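(* Let $c:[t_0,\infty)\to P$, $t\mapsto c_t$, be the unique $C^1$ solution of the noncommutative Ricci flow $\frac{d}{dt}c_t=-\triangle\log c_t$ with a given initial value $c_{t_0}\in P$. Then the eigenvalues and normalized eigenvectors of the Laplace–Beltrami operators $\triangle_{c_t}:H_{c_t}\to H_{c_t}$ can be chosen as analytic functions of $t\in[t_0,\infty)$, and for each such analytic eigenvalue $\lambda_t$ with corresponding analytic eigenvector $a_t\in H_{c_t}$ normalized by $\langle a_t,a_t\rangle_{c_t}=1$, one has \[ \frac{d\lambda_t}{dt}=\lambda_t\,\tau\big(|a_t|^2\,\triangle\log c_t\big),\qquad |a_t|^2:=a_t^*a_t, \] for all $t\in[t_0,\infty)$ (at $t=t_0$ the derivative being the right-hand derivative).
   Context: Fix integers $n\ge 2$ and $m\in\{1,\dots,n-1\}$ with $\gcd(m,n)=1$, and put $q=e^{2\pi i m/n}$. Let $A=M_n$ be the algebra of complex $n\times n$ matrices with the conjugate-transpose involution $a\mapsto a^*$, unit $I$, and usual trace $\tau$. Let $u,v\in A$ be unitary matrices generating $A$ with $vu=quv$. Choose Hermitian matrices $x,y$ with $u=e^{2\pi i x/n}$ and $v=e^{2\pi i y/n}$, and define derivations $\delta_1=[y,\cdot\,]$, $\delta_2=-[x,\cdot\,]$ on $A$. The (flat) Laplacian is $\triangle=\delta_1^2+\delta_2^2$, i.e. $\triangle a=[y,[y,a]]+[x,[x,a]]$. Let $P=\{a\in A: a \text{ Hermitian with all eigenvalues strictly positive}\}$ (noncommutative metrics); for $a\in P$, $\log a$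 is defined via the spectral decomposition. For $c\in P$, $H_c$ denotes the vector space $A$ with inner product $\langle a,b\rangle_c=\tau(c\,a^*b)$. The Laplace–Beltrami operator for the metric $c$ is $\triangle_c:H_c\to H_c$, $\triangle_c a=(\triangle a)\,c^{-1}$ (product in $A$). It is known that the Ricci flow initial value problem has a unique $C^1$ solution in $P$ on $[t_0,\infty)$, and that it is analytic in $t$. *)

(* Defs.v *)
From Stdlib Require Import Reals Lra Lia Arith List ClassicalEpsilon.
Open Scope R_scope.

Definition Cx : Type := (R * R)%type.
Definition Cx0 : Cx := (0, 0).
Definition Cx1 : Cx := (1, 0).
Definition RtoC (r : R) : Cx := (r, 0).
Definition Cadd (a b : Cx) : Cx := (fst a + fst b, snd a + snd b).
Definition Copp (a : Cx) : Cx := (- fst a, - snd a).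
Definition Cmul (a b : Cx) : Cx :=
  (fst a * fst b - snd a * snd b, fst a * snd b + snd a * fst b).
Definition Cconj (a : Cx) : Cx := (fst a, - snd a).
Definition Cexpi (theta : R) : Cx := (cos theta, sin theta).

Fixpoint Csum (f : nat -> Cx) (N : nat) : Cx :=
  match N with
  | O => Cx0
  | S k => Cadd (Csum f k) (f k)
  end.

(* ---------- n x n complex matrices: entries (i,j) with i,j < n ---------- *)
Definition Mat : Type := nat -> nat -> Cx.
Definition Meq (n : nat) (A B : Mat) : Prop :=
  forall i j, (i < n)%nat -> (j < n)%nat -> A i j = B i j.
Definition Mid : Mat := fun i j => if Nat.eqb i j then Cx1 else Cx0.
Definition Mzero : Mat := fun _ _ => Cx0.
Definition Madd (A B : Mat) : Mat := fun i j => Cadd (A i j) (B i j).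
Definition Mopp (A : Mat) : Mat := fun i j => Copp (A i j).
Definition Msub (A B : Mat) : Mat := Madd A (Mopp B).
Definition Mscal (z : Cx) (A : Mat) : Mat := fun i j => Cmul z (A i j).
Definition Mmul (n : nat) (A B : Mat) : Mat :=
  fun i j => Csum (fun k => Cmul (A i k) (B k j)) n.
Definition Madj (A : Mat) : Mat := fun i j => Cconj (A j i).
Definition Mtr (n : nat) (A : Mat) : Cx := Csum (fun i => A i i) n.
Definition Mdiag (d : nat -> Cx) : Mat := fun i j => if Nat.eqb i j then d i else Cx0.

Definition unitary (n : nat) (U : Mat) : Prop :=
  Meq n (Mmul n (Madj U) U) Mid /\ Meq n (Mmul n U (Madj U)) Mid.
Definition hermitian (n : nat) (A : Mat) : Prop := Meq n (Madj A) A.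

Definition Mcomm (n : nat) (A B : Mat) : Mat := Msub (Mmul n A B) (Mmul n B A).

Definition eigenpair (n : nat) (A : Mat) (z : Cx) (w : nat -> Cx) : Prop :=
  (exists i, (i < n)%nat /\ w i <> Cx0) /\
  forall i, (i < n)%nat -> Csum (fun j => Cmul (A i j) (w j)) n = Cmul z (w i).

Definition posdef (n : nat) (A : Mat) : Prop :=
  hermitian n A /\
  forall z w, eigenpair n A z w -> snd z = 0 /\ 0 < fst z.

Definition is_fcalc (n : nat) (f : R -> Cx) (A B : Mat) : Prop :=
  exists (U : Mat) (d : nat -> R),
    unitary n U /\
    Meq n A (Mmul n (Mmul n U (Mdiag (fun k => RtoC (d k)))) (Madj U)) /\
    Meq n B (Mmul n (Mmul n U (Mdiag (fun k => f (d k)))) (Madj U)).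

Definition is_log (n : nat) (A B : Mat) : Prop :=
  exists (U : Mat) (d : nat -> R),
    unitary n U /\ (forall k, (k < n)%nat -> 0 < d k) /\
    Meq n A (Mmul n (Mmul n U (Mdiag (fun k => RtoC (d k)))) (Madj U)) /\
    Meq n B (Mmul n (Mmul n U (Mdiag (fun k => RtoC (ln (d k))))) (Madj U)).

Definition Mlog (n : nat) (A : Mat) : Mat :=
  epsilon (inhabits Mzero) (is_log n A).

(* inverse matrix (chosen; unique for invertible A) *)
Definition Minv (n : nat) (A : Mat) : Mat :=
  epsilon (inhabits Mzero)
    (fun B => Meq n (Mmul n A B) Mid /\ Meq n (Mmul n B A) Mid).

Fixpoint word (n : nat) (u v : Mat) (w : list bool) : Mat :=
  match w with
  | nil => Mid
  | true :: l => Mmul n u (word n u v l)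
  | false :: l => Mmul n v (word n u v l)
  end.
Fixpoint Msum (F : nat -> Mat) (N : nat) : Mat :=
  match N with
  | O => Mzero
  | S k => Madd (Msum F k) (F k)
  end.
Definition generates (n : nat) (u v : Mat) : Prop :=
  forall A : Mat, exists (N : nat) (cf : nat -> Cx) (ws : nat -> list bool),
    Meq n A (Msum (fun k => Mscal (cf k) (word n u v (ws k))) N).

Definition Lap (n : nat) (x y : Mat) (a : Mat) : Mat :=
  Madd (Mcomm n y (Mcomm n y a)) (Mcomm n x (Mcomm n x a)).
Definition LB (n : nat) (x y : Mat) (c : Mat) (a : Mat) : Mat :=
  Mmul n (Lap n x y a) (Minv n c).
Definition ipc (n : nat) (c a b : Mat) : Cx := Mtr n (Mmul n c (Mmul n (Madj a) b)).

Definition Ici (t0 : R) : R -> Prop := fun t => t0 <= t.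

Definition Rderiv_within (D : R -> Prop) (f : R -> R) (t l : R) : Prop :=
  forall eps, 0 < eps -> exists delta, 0 < delta /\
    forall s, D s -> s <> t -> Rabs (s - t) < delta ->
      Rabs ((f s - f t) / (s - t) - l) < eps.
Definition Rcont_within (D : R -> Prop) (f : R -> R) (t : R) : Prop :=
  forall eps, 0 < eps -> exists delta, 0 < delta /\
    forall s, D s -> Rabs (s - t) < delta -> Rabs (f s - f t) < eps.
Definition Ranalytic_on (D : R -> Prop) (f : R -> R) : Prop :=
  forall t, D t -> exists (coef : nat -> R) (r : R), 0 < r /\
    forall s, D s -> Rabs (s - t) < r ->
      Un_cv (fun N => sum_f_R0 (fun k => coef k * (s - t) ^ k) N) (f s).

Definition Cderiv_within (D : R -> Prop) (f : R -> Cx) (t : R) (l : Cx) : Prop :=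
  Rderiv_within D (fun s => fst (f s)) t (fst l) /\
  Rderiv_within D (fun s => snd (f s)) t (snd l).
Definition Ccont_within (D : R -> Prop) (f : R -> Cx) (t : R) : Prop :=
  Rcont_within D (fun s => fst (f s)) t /\ Rcont_within D (fun s => snd (f s)) t.
Definition Canalytic_on (D : R -> Prop) (f : R -> Cx) : Prop :=
  Ranalytic_on D (fun s => fst (f s)) /\ Ranalytic_on D (fun s => snd (f s)).

Definition Mderiv_within (n : nat) (D : R -> Prop) (f : R -> Mat) (t : R) (l : Mat) : Prop :=
  forall i j, (i < n)%nat -> (j < n)%nat -> Cderiv_within D (fun s => f s i j) t (l i j).
Definition Mcont_within (n : nat) (D : R -> Prop) (f : R -> Mat) (t : R) : Prop :=
  forall i j, (i < n)%nat -> (j < n)%nat -> Ccont_within D (fun s => f s i j) t.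
Definition Manalytic_on (n : nat) (D : R -> Prop) (f : R -> Mat) : Prop :=
  forall i j, (i < n)%nat -> (j < n)%nat -> Canalytic_on D (fun s => f s i j).

Definition C1_on (n : nat) (D : R -> Prop) (f : R -> Mat) : Prop :=
  exists f' : R -> Mat,
    (forall t, D t -> Mderiv_within n D f t (f' t)) /\
    (forall t, D t -> Mcont_within n D f' t).

(* Main.v *)
(* The flow is analytic: near a time s put w = 1 - c / K with K above the trace of c, so that
   -log (c / K) = sum_k w^(k+1) / (k+1) and w solves w' = - K^-1 Lap (-log (1 - w)), whose formal
   power series solution converges (majorant estimate in a norm with |w_s| < 1) and is the only
   solution (Lipschitz estimate).  This also continues c analytically to the left of t0.

   The eigenvalue equation Lap a = lambda a c is a Hermitian pencil with analytic, uniformly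
   positive weight.  Following Rellich, the characteristic polynomial is real-rooted; after
   centring, its second power sum is t^(2k) times a nonvanishing function, so dividing the roots
   by t^k gives an analytic polynomial whose roots at t = 0 are not all equal, and Hensel's lemma
   splits it.  Local branches are continued along the interval.  Eigenvectors come one at a time:
   an analytic kernel vector, normalised by an analytic square root, followed by a rank-one shift
   of its eigenvalue.

   For the derivative, self-adjointness of Lap gives
   (lambda_s - lambda_t) tr (c_s a_t^* a_s) = - lambda_t tr ((c_s - c_t) a_t^* a_s);
   divide by s - t and let s tend to t. *)

Require Import Defs.
From Stdlib Require Import Reals ClassicalEpsilon Arith.
From HB Require structures.
From mathcomp Require all_boot all_order all_algebra complex Rstruct ring lra.
From Coquelicot Require Rbar Lim_seq Hierarchy Series PSeries Derive Continuity.

(* The module confines MathComp's boolean reading of [<=] and [<] on [nat]. *)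
Module RicciFlow.
Import HB.structures.
Import all_boot all_order all_algebra complex Rstruct ring lra.
Import Rbar Lim_seq Hierarchy Series PSeries Derive Continuity.
Import Defs.
Import GRing.Theory Num.Theory Order.TTheory ComplexField.
Set Implicit Arguments.
Unset Strict Implicit.
Unset Printing Implicit Defensive.
Local Open Scope ring_scope.
Local Open Scope complex_scope.

(** Analyticity in a real parameter is handled through coefficient sequences with a bounded weighted
    [l1] norm, which is submultiplicative; one fixed-point lemma, [anat_quadratic], then yields both
    reciprocals and Hensel's factorization.

    Real-rootedness must be known on both sides of a time: [X^2 - (t - t0)] has real roots for
    [t >= t0] but no analytic root there. This is the obstacle at the initial time and the reason
    for continuing [c] to the left of [t0], inside the positive Hermitian matrices.

    Multiplicities may change at isolated times, so eigenspaces cannot be followed pointwise. The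
    linear algebra is done over the analytic functions on an open interval, which form an integral
    domain: elimination avoids inverses, a root of a product is a root of one factor, and a nonzero
    vector may still vanish at isolated times. The analytic square root that removes these zeros is
    again a branch of a real-rooted polynomial. Eigenvalues already treated are moved to the
    non-real number [ii], so they never meet a remaining one, even where branches cross. *)

Local Notation C := (complex R).
Local Notation Re := (@complex.Re R).
Local Notation Im := (@complex.Im R).
Local Notation nc := (@Normc.normc R).

(** * Real part, imaginary part and modulus of complex numbers *)

Lemma cReD (x y : C) : Re (x + y) = Re x + Re y. Proof. by case: x y => [? ?] []. Qed.
Lemma cImD (x y : C) : Im (x + y) = Im x + Im y. Proof. by case: x y => [? ?] []. Qed.
Lemma cReM (x y : C) : Re (x * y) = Re x * Re y - Im x * Im y.
Proof. by case: x y => [? ?] []. Qed.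
Lemma cImM (x y : C) : Im (x * y) = Re x * Im y + Im x * Re y.
Proof. by case: x y => [? ?] []. Qed.
Lemma cReN (x : C) : Re (- x) = - Re x. Proof. by case: x. Qed.
Lemma cImN (x : C) : Im (- x) = - Im x. Proof. by case: x. Qed.
Lemma Csum_Re I (r : seq I) (P : pred I) (F : I -> C) :
  Re (\sum_(i <- r | P i) F i) = \sum_(i <- r | P i) Re (F i).
Proof. by elim/big_rec2: _ => // i a b _ <-; rewrite cReD. Qed.
Lemma Csum_Im I (r : seq I) (P : pred I) (F : I -> C) :
  Im (\sum_(i <- r | P i) F i) = \sum_(i <- r | P i) Im (F i).
Proof. by elim/big_rec2: _ => // i a b _ <-; rewrite cImD. Qed.
Lemma cReRM (t : R) (x : C) : Re (t%:C * x) = t * Re x.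
Proof. by rewrite cReM /= mul0r subr0. Qed.
Lemma cImRM (t : R) (x : C) : Im (t%:C * x) = t * Im x.
Proof. by rewrite cImM /= mul0r addr0. Qed.

Lemma nc_ge0 (x : C) : 0 <= nc x. Proof. by case: x => a b; rewrite sqrtr_ge0. Qed.
Lemma ncM (x y : C) : nc (x * y) = nc x * nc y. Proof. exact: Normc.normcM. Qed.
Lemma ncD (x y : C) : nc (x + y) <= nc x + nc y. Proof. exact: le_normcD. Qed.
Lemma ncN (x : C) : nc (- x) = nc x. Proof. exact: normcN. Qed.
Lemma ncB (x y : C) : nc (x - y) <= nc x + nc y. Proof. by rewrite -(ncN y) ncD. Qed.
Lemma nc0 : nc 0 = 0. Proof. exact: Normc.normc0. Qed.
Lemma nc1 : nc 1 = 1. Proof. exact: Normc.normc1. Qed.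
Lemma ncX (x : C) k : nc (x ^+ k) = nc x ^+ k.
Proof. by elim: k => [|k IH]; rewrite ?expr0 ?nc1 // !exprS ncM IH. Qed.
Lemma ncR (t : R) : nc t%:C = `|t|.
Proof. by rewrite /= expr0n addr0 sqrtr_sqr. Qed.
Lemma nc_sqr (x : C) : nc x ^+ 2 = Re x ^+ 2 + Im x ^+ 2.
Proof. by case: x => a b /=; rewrite sqr_sqrtr // addr_ge0 ?sqr_ge0. Qed.
Lemma nc_Re (x : C) : `|Re x| <= nc x.
Proof. by rewrite -ler_sqr ?nnegrE ?nc_ge0 // nc_sqr real_normK ?num_real // lerDl sqr_ge0. Qed.
Lemma nc_Im (x : C) : `|Im x| <= nc x.
Proof. by rewrite -ler_sqr ?nnegrE ?nc_ge0 // nc_sqr real_normK ?num_real // lerDr sqr_ge0. Qed.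
Lemma nc_le (x : C) : nc x <= `|Re x| + `|Im x|.
Proof.
rewrite -ler_sqr ?nnegrE ?nc_ge0 ?addr_ge0 // nc_sqr sqrrD !real_normK ?num_real //.
by rewrite -addrA lerD2l lerDr mulrn_wge0 // mulr_ge0.
Qed.
Lemma nc_eq0 (x : C) : nc x = 0 -> x = 0. Proof. exact: Normc.eq0_normc. Qed.
Lemma nc_gt0 (x : C) : x != 0 -> 0 < nc x.
Proof. by move=> x0; rewrite lt_def nc_ge0 andbT; apply/eqP => /nc_eq0/eqP; exact/negP. Qed.
Lemma nc_sum I (r : seq I) (P : pred I) (F : I -> C) :
  nc (\sum_(i <- r | P i) F i) <= \sum_(i <- r | P i) nc (F i).
Proof.
elim/big_rec2: _ => [|i a b _ h]; first by rewrite nc0.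
by apply: (le_trans (ncD _ _)); rewrite lerD2l.
Qed.
Lemma ncBC (x y : C) : nc (x - y) = nc (y - x). Proof. by rewrite -ncN opprB. Qed.

Arguments Normc.normc : simpl never.

(** * Complex sequences and series *)

(** Coordinatewise, so that the real limit theorems apply directly; [climP] is the form with the
    modulus. *)
Definition clim (u : nat -> C) (l : C) :=
  is_lim_seq (fun n => Re (u n)) (Finite (Re l)) /\
  is_lim_seq (fun n => Im (u n)) (Finite (Im l)).

Lemma is_lim_seq_eps (u : nat -> R) (l : R) :
  is_lim_seq u (Finite l) <->
  forall e, 0 < e -> exists n0, forall n, (n0 <= n)%N -> `|u n - l| < e.
Proof.
split=> [/is_lim_seq_spec h e e0|h].
  have /RltP e0' := e0.
  have [n0 hn] := h (mkposreal e e0').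
  exists n0 => n le; apply/RltP; rewrite -RabsE; apply: hn.
  exact/ssrnat.leP.
apply/is_lim_seq_spec => e.
have e0 : 0 < (e : R) by apply/RltP; case: e.
have [n0 hn] := h _ e0.
by exists n0 => n /ssrnat.leP le; rewrite RabsE; apply/RltP; exact: hn.
Qed.

Lemma climP u l :
  clim u l <-> forall e, 0 < e -> exists n0, forall n, (n0 <= n)%N -> nc (u n - l) < e.
Proof.
split=> [[/is_lim_seq_eps h1 /is_lim_seq_eps h2] e e0|h].
  have e2 : 0 < e / 2%:R by lra.
  have [n1 h1'] := h1 _ e2; have [n2 h2'] := h2 _ e2.
  exists (maxn n1 n2) => n; rewrite geq_max => /andP[le1 le2].
  apply: (le_lt_trans (nc_le _)); rewrite cReD cReN cImD cImN.
  by have := h1' _ le1; have := h2' _ le2; lra.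
split; apply/is_lim_seq_eps => e e0; have [n0 hn] := h e e0; exists n0 => n le;
  apply: le_lt_trans (hn n le).
  by rewrite -cReN -cReD nc_Re.
by rewrite -cImN -cImD nc_Im.
Qed.

Lemma clim_ext u v l : u =1 v -> clim u l -> clim v l.
Proof.
move=> e [h1 h2]; split; [apply: is_lim_seq_ext h1|apply: is_lim_seq_ext h2] => n;
  by rewrite e.
Qed.

Lemma clim_cst a : clim (fun=> a) a.
Proof. by split; apply: is_lim_seq_const. Qed.

Lemma climD u v l m : clim u l -> clim v m -> clim (fun n => u n + v n) (l + m).
Proof.
move=> [h1 h2] [h3 h4]; split.
  apply: (is_lim_seq_ext (fun n => Rplus (Re (u n)) (Re (v n)))) => [n|]; first by rewrite cReD.
  by rewrite cReD; apply: is_lim_seq_plus'.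
apply: (is_lim_seq_ext (fun n => Rplus (Im (u n)) (Im (v n)))) => [n|]; first by rewrite cImD.
by rewrite cImD; apply: is_lim_seq_plus'.
Qed.

Lemma climM u v l m : clim u l -> clim v m -> clim (fun n => u n * v n) (l * m).
Proof.
move=> [h1 h2] [h3 h4]; split.
  apply: (is_lim_seq_ext (fun n => Rminus (Rmult (Re (u n)) (Re (v n)))
           (Rmult (Im (u n)) (Im (v n))))) => [n|]; first by rewrite cReM.
  by rewrite cReM; apply: is_lim_seq_minus'; apply: is_lim_seq_mult'.
apply: (is_lim_seq_ext (fun n => Rplus (Rmult (Re (u n)) (Im (v n)))
         (Rmult (Im (u n)) (Re (v n))))) => [n|]; first by rewrite cImM.
by rewrite cImM; apply: is_lim_seq_plus'; apply: is_lim_seq_mult'.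
Qed.

Lemma climZ a u l : clim u l -> clim (fun n => a * u n) (a * l).
Proof. exact: climM (clim_cst a). Qed.

Lemma clim_sum (I : finType) (P : pred I) (u : I -> nat -> C) l :
  (forall i, clim (u i) (l i)) ->
  clim (fun n => \sum_(i | P i) u i n) (\sum_(i | P i) l i).
Proof.
move=> h; elim: (index_enum I) => [|i r IH].
  by rewrite big_nil; apply: (clim_ext (u := fun=> 0)) => [n|]; rewrite ?big_nil //; exact: clim_cst.
rewrite big_cons; case: ifP => Pi.
  by apply: (clim_ext _ (climD (h i) IH)) => n; rewrite big_cons Pi.
by apply: (clim_ext _ IH) => n; rewrite big_cons Pi.
Qed.

Lemma clim_uniq u l m : clim u l -> clim u m -> l = m.
Proof.
move=> [h1 h2] [h3 h4]; have := is_lim_seq_unique _ _ h1; rewrite (is_lim_seq_unique _ _ h3) => -[e1].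
have := is_lim_seq_unique _ _ h2; rewrite (is_lim_seq_unique _ _ h4) => -[e2].
by case: l m e1 e2 {h1 h2 h3 h4} => [? ?] [? ?] /= -> ->.
Qed.

Lemma clim_incr u l k : clim u l <-> clim (fun n => u (n + k)%N) l.
Proof.
have h f := is_lim_seq_incr_n (fun n => f (u n) : R) k.
by split=> -[h1 h2]; split; 
  [exact: (proj1 (h Re _))|exact: (proj1 (h Im _))|exact: (proj2 (h Re _))|exact: (proj2 (h Im _))].
Qed.

Lemma lim_le_const (u : nat -> R) (l B : R) :
  is_lim_seq u (Finite l) -> (forall n, u n <= B) -> l <= B.
Proof.
move=> h le; apply/RleP.
have := is_lim_seq_le _ _ _ _ (fun n => elimT RleP (le n)) h (is_lim_seq_const B).
by [].
Qed.

Lemma clim_nc u l : clim u l -> is_lim_seq (fun n => nc (u n)) (Finite (nc l)).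
Proof.
move=> /climP h; apply/is_lim_seq_eps => e /h[n0 hn]; exists n0 => n /hn.
apply: le_lt_trans; have h1 := ncD (u n - l) l; have h2 := ncD (l - u n) (u n).
rewrite !subrK in h1 h2; rewrite (ncBC l) in h2; rewrite ler_norml; lra.
Qed.

Lemma clim_nc_le u l B : clim u l -> (forall n, nc (u n) <= B) -> nc l <= B.
Proof. by move=> /clim_nc; exact: lim_le_const. Qed.

Definition csum (u : nat -> C) (l : C) := clim (fun n => \sum_(k < n) u k) l.

Lemma is_series_lim (a : nat -> R) (l : R) :
  is_series a l <-> is_lim_seq (fun n => \sum_(k < n) a k) (Finite l).
Proof.
rewrite is_lim_seq_incr_1.
have e n : sum_n a n = \sum_(k < n.+1) a k.
  by rewrite sum_n_Reals sum_f_R0E big_mkord.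
split=> h.
  by have h' : is_lim_seq (sum_n a) (Finite l) := h; apply: is_lim_seq_ext h' => n.
suff h' : is_lim_seq (sum_n a) (Finite l) by [].
by apply: is_lim_seq_ext h => n; rewrite e.
Qed.

Lemma csumE u l : csum u l <-> is_series (fun k => Re (u k)) (Re l) /\
   is_series (fun k => Im (u k)) (Im l).
Proof.
rewrite /csum /clim !is_series_lim; split=> -[h1 h2]; split;
  [apply: is_lim_seq_ext h1|apply: is_lim_seq_ext h2|
   apply: is_lim_seq_ext h1|apply: is_lim_seq_ext h2] => n; by rewrite ?Csum_Re ?Csum_Im.
Qed.

Lemma csum_ext u v l : u =1 v -> csum u l -> csum v l.
Proof. by move=> e; apply: clim_ext => n; apply: eq_bigr => i _. Qed.

Lemma csumD u v l m : csum u l -> csum v m -> csum (fun n => u n + v n) (l + m).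
Proof. by move=> h1 h2; apply: (clim_ext _ (climD h1 h2)) => n; rewrite big_split. Qed.

Lemma csumZ a u l : csum u l -> csum (fun n => a * u n) (a * l).
Proof. by move=> h; apply: (clim_ext _ (climZ a h)) => n; rewrite mulr_sumr. Qed.

Lemma csum_sum (I : finType) (P : pred I) (u : I -> nat -> C) l :
  (forall i, csum (u i) (l i)) ->
  csum (fun n => \sum_(i | P i) u i n) (\sum_(i | P i) l i).
Proof. by move=> h; apply: (clim_ext _ (clim_sum P h)) => n; rewrite exchange_big. Qed.

Lemma csum_uniq u l m : csum u l -> csum u m -> l = m.
Proof. exact: clim_uniq. Qed.

Lemma nonneg_bounded_series (x : nat -> R) B : (forall k, 0 <= x k) ->
  (forall n, \sum_(k < n) x k <= B) -> ex_series x.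
Proof.
move=> x0 hB.
have [l hl] : ex_finite_lim_seq (fun n => \sum_(k < n) x k).
  apply: (ex_finite_lim_seq_incr _ B) => n; apply/RleP => //.
  by rewrite big_ord_recr /= lerDl.
by exists l; apply/is_series_lim.
Qed.

Lemma sum_le_trans_nc (f : C -> R) (u : nat -> C) B : (forall z, `|f z| <= nc z) ->
  (forall n, \sum_(k < n) nc (u k) <= B) -> ex_series (fun k => Rabs (f (u k))).
Proof.
move=> hf h; apply: (@nonneg_bounded_series _ B) => [k|n]; first by rewrite RabsE.
by apply: le_trans (h n); apply: ler_sum => i _; rewrite RabsE.
Qed.

Lemma csum_ex (u : nat -> C) B : (forall n, \sum_(k < n) nc (u k) <= B) ->
  exists2 l, csum u l & nc l <= B.
Proof.
move=> h.
have [a ha] := ex_series_Rabs _ (sum_le_trans_nc nc_Re h).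
have [b hb] := ex_series_Rabs _ (sum_le_trans_nc nc_Im h).
have hl : csum u (a +i* b) by apply/csumE.
exists (a +i* b) => //; apply: (clim_nc_le hl) => n.
exact: le_trans (nc_sum _ _ _) (h n).
Qed.

Lemma csum_nc_le (u : nat -> C) l B : (forall n, \sum_(k < n) nc (u k) <= B) -> csum u l -> nc l <= B.
Proof. by move=> /csum_ex[m hm le] /csum_uniq /(_ hm) ->. Qed.

Definition conv (a b : nat -> C) n := \sum_(i < n.+1) a i * b (n - i)%N.

(** Absolute convergence gives four real Cauchy products, which combine to the real and imaginary
    parts. *)
Lemma csum_conv (a b : nat -> C) la lb A B : (forall n, \sum_(k < n) nc (a k) <= A) ->
  (forall n, \sum_(k < n) nc (b k) <= B) ->
  csum a la -> csum b lb -> csum (conv a b) (la * lb).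
Proof.
move=> hA hB /csumE[a1 a2] /csumE[b1 b2]; apply/csumE.
have A1 := sum_le_trans_nc nc_Re hA; have A2 := sum_le_trans_nc nc_Im hA.
have B1 := sum_le_trans_nc nc_Re hB; have B2 := sum_le_trans_nc nc_Im hB.
have E (f g : C -> R) n :
    sum_f_R0 (fun k => Rmult (f (a k)) (g (b (n - k)%coq_nat))) n =
    \sum_(i < n.+1) f (a i) * g (b (n - i)%N).
  by rewrite sum_f_R0E big_mkord.
split.
  rewrite cReM; have := is_series_minus _ _ _ _ (is_series_mult _ _ _ _ a1 b1 A1 B1)
     (is_series_mult _ _ _ _ a2 b2 A2 B2).
  apply: is_series_ext => n; rewrite !E /conv Csum_Re.
  by under [RHS]eq_bigr do rewrite cReM; rewrite big_split sumrN.
rewrite cImM; have := is_series_plus _ _ _ _ (is_series_mult _ _ _ _ a1 b2 A1 B2)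
   (is_series_mult _ _ _ _ a2 b1 A2 B1).
apply: is_series_ext => n; rewrite !E /conv Csum_Im.
by under [RHS]eq_bigr do rewrite cImM; rewrite big_split.
Qed.

(* The triangle [i + j < n] lies inside the square [i, j < n]. *)
Lemma sum_triangle (x y : nat -> R) n : (forall k, 0 <= x k) -> (forall k, 0 <= y k) ->
  \sum_(k < n) \sum_(i < k.+1) x i * y (k - i)%N <= (\sum_(i < n) x i) * (\sum_(j < n) y j).
Proof.
move=> x0 y0.
have -> : \sum_(k < n) \sum_(i < k.+1) x i * y (k - i)%N =
          \sum_(i < n) \sum_(j < n - i) x i * y j.
  elim: n => [|n IH]; first by rewrite !big_ord0.
  rewrite big_ord_recr /= IH.
  transitivity (\sum_(i < n.+1) (\sum_(j < n - i) x i * y j + x i * y (n - i)%N)).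
    by rewrite big_split /= [in RHS]big_ord_recr /= subnn big_ord0 addr0.
  apply: eq_bigr => i _.
  by rewrite [in RHS]subSn ?big_ord_recr // -ltnS.
rewrite mulr_suml; apply: ler_sum => i _; rewrite mulr_sumr.
rewrite (big_ord_widen n (fun j => x i * y j)) ?leq_subr // big_mkcond /=.
by apply: ler_sum => j _; case: ifP => // _; rewrite mulr_ge0.
Qed.

Lemma geom_le (x : R) n : 0 <= x -> x < 1 -> \sum_(k < n) x ^+ k <= (1 - x)^-1.
Proof.
move=> x0 x1; have d0 : 0 < 1 - x by lra.
rewrite -[leRHS]mul1r ler_pdivlMr // mulrC.
have -> : (1 - x) * (\sum_(k < n) x ^+ k) = 1 - x ^+ n.
  by rewrite -[in RHS](expr1n _ n) subrXX; congr (_ * _); apply: eq_bigr => i _; rewrite expr1n mul1r.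
by rewrite gerBl exprn_ge0.
Qed.

Lemma geom_lim (x : R) : 0 <= x -> x < 1 -> is_lim_seq (fun n => x ^+ n) (Finite 0).
Proof.
move=> x0 x1; apply: (is_lim_seq_ext (fun n => pow x n)) => [n|]; first by rewrite RpowE.
by apply: is_lim_seq_geom; rewrite RabsE ger0_norm //; apply/RltP.
Qed.

Lemma csum_tail (u : nat -> C) l A (y : R) n : 0 <= y -> y < 1 ->
  (forall k, nc (u k) <= A * y ^+ k) -> csum u l ->
  nc (l - \sum_(k < n) u k) <= A * y ^+ n / (1 - y).
Proof.
move=> y0 y1 hu hl.
have A0 : 0 <= A by have := hu 0%N; rewrite expr0 mulr1; apply: le_trans; exact: nc_ge0.
have h : clim (fun m => \sum_(k < m + n) u k - \sum_(k < n) u k) (l - \sum_(k < n) u k).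
  by apply: (climD _ (clim_cst _)); exact: (proj1 (clim_incr _ _ n) hl).
apply: (clim_nc_le h) => m.
rewrite addnC big_split_ord /= [X in X - _]addrC addrK.
apply: (le_trans (nc_sum _ _ _)).
apply: (@le_trans _ _ (\sum_(i < m) (A * y ^+ n) * y ^+ i)).
  by apply: ler_sum => i _; rewrite -mulrA -exprD.
by rewrite -mulr_sumr ler_wpM2l ?geom_le // mulr_ge0 ?exprn_ge0.
Qed.

(** Both iterated sums, cut after [n] terms, differ from the sum over the [n] by [n] square by at
    most [D * x ^+ n], where [D = B / (1 - x) ^+ 2]. *)
Lemma csum_swap (u : nat -> nat -> C) c d l B (x : R) : 0 <= x -> x < 1 ->
  (forall j k, nc (u j k) <= B * x ^+ j * x ^+ k) ->
  (forall j, csum (u j) (c j)) -> (forall k, csum (fun j => u j k) (d k)) ->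
  csum d l -> csum c l.
Proof.
move=> x0 x1 hu hc hd /climP hl; apply/climP => e e0.
have e2 : 0 < e / 2%:R by lra.
have [n1 h1] := hl _ e2.
have B0 : 0 <= B.
  by have := hu 0%N 0%N; rewrite !expr0 !mulr1; apply: le_trans; exact: nc_ge0.
pose D := B / (1 - x) / (1 - x).
have d0 : 0 < (1 - x)^-1 by rewrite invr_gt0; lra.
have D0 : 0 <= D by rewrite /D !mulr_ge0 // ltW.
have De : 0 < e / 4%:R / (D + 1).
  by rewrite divr_gt0 //; lra.
have [n2 h2] := proj1 (is_lim_seq_eps _ _) (geom_lim x0 x1) _ De.
exists (maxn n1 n2) => n; rewrite geq_max => /andP[/h1 le1 /h2].
rewrite subr0 ger0_norm ?exprn_ge0 // => le2.
have tail (v : nat -> nat -> C) (m : nat -> C) : (forall j, nc (m j - \sum_(k < n) v j k) <= B * x ^+ j * x ^+ n / (1 - x)) ->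
    nc (\sum_(j < n) m j - \sum_(j < n) \sum_(k < n) v j k) <= D * x ^+ n.
  move=> h; rewrite -sumrB; apply: (le_trans (nc_sum _ _ _)).
  apply: (@le_trans _ _ (\sum_(j < n) (B * x ^+ n / (1 - x)) * x ^+ j)).
    by apply: ler_sum => j _; apply: (le_trans (h j)); rewrite le_eqVlt; apply/orP; left; apply/eqP; ring.
  rewrite -mulr_sumr; apply: (@le_trans _ _ ((B * x ^+ n / (1 - x)) * (1 - x)^-1)).
    by rewrite ler_wpM2l ?geom_le // !mulr_ge0 ?exprn_ge0 // ltW.
  by rewrite le_eqVlt /D; apply/orP; left; apply/eqP; ring.
have t1 : nc (\sum_(j < n) c j - \sum_(j < n) \sum_(k < n) u j k) <= D * x ^+ n.
  by apply: (tail u c) => j; apply: csum_tail (hu j) (hc j).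
have t2 : nc (\sum_(k < n) d k - \sum_(k < n) \sum_(j < n) u j k) <= D * x ^+ n.
  apply: (tail (fun k j => u j k) d) => k; apply: csum_tail (hd k) => // j.
  by rewrite mulrAC.
rewrite exchange_big in t2.
have t3 : D * x ^+ n < e / 4%:R.
  move: le2; rewrite ltr_pdivlMr; last by lra.
  apply: le_lt_trans; rewrite mulrC ler_wpM2l ?exprn_ge0 //; lra.
set X := \sum_(j < n) c j in t1 *; set Y := \sum_(k < n) d k in t2 le1.
set Z := \sum_(j < n) _ in t1; rewrite -/Z in t2.
have -> : X - l = (X - Z) + ((Z - Y) + (Y - l)) by ring.
apply: (le_lt_trans (ncD _ _)).
have := ncD (Z - Y) (Y - l); rewrite (ncBC Z).
lra.
Qed.

(** A total choice of the sum; it carries meaning only through [csum_valE], when the series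
    converges. *)
Definition csum_val (u : nat -> C) : C :=
  Series (fun k => Re (u k)) +i* Series (fun k => Im (u k)).

Lemma csum_valE u l : csum u l -> csum_val u = l.
Proof.
move=> /csumE[h1 h2]; rewrite /csum_val (is_series_unique _ _ h1) (is_series_unique _ _ h2).
by case: l {h1 h2}.
Qed.

Lemma csum_valP (u : nat -> C) B : (forall n, \sum_(k < n) nc (u k) <= B) -> csum u (csum_val u).
Proof. by move=> /csum_ex[l hl _]; rewrite (csum_valE hl). Qed.

Lemma csum1 (u : nat -> C) : (forall k, u k.+1 = 0) -> csum u (u 0%N).
Proof.
move=> h; apply/(clim_incr _ _ 1); apply: clim_ext (clim_cst (u 0%N)) => n.
by rewrite addn1 big_ord_recl big1 ?addr0 // => i _; rewrite /= h.
Qed.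

(** * Convergent power series *)

(** Bounds on partial sums rather than a norm: they can be proved by induction on [n], before
    convergence is known. *)
Definition l1 (r : R) (a : nat -> C) (B : R) :=
  forall n, \sum_(k < n) nc (a k) * r ^+ k <= B.
Definition psum (a : nat -> C) (t : R) (l : C) := csum (fun k => a k * t%:C ^+ k) l.

Lemma l1_ge0 r a B : l1 r a B -> 0 <= B.
Proof. by move=> /(_ 0%N); rewrite big_ord0. Qed.

Lemma l1_le r r' a B : 0 <= r' -> r' <= r -> l1 r a B -> l1 r' a B.
Proof.
move=> r0 le h n; apply: le_trans (h n); apply: ler_sum => k _.
by rewrite ler_wpM2l ?nc_ge0 // lerXn2r ?nnegrE //; apply: le_trans le.
Qed.

Lemma l1_term r a B k : 0 <= r -> l1 r a B -> nc (a k) * r ^+ k <= B.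
Proof.
move=> r0 /(_ k.+1); rewrite big_ord_recr /=; apply: le_trans; rewrite lerDr.
by apply: sumr_ge0 => i _; rewrite mulr_ge0 ?nc_ge0 ?exprn_ge0.
Qed.

Lemma l1_abs r a B t : `|t| <= r -> l1 r a B ->
  forall n, \sum_(k < n) nc (a k * t%:C ^+ k) <= B.
Proof.
move=> tr h n; apply: le_trans (h n); apply: ler_sum => k _.
rewrite ncM ncX ncR ler_wpM2l ?nc_ge0 // lerXn2r ?nnegrE //; exact: le_trans tr.
Qed.

Lemma l1D r a b A B : l1 r a A -> l1 r b B -> 0 <= r -> l1 r (fun k => a k + b k) (A + B).
Proof.
move=> ha hb r0 n; apply: le_trans (lerD (ha n) (hb n)); rewrite -big_split /=.
by apply: ler_sum => k _; rewrite -mulrDl ler_wpM2r ?exprn_ge0 ?ncD.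
Qed.

Lemma l1_conv r a b A B : 0 <= r -> l1 r a A -> l1 r b B -> l1 r (conv a b) (A * B).
Proof.
move=> r0 ha hb n.
have A0 := l1_ge0 ha.
pose x k := nc (a k) * r ^+ k; pose y k := nc (b k) * r ^+ k.
have x0 k : 0 <= x k by rewrite mulr_ge0 ?nc_ge0 ?exprn_ge0.
have y0 k : 0 <= y k by rewrite mulr_ge0 ?nc_ge0 ?exprn_ge0.
apply: (@le_trans _ _ (\sum_(k < n) \sum_(i < k.+1) x i * y (k - i)%N)).
  apply: ler_sum => k _; rewrite /conv.
  apply: (le_trans (ler_wpM2r _ (nc_sum _ _ _))); first by rewrite exprn_ge0.
  rewrite mulr_suml; apply: ler_sum => i _; rewrite ncM /x /y.
  have -> : r ^+ k = r ^+ i * r ^+ (k - i) by rewrite -exprD subnKC // -ltnS.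
  by rewrite le_eqVlt; apply/orP; left; apply/eqP; ring.
apply: (le_trans (sum_triangle n x0 y0)).
apply: ler_pM; rewrite ?sumr_ge0 //; [exact: ha|exact: hb].
Qed.

Lemma psum_ex r a B t : `|t| <= r -> l1 r a B -> exists2 l, psum a t l & nc l <= B.
Proof. by move=> tr h; apply: csum_ex; apply: l1_abs h. Qed.

Lemma psumD a b t l m : psum a t l -> psum b t m -> psum (fun k => a k + b k) t (l + m).
Proof. by move=> h1 h2; apply: csum_ext (csumD h1 h2) => k; rewrite mulrDl. Qed.

Lemma psum_conv r a b A B t l m : `|t| <= r -> l1 r a A -> l1 r b B ->
  psum a t l -> psum b t m -> psum (conv a b) t (l * m).
Proof.
move=> tr ha hb h1 h2.
apply: csum_ext (csum_conv (l1_abs tr ha) (l1_abs tr hb) h1 h2) => k.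
rewrite /conv mulr_suml; apply: eq_bigr => i _.
have -> : t%:C ^+ k = t%:C ^+ i * t%:C ^+ (k - i) by rewrite -exprD subnKC // -ltnS.
by ring.
Qed.

Lemma psum0 a : psum a 0 (a 0%N).
Proof.
have := @csum1 (fun k => a k * 0%:C ^+ k); rewrite expr0 mulr1; apply=> k.
by rewrite exprS mul0r mulr0.
Qed.

(** The [l1] bound holds at the closed radius and the expansion on the open real interval, so
    shrinking [r] and multiplying two expansions lose nothing. *)
Definition anat_in (r s : R) (f : R -> C) :=
  exists a A, l1 r a A /\ forall t, `|t| < r -> psum a t (f (s + t)).
Definition anat (s : R) (f : R -> C) := exists2 r, 0 < r & anat_in r s f.

Lemma anat_in_le r r' s f : 0 <= r' -> r' <= r -> anat_in r s f -> anat_in r' s f.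
Proof.
move=> r0 le [a [A [h1 h2]]]; exists a, A; split=> [|t tr]; first exact: l1_le h1.
by apply: h2; apply: lt_le_trans le.
Qed.

Lemma anat2 s f g : anat s f -> anat s g ->
  exists2 r, 0 < r & anat_in r s f /\ anat_in r s g.
Proof.
move=> [r r0 hr] [q q0 hq]; exists (Num.min r q); first by rewrite lt_min r0.
have h : 0 <= Num.min r q by rewrite le_min !ltW.
by split; [apply: anat_in_le hr|apply: anat_in_le hq] => //; rewrite ge_min lexx ?orbT.
Qed.

(** A two-sided neighbourhood that contains [s] itself; punctured statements carry [t != s] inside
    [P]. *)
Definition near (s : R) (P : R -> Prop) := exists2 d, 0 < d & forall t, `|t - s| < d -> P t.

Lemma near_and s P Q : near s P -> near s Q -> near s (fun t => P t /\ Q t).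
Proof.
move=> [d d0 h] [e e0 k]; exists (Num.min d e); first by rewrite lt_min d0.
by move=> t; rewrite lt_min => /andP[/h ? /k ?].
Qed.

Lemma near_imp s (P Q : R -> Prop) : (forall t, P t -> Q t) -> near s P -> near s Q.
Proof. by move=> h [d d0 k]; exists d => // t /k; exact: h. Qed.

Lemma near_all s (P : R -> Prop) : (forall t, P t) -> near s P.
Proof. by move=> h; exists 1. Qed.

Lemma near_self s P : near s P -> P s.
Proof. by move=> [d d0]; apply; rewrite subrr normr0. Qed.

Lemma near_forall_fin (I : finType) s (P : I -> R -> Prop) :
  (forall i, near s (P i)) -> near s (fun t => forall i, P i t).
Proof.
move=> h.
suff: near s (fun t => forall i, i \in enum I -> P i t).
  by apply: near_imp => t k i; apply: k; rewrite mem_enum.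
elim: (enum I) => [|i r IH]; first by apply: near_all.
by apply: near_imp (near_and (h i) IH) => t [h1 h2] j; rewrite inE => /orP[/eqP->|/h2].
Qed.

Lemma near_shift s (P : R -> Prop) d : 0 < d -> (forall t, `|t| < d -> P (s + t)) -> near s P.
Proof. by move=> d0 h; exists d => // t /h; rewrite addrC subrK. Qed.

Lemma near_near s P : near s P -> near s (fun u => near u P).
Proof.
move=> [d d0 h]; exists (d / 2%:R); first by lra.
move=> u hu; exists (d / 2%:R); first by lra.
move=> t ht; apply: h; have := ler_normD (t - u) (u - s).
have -> : t - u + (u - s) = t - s by ring.
lra.
Qed.

Lemma anat_ext s f g : near s (fun t => f t = g t) -> anat s f -> anat s g.
Proof.
move=> [d d0 h] [r r0 hr]; exists (Num.min r d); first by rewrite lt_min r0.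
have m0 : 0 <= Num.min r d by rewrite le_min !ltW.
have le : Num.min r d <= r by rewrite ge_min lexx.
have [a [A [h1 h2]]] := anat_in_le m0 le hr.
exists a, A; split=> // t tr; rewrite -h; first exact: h2.
by rewrite addrC addKr; apply: lt_le_trans tr _; rewrite ge_min lexx orbT.
Qed.

Lemma anat_cst s c : anat s (fun=> c).
Proof.
exists 1 => //; exists (fun k => if k is 0%N then c else 0), (nc c); split.
  case=> [|n]; first by rewrite big_ord0 nc_ge0.
  by rewrite big_ord_recl expr0 mulr1 big1 ?addr0 // => i _; rewrite /= nc0 mul0r.
move=> t _; rewrite /psum.
have := @csum1 (fun k => (if k is 0%N then c else 0) * t%:C ^+ k).
by rewrite expr0 mulr1; apply=> k; rewrite mul0r.
Qed.

Lemma anatD s f g : anat s f -> anat s g -> anat s (fun t => f t + g t).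
Proof.
move=> hf hg; have [r r0 [[a [A [a1 a2]]] [b [B [b1 b2]]]]] := anat2 hf hg.
exists r => //; exists (fun k => a k + b k), (A + B); split.
  by apply: l1D => //; exact: ltW.
by move=> t tr; apply: psumD; [exact: a2|exact: b2].
Qed.

Lemma anatM s f g : anat s f -> anat s g -> anat s (fun t => f t * g t).
Proof.
move=> hf hg; have [r r0 [[a [A [a1 a2]]] [b [B [b1 b2]]]]] := anat2 hf hg.
exists r => //; exists (conv a b), (A * B); split.
  by apply: l1_conv => //; exact: ltW.
by move=> t tr; apply: (psum_conv _ a1 b1); rewrite ?ltW //; [exact: a2|exact: b2].
Qed.

Lemma anatZ s c f : anat s f -> anat s (fun t => c * f t).
Proof. exact: anatM (anat_cst s c). Qed.

Lemma anatN s f : anat s f -> anat s (fun t => - f t).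
Proof.
by move=> h; apply: anat_ext (anatZ (-1) h); apply: near_all => t; rewrite mulN1r.
Qed.

Lemma anatB s f g : anat s f -> anat s g -> anat s (fun t => f t - g t).
Proof. by move=> hf hg; apply: anatD => //; apply: anatN. Qed.

Lemma anatX s f n : anat s f -> anat s (fun t => f t ^+ n).
Proof.
move=> h; elim: n => [|n IH].
  by apply: anat_ext (anat_cst s 1); apply: near_all => t; rewrite expr0.
by apply: anat_ext (anatM h IH); apply: near_all => t; rewrite exprS.
Qed.

Lemma anat_sum s I (r : seq I) (P : pred I) (F : I -> R -> C) :
  (forall i, P i -> anat s (F i)) -> anat s (fun t => \sum_(i <- r | P i) F i t).
Proof.
move=> h; elim: r => [|i r IH].
  by apply: anat_ext (anat_cst s 0); apply: near_all => t; rewrite big_nil.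
case Pi: (P i); last by apply: anat_ext IH; apply: near_all => t; rewrite big_cons Pi.
by apply: anat_ext (anatD (h i Pi) IH); apply: near_all => t; rewrite big_cons Pi.
Qed.

Lemma anat_prod s I (r : seq I) (P : pred I) (F : I -> R -> C) :
  (forall i, P i -> anat s (F i)) -> anat s (fun t => \prod_(i <- r | P i) F i t).
Proof.
move=> h; elim: r => [|i r IH].
  by apply: anat_ext (anat_cst s 1); apply: near_all => t; rewrite big_nil.
case Pi: (P i); last by apply: anat_ext IH; apply: near_all => t; rewrite big_cons Pi.
by apply: anat_ext (anatM (h i Pi) IH); apply: near_all => t; rewrite big_cons Pi.
Qed.

Lemma anat_id s : anat s (fun t => t%:C).
Proof.
exists 1 => //.
exists (fun k => if k is 0%N then s%:C else if k is 1%N then 1 else 0), (nc s%:C + 1); split.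
  case=> [|[|n]].
  - by rewrite big_ord0 addr_ge0 ?nc_ge0.
  - by rewrite big_ord_recl big_ord0 expr0 mulr1 addr0 lerDl.
  rewrite !big_ord_recl expr0 mulr1 /= expr1n mulr1 nc1 big1 ?addr0 // => i _.
  by rewrite /= nc0 mul0r.
move=> t _; apply/(clim_incr _ _ 2); apply: clim_ext (clim_cst _) => n.
rewrite addn2 !big_ord_recl /= expr0 mulr1 expr1 mul1r big1 ?addr0 => [|i _]; last by rewrite mul0r.
by rewrite rmorphD.
Qed.

Lemma clim_conj u l : clim u l -> clim (fun n => (u n)^*) l^*.
Proof.
have eR (x : C) : Re x^* = Re x by case: x.
have eI (x : C) : Im x^* = - Im x by case: x.
move=> [h1 h2]; split; rewrite ?eR ?eI.
  by apply: is_lim_seq_ext h1 => n; rewrite eR.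
apply: (is_lim_seq_ext (fun n => Ropp (Im (u n)))) => [n|]; first by rewrite eI.
exact: (proj1 (is_lim_seq_opp _ _) h2).
Qed.

Lemma ncJ (x : C) : nc x^* = nc x.
Proof. by case: x => a b; rewrite /Normc.normc /= sqrrN. Qed.

Lemma anatJ s f : anat s f -> anat s (fun t => (f t)^*).
Proof.
move=> [r r0 [a [A [h1 h2]]]]; exists r => //; exists (fun k => (a k)^*), A; split.
  by move=> n; apply: le_trans (h1 n); apply: ler_sum => k _; rewrite ncJ.
move=> t tr; apply: clim_ext (clim_conj (h2 t tr)) => n.
by rewrite rmorph_sum; apply: eq_bigr => k _; rewrite rmorphM rmorphXn /= oppr0.
Qed.

(** Without its constant term the series has a factor [|t - s| / r]. This bound does the work of
    continuity at [s] in all later estimates. *)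
Lemma anat_lip s f : anat s f ->
  exists2 K, 0 <= K & near s (fun t => nc (f t - f s) <= K * `|t - s|).
Proof.
move=> [r r0 [a [A [h1 h2]]]]; have A0 := l1_ge0 h1.
exists (A / r); first by apply: divr_ge0 => //; exact: ltW.
apply: (near_shift r0) => t tr; rewrite addrAC subrr add0r.
have h0 : f s = a 0%N.
  by have := h2 0; rewrite normr0 addr0 => /(_ r0) h; apply: csum_uniq h (psum0 a).
have : csum (fun k => a k.+1 * t%:C ^+ k.+1) (f (s + t) - f s).
  have h3 := proj1 (clim_incr _ _ 1) (h2 t tr); rewrite h0.
  apply: clim_ext (climD h3 (clim_cst (- a 0%N))) => n.
  by rewrite addn1 big_ord_recl expr0 mulr1 addrC addKr.
apply: csum_nc_le => n.
apply: (@le_trans _ _ (\sum_(k < n) (nc (a k.+1) * r ^+ k.+1) * (`|t| / r))).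
  apply: ler_sum => k _; rewrite ncM ncX ncR.
  rewrite -mulrA ler_wpM2l ?nc_ge0 // exprS [r ^+ _]exprS.
  have -> : r * r ^+ k * (`|t| / r) = `|t| * r ^+ k.
    by field; rewrite gt_eqF.
  by rewrite ler_wpM2l // lerXn2r ?nnegrE // ltW.
have -> : A / r * `|t| = A * (`|t| / r) by ring.
rewrite -mulr_suml ler_wpM2r //; first by apply: divr_ge0 => //; exact: ltW.
apply: le_trans (h1 n.+1); rewrite big_ord_recl expr0 mulr1.
by rewrite lerDr nc_ge0.
Qed.

Lemma anat_near_neq0 s f : anat s f -> f s != 0 -> near s (fun t => f t != 0).
Proof.
move=> /anat_lip[K K0 [d d0 h]] fs; have n0 := nc_gt0 fs.
exists (Num.min d (nc (f s) / (K + 1))).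
  by rewrite lt_min d0 divr_gt0 //; lra.
move=> t; rewrite lt_min => /andP[/h le lt]; apply/negP => /eqP f0.
move: le; rewrite f0 sub0r ncN => le.
move: lt; rewrite ltr_pdivlMr; last by lra.
by have := normr_ge0 (t - s); nra.
Qed.

(** [m] is the least index of a nonzero coefficient. Dividing by the monomial shifts the
    coefficients and divides the [l1] bound by [r ^+ m]; at [s] the quotient is given the value
    [a m]. *)
Lemma anat_factor s f : anat s f -> near s (fun t => f t = 0) \/
  exists m g, [/\ anat s g, g s != 0 & near s (fun t => f t = (t - s)%:C ^+ m * g t)].
Proof.
move=> [r r0 [a [A [h1 h2]]]].
have [h|h] := excluded_middle_informative (exists k, a k != 0); last first.
  left; apply: (near_shift r0) => t tr; apply: csum_uniq (h2 t tr) _.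
  apply: clim_ext (clim_cst 0) => n; rewrite big1 // => k _.
  by have [->|ak] := eqVneq (a k) 0; [rewrite mul0r|case: h; exists k].
right; case: (ex_minnP h) => m am hm.
have a0 k : (k < m)%N -> a k = 0.
  by move=> km; apply/eqP; apply: contraLR km => /hm; rewrite -leqNgt.
pose b k := a (k + m)%N.
pose g u : C := if u == s then a m else f u / (u - s)%:C ^+ m.
exists m, g; split.
- exists r => //; exists b, (A / r ^+ m); split.
    move=> n; rewrite ler_pdivlMr ?exprn_gt0 //; apply: le_trans (h1 (m + n)%N).
    rewrite big_split_ord /= mulr_suml.
    apply: (@le_trans _ _ (\sum_(k < n) nc (a (m + k)%N) * r ^+ (m + k))).
      by apply: ler_sum => k _; rewrite /b addnC -mulrA -exprD addnC.
    by rewrite lerDr sumr_ge0 // => k _; rewrite mulr_ge0 ?nc_ge0 ?exprn_ge0 ?ltW.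
  move=> t tr; have [->|t0] := eqVneq t 0.
    by rewrite addr0 /g eqxx -[a m]/(b 0%N); exact: psum0.
  have tC0 : t%:C != 0 by rewrite (inj_eq (@complexI R)).
  rewrite /g -subr_eq0 [s + t]addrC addrK (negbTE t0) addrC.
  have h3 := proj1 (clim_incr _ _ m) (h2 t tr); rewrite mulrC.
  apply: clim_ext (climZ (t%:C ^+ m)^-1 h3) => n.
  rewrite addnC big_split_ord /= big1 => [|k _]; last by rewrite a0 ?mul0r.
  rewrite add0r mulr_sumr; apply: eq_bigr => k _.
  rewrite /b addnC exprD; field; by rewrite expf_neq0.
- by rewrite /g eqxx.
apply: (near_shift r0) => t tr; rewrite [s + t]addrC addrK /g -subr_eq0 addrK.
have [->|t0] := eqVneq t 0.
  rewrite add0r.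
  have := h2 0; rewrite normr0 addr0 => /(_ r0) h3; rewrite (csum_uniq h3 (psum0 a)).
  case: m am a0 {hm b g} => [|m] am a0; first by rewrite expr0 mul1r.
  by rewrite exprS mul0r mul0r a0.
have tC0 : t%:C != 0 by rewrite (inj_eq (@complexI R)).
by field; rewrite expf_neq0.
Qed.

Lemma bin_le_exp2 n k : ('C(n, k) <= 2 ^ n)%N.
Proof.
elim: n k => [|n IH] [|k] //; first by rewrite bin0 expn_gt0.
by rewrite binS expnS mul2n -addnn leq_add.
Qed.

(** Expand [(d + t) ^+ n] by the binomial formula and exchange the two summations. *)
Lemma anat_recenter s f : anat s f -> near s (fun u => anat u f).
Proof.
move=> [r r0 [a [A [h1 h2]]]]; have A0 := l1_ge0 h1.
have half0 : (0 : R) <= 2%:R^-1 by rewrite invr_ge0 ler0n.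
have half1 : (2%:R^-1 : R) < 1 by rewrite invf_lt1 ?ltr1n ?ltr0n.
have half2 : 0 <= (1 - 2%:R^-1 : R)^-1 by rewrite invr_ge0 subr_ge0 ltW.
(* With ['C(n, k) <= 2 ^ n] the radius [r / 8] leaves [4^-n], and [4^-n <= 2^-n * 2^-k] for
   [k <= n]: this is the product bound that [csum_swap] asks for. *)
pose q := r / 8%:R; have q0 : 0 < q by rewrite /q; lra.
apply: (near_shift q0) => d dq.
pose u t n k := if (k <= n)%N then a n * (d%:C ^+ (n - k) * t%:C ^+ k) *+ 'C(n, k) else 0.
have hu t : `|t| <= q -> forall n k, nc (u t n k) <= A * 2%:R^-1 ^+ n * 2%:R^-1 ^+ k.
  move=> tq n k; rewrite /u; case: leqP => kn; last first.
    by rewrite nc0; do 2?[apply: mulr_ge0] => //; apply: exprn_ge0.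
  rewrite -mulr_natr 3!ncM !ncX !ncR.
  have -> : nc ('C(n, k)%:R : C) = 'C(n, k)%:R.
    by rewrite -[('C(n, k)%:R : C)](rmorph_nat (real_complex R)) ncR normr_nat.
  have hb : ('C(n, k)%:R : R) <= 2%:R ^+ n by rewrite -natrX ler_nat bin_le_exp2.
  have ha : nc (a n) <= A / r ^+ n.
    by rewrite ler_pdivlMr ?exprn_gt0 //; apply: l1_term h1; exact: ltW.
  have hd : `|d| ^+ (n - k) * `|t| ^+ k <= q ^+ n.
    rewrite -[in leRHS](subnK kn) exprD; apply: ler_pM; rewrite ?exprn_ge0 //;
    by apply: lerXn2r; rewrite ?nnegrE // ?ltW.
  apply: (@le_trans _ _ ((A / r ^+ n * q ^+ n) * 2%:R ^+ n)).
    by apply: ler_pM => //; rewrite ?mulr_ge0 ?nc_ge0 ?exprn_ge0 //;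
       apply: ler_pM; rewrite ?mulr_ge0 ?nc_ge0 ?exprn_ge0.
  have -> : A / r ^+ n * q ^+ n * 2%:R ^+ n = A * 4%:R^-1 ^+ n.
    rewrite /q -mulrA -mulrA -[X in _ * (X * _)]exprVn -!exprMn; congr (_ * _ ^+ _).
    by field; rewrite gt_eqF.
  rewrite -mulrA ler_wpM2l // (_ : 4%:R^-1 = 2%:R^-1 * 2%:R^-1); last by field.
  rewrite exprMn ler_wpM2l ?exprn_ge0 //.
  by apply: ler_wiXn2l => //; exact: ltW.
have geo (t : R) n : 0 <= t -> \sum_(k < n) A * t * 2%:R^-1 ^+ k <= A * t * (1 - 2%:R^-1)^-1.
  by move=> t0; rewrite -mulr_sumr ler_wpM2l ?geom_le // mulr_ge0.
pose v n k : C := if (k <= n)%N then a n * d%:C ^+ (n - k) *+ 'C(n, k) else 0.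
have uv t n k : u t n k = v n k * t%:C ^+ k.
  by rewrite /u /v; case: ifP => _; rewrite ?mul0r // mulrA mulrnAl.
have colb t k : `|t| <= q ->
    forall m, \sum_(n < m) nc (u t n k) <= A * 2%:R^-1 ^+ k * (1 - 2%:R^-1)^-1.
  move=> tq m; apply: (@le_trans _ _ (\sum_(n < m) A * 2%:R^-1 ^+ k * 2%:R^-1 ^+ n)).
    by apply: ler_sum => n _; rewrite mulrAC; exact: hu.
  by apply: geo; exact: exprn_ge0.
have qq : `|q| <= q by rewrite gtr0_norm.
pose b k := csum_val (fun n => v n k).
have hb k : csum (fun n => v n k) (b k).
  apply: (@csum_valP _ (A * 2%:R^-1 ^+ k * (1 - 2%:R^-1)^-1 / q ^+ k)) => m.
  rewrite ler_pdivlMr ?exprn_gt0 // mulr_suml; apply: le_trans (colb q k qq m).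
  by apply: ler_sum => n _; rewrite uv ncM ncX ncR gtr0_norm.
have hbt t k : csum (fun n => u t n k) (b k * t%:C ^+ k).
  by rewrite mulrC; apply: csum_ext (csumZ (t%:C ^+ k) (hb k)) => n; rewrite uv mulrC.
have bb t k : `|t| <= q -> nc (b k * t%:C ^+ k) <= A * 2%:R^-1 ^+ k * (1 - 2%:R^-1)^-1.
  by move=> tq; apply: csum_nc_le (hbt t k) => m; exact: colb.
exists q => //; exists b, (A * (1 - 2%:R^-1)^-1 * (1 - 2%:R^-1)^-1); split.
  move=> n; apply: (@le_trans _ _ (\sum_(k < n) A * (1 - 2%:R^-1)^-1 * 2%:R^-1 ^+ k)).
    apply: ler_sum => k _; rewrite mulrAC; have := bb q k qq.
    by rewrite ncM ncX ncR gtr0_norm.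
  exact: geo.
move=> t tq; have tq' := ltW tq.
have ex : `|t| < q by [].
have rows n : csum (u t n) (a n * (d + t)%:C ^+ n).
  apply/(clim_incr _ _ n.+1); apply: clim_ext (clim_cst _) => m.
  rewrite addnC big_split_ord /= [X in _ = _ + X]big1 ?addr0; last first.
    by move=> i _; rewrite /u leqNgt ltnS leq_addr.
  rewrite rmorphD exprDn mulr_sumr; apply: eq_bigr => k _.
  by rewrite /u -ltnS ltn_ord mulrnAr.
have dt : `|d + t| < r.
  by apply: le_lt_trans (ler_normD _ _) _; move: dq tq; rewrite /q; lra.
have tot := h2 _ dt; rewrite addrA in tot.
have [l hl _] : exists2 l, csum (fun k => b k * t%:C ^+ k) l & nc l <= (A * (1 - 2%:R^-1)^-1 * (1 - 2%:R^-1)^-1).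
  apply: csum_ex => n; apply: (@le_trans _ _ (\sum_(k < n) A * (1 - 2%:R^-1)^-1 * 2%:R^-1 ^+ k)).
    by apply: ler_sum => k _; rewrite mulrAC; exact: bb.
  exact: geo.
have := csum_swap half0 half1 (hu t tq') rows (hbt t) hl.
by move=> /csum_uniq /(_ tot) <-.
Qed.

(** Course-of-values recursion: the value at [k] is stable after [k.+1] iterations of [Phi], so the
    constant start [d] does not survive. *)
Lemma strong_rec (T : Type) (d : T) (Phi : (nat -> T) -> nat -> T) :
  (forall k f g, (forall j, (j < k)%N -> f j = g j) -> Phi f k = Phi g k) ->
  exists f, forall k, f k = Phi f k.
Proof.
move=> h; pose F n := iter n Phi (fun=> d).
have FE m n k : (k < n)%N -> F n k = F (n + m)%N k.
  elim: n k => // n IH k; rewrite ltnS => kn.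
  by rewrite addSn /F !iterS; apply: h => j jk; apply: IH; apply: leq_trans jk kn.
exists (fun k => F k.+1 k) => k; rewrite {1}/F iterS; apply: h => j jk.
by rewrite (FE (k - j.+1)%N) // subnKC.
Qed.

Definition vn N (x : 'rV[C]_N) : R := \sum_i nc (x 0 i).

Lemma vn_ge0 N (x : 'rV[C]_N) : 0 <= vn x.
Proof. by apply: sumr_ge0 => i _; exact: nc_ge0. Qed.
Lemma vn0 N : vn (0 : 'rV[C]_N) = 0.
Proof. by rewrite /vn big1 // => i _; rewrite mxE nc0. Qed.
Lemma vnD N (x y : 'rV[C]_N) : vn (x + y) <= vn x + vn y.
Proof. by rewrite -big_split; apply: ler_sum => i _; rewrite mxE ncD. Qed.
Lemma vnZ N c (x : 'rV[C]_N) : vn (c *: x) = nc c * vn x.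
Proof. by rewrite /vn mulr_sumr; apply: eq_bigr => i _; rewrite mxE ncM. Qed.
Lemma vn_sum N I (r : seq I) (P : pred I) (F : I -> 'rV[C]_N) :
  vn (\sum_(i <- r | P i) F i) <= \sum_(i <- r | P i) vn (F i).
Proof.
elim/big_rec2: _ => [|i a b _ h]; first by rewrite vn0.
by apply: (le_trans (vnD _ _)); rewrite lerD2l.
Qed.
Lemma vn_coord N (x : 'rV[C]_N) i : nc (x 0 i) <= vn x.
Proof. by rewrite /vn (bigD1 i) //= lerDl sumr_ge0 // => j _; exact: nc_ge0. Qed.

(* If [S] is the partial sum [\sum_(k < n) vn (X k) * r ^+ k], the recursion gives
   [S' <= e + K * S ^+ 2] for the next one, so [S <= 2 * e] persists when [4 * K * e <= 1]. *)
Lemma anat_quadratic N (s : R) (E : 'I_N -> R -> C) (b : 'I_N -> 'I_N -> 'rV[C]_N) :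
  (forall i, anat s (E i)) -> (forall i, E i s = 0) ->
  exists X : 'I_N -> R -> C, (forall i, anat s (X i)) /\
    near s (fun t => forall l, X l t = E l t + \sum_i \sum_j (X i t * X j t) * b i j 0 l).
Proof.
move=> hE E0.
have [r r0 hr] : exists2 r, 0 < r & forall i, anat_in r s (E i).
  have H : forall i, exists2 r, 0 < r & anat_in r s (E i) by [].
  suff [r r0 h] : exists2 r, 0 < r & forall i, i \in enum 'I_N -> anat_in r s (E i).
    by exists r => // i; apply: h; rewrite mem_enum.
  elim: (enum 'I_N) => [|i l [r r0 IH]]; first by exists 1.
  have [q q0 hq] := H i; exists (Num.min r q); first by rewrite lt_min r0.
  have m0 : 0 <= Num.min r q by rewrite le_min !ltW.
  move=> j; rewrite inE => /orP[/eqP->|/IH h]; [apply: anat_in_le hq|apply: anat_in_le h] => //;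
    by rewrite ge_min lexx ?orbT.
have {}hr i : exists aA : (nat -> C) * R,
    l1 r aA.1 aA.2 /\ forall t, `|t| < r -> psum aA.1 t (E i (s + t)).
  by have [a [A h]] := hr i; exists (a, A).
have [aA haA] : exists aA : 'I_N -> (nat -> C) * R, forall i,
    l1 r (aA i).1 (aA i).2 /\ forall t, `|t| < r -> psum (aA i).1 t (E i (s + t)).
  exists (fun i => proj1_sig (constructive_indefinite_description _ (hr i))) => i.
  by case: (constructive_indefinite_description _ _).
pose e k : 'rV[C]_N := \row_i (aA i).1 k.
have e0 : e 0%N = 0.
  apply/rowP => i; rewrite !mxE; have [_ /(_ 0)] := haA i; rewrite normr0 addr0 E0 => /(_ r0) h.
  exact/esym/(csum_uniq h (psum0 _)).
pose A := \sum_i (aA i).2.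
have eA n : \sum_(k < n) vn (e k) * r ^+ k <= A.
  under eq_bigr do rewrite mulr_suml.
  rewrite exchange_big; apply: ler_sum => i _; have [h _] := haA i; apply: le_trans (h n).
  by apply: ler_sum => k _; rewrite mxE.
have A0 : 0 <= A by have := eA 0%N; rewrite big_ord0.
pose K := \sum_i \sum_j vn (b i j).
have K0 : 0 <= K by apply: sumr_ge0 => i _; apply: sumr_ge0 => j _; exact: vn_ge0.
pose B (x y : 'rV[C]_N) := \sum_i \sum_j (x 0 i * y 0 j) *: b i j.
have BK x y : vn (B x y) <= K * (vn x * vn y).
  rewrite /B /K mulr_suml; apply: (le_trans (vn_sum _ _ _)); apply: ler_sum => i _.
  rewrite mulr_suml; apply: (le_trans (vn_sum _ _ _)); apply: ler_sum => j _.
  rewrite vnZ mulrC ler_wpM2l ?vn_ge0 // ncM.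
  by apply: ler_pM; rewrite ?nc_ge0 ?vn_coord.
have B0x y : B 0 y = 0.
  by rewrite /B big1 // => i _; rewrite big1 // => j _; rewrite mxE mul0r scale0r.
have Bx0 x : B x 0 = 0.
  by rewrite /B big1 // => i _; rewrite big1 // => j _; rewrite mxE mulr0 scale0r.
(* The two end terms of the convolution would refer to [X k] itself; they are dropped here and put
   back in [hX'], where they vanish because [X 0 = 0]. *)
pose Phi (X : nat -> 'rV[C]_N) k := e k +
  \sum_(i < k.+1) if (0 < i < k)%N then B (X i) (X (k - i)%N) else 0.
have [X hX] : exists X, forall k, X k = Phi X k.
  apply: (strong_rec 0) => k f g h; rewrite /Phi; congr (_ + _); apply: eq_bigr => i _.
  case: ifP => // /andP[i0 ik]; rewrite !h // ltn_subrL i0 /=; exact: leq_trans ik.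
have X0 : X 0%N = 0 by rewrite hX /Phi e0 big_ord_recl big_ord0 /= !addr0.
have hX' k : X k = e k + \sum_(i < k.+1) B (X i) (X (k - i)%N).
  rewrite {1}hX /Phi; congr (_ + _); apply: eq_bigr => i _; case: ifP => // /negbT.
  rewrite negb_and -leqNgt leqn0 -leqNgt => /orP[/eqP->|ki]; first by rewrite X0 B0x.
  by have /eqP -> : (k - i == 0)%N; rewrite ?subn_eq0 // X0 Bx0.
(* Since [e 0 = 0], shrinking the radius by [D] divides the [l1] bound of [e] by [D], which makes
   [4 * K * ep <= 1]. *)
pose D := 4%:R * K * A + 1.
have D1 : 1 <= D by rewrite /D lerDr !mulr_ge0.
have D0 : 0 < D by apply: lt_le_trans D1.
have Dv0 : 0 <= D^-1 by rewrite invr_ge0 ltW.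
have Dv1 : D^-1 <= 1 by rewrite invf_le1.
pose q := r / D; have q0 : 0 < q by rewrite divr_gt0.
have q0' := ltW q0; have r0' := ltW r0.
have qr : q <= r by rewrite /q ler_pdivrMr // ler_peMr.
pose ep := A / D; have ep0 : 0 <= ep by apply: divr_ge0 => //; exact: ltW.
have Kep : 4%:R * K * ep <= 1.
  by rewrite /ep mulrA ler_pdivrMr // mul1r /D lerDl.
have eq n : \sum_(k < n) vn (e k) * q ^+ k <= ep.
  apply: (@le_trans _ _ (\sum_(k < n) (vn (e k) * r ^+ k) * D^-1)); last first.
    by rewrite -mulr_suml ler_wpM2r // invr_ge0 ltW.
  apply: ler_sum => -[[|k] kn] _ /=; first by rewrite e0 vn0 !mul0r.
  rewrite -mulrA ler_wpM2l ?vn_ge0 // /q exprMn ler_wpM2l ?exprn_ge0 //.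
  by rewrite exprS ler_piMr // exprn_ile1.
have S n : \sum_(k < n) vn (X k) * q ^+ k <= 2%:R * ep.
  elim: n => [|n IH]; first by rewrite big_ord0 mulr_ge0.
  pose y i := if (i < n)%N then vn (X i) * q ^+ i else 0.
  have y0 i : 0 <= y i by rewrite /y; case: ifP => // _; rewrite mulr_ge0 ?vn_ge0 ?exprn_ge0.
  have yn : \sum_(i < n.+1) y i = \sum_(i < n) vn (X i) * q ^+ i.
    rewrite big_ord_recr /= {2}/y ltnn addr0; apply: eq_bigr => i _.
    by rewrite /y ltn_ord.
  apply: (@le_trans _ _ (ep + K * ((\sum_(i < n.+1) y i) * (\sum_(i < n.+1) y i)))).
    apply: (@le_trans _ _ (\sum_(k < n.+1) vn (e k) * q ^+ k +
       K * (\sum_(k < n.+1) \sum_(i < k.+1) y i * y (k - i)%N))); last first.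
      by rewrite lerD // ler_wpM2l // sum_triangle.
    rewrite mulr_sumr -big_split /=; apply: ler_sum => k _.
    rewrite hX /Phi mulr_sumr.
    apply: (@le_trans _ _ ((vn (e k) + \sum_(i < k.+1)
       vn (if (0 < i < k)%N then B (X i) (X (k - i)%N) else 0)) * q ^+ k)).
      rewrite ler_wpM2r ?exprn_ge0 //; apply: (le_trans (vnD _ _)).
      by rewrite lerD2l vn_sum.
    rewrite mulrDl lerD2l mulr_suml; apply: ler_sum => i _; case: ifP => [/andP[i0 ik]|_].
      have kin : (k - i < n)%N by rewrite -ltnS; apply: leq_trans (ltn_ord k); rewrite ltnS ltn_subrL i0 (leq_trans _ ik).
      have iin : (i < n)%N by apply: leq_trans ik _; rewrite -ltnS.
      rewrite /y kin iin.
      apply: (le_trans (ler_wpM2r _ (BK _ _))); first exact: exprn_ge0.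
      have -> : q ^+ k = q ^+ i * q ^+ (k - i) by rewrite -exprD subnKC // ltnW.
      by rewrite le_eqVlt; apply/orP; left; apply/eqP; ring.
    by rewrite vn0 mul0r mulr_ge0 // mulr_ge0.
  rewrite yn; set z := \sum_(i < n) _ in IH *.
  have z0 : 0 <= z by apply: sumr_ge0 => i _; rewrite mulr_ge0 ?vn_ge0 ?exprn_ge0.
  have : K * (z * z) <= K * (2%:R * ep * (2%:R * ep)) by rewrite ler_wpM2l // ler_pM.
  by nra.
have l1X l : l1 q (fun k => X k 0 l) (2%:R * ep).
  move=> n; apply: le_trans (S n); apply: ler_sum => k _.
  by rewrite ler_wpM2r ?vn_coord // exprn_ge0.
pose F l u := csum_val (fun k => X k 0 l * (u - s)%:C ^+ k).
have hF l t : `|t| < q -> psum (fun k => X k 0 l) t (F l (s + t)).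
  move=> tq; rewrite /F [s + t]addrC addrK; exact: csum_valP (l1_abs (ltW tq) (l1X l)).
exists F; split=> [l|].
  exists q => //; exists (fun k => X k 0 l), (2%:R * ep).
  by split; [exact: l1X|exact: hF].
apply: (near_shift q0) => t tq l.
have h1 := hF l t tq.
have h2 : psum (fun k => e k 0 l) t (E l (s + t)).
  have [_ /(_ t)] := haA l; move=> /(_ (lt_le_trans tq qr)).
  by apply: csum_ext => k; rewrite mxE.
have h3 : csum (fun k => e k 0 l * t%:C ^+ k + \sum_i \sum_j
    b i j 0 l * (conv (fun k => X k 0 i) (fun k => X k 0 j) k * t%:C ^+ k))
    (E l (s + t) + \sum_i \sum_j b i j 0 l * (F i (s + t) * F j (s + t))).
  apply: csumD h2 _; apply: csum_sum => i; apply: csum_sum => j; apply: csumZ.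
  exact: psum_conv (ltW tq) (l1X i) (l1X j) (hF i t tq) (hF j t tq).
rewrite (csum_uniq h1 (csum_ext _ h3)) => [|k].
  by congr (_ + _); apply: eq_bigr => i _; apply: eq_bigr => j _; rewrite mulrC.
rewrite [X k]hX' [in RHS]mxE mulrDl; congr (_ + _).
transitivity (\sum_(k' < k.+1) \sum_i \sum_j
   b i j 0 l * (X k' 0 i * X (k - k')%N 0 j * t%:C ^+ k)).
  rewrite [RHS]exchange_big; apply: eq_bigr => i _; rewrite [RHS]exchange_big.
  by apply: eq_bigr => j _; rewrite /conv mulr_suml mulr_sumr.
apply: esym; rewrite summxE mulr_suml; apply: eq_bigr => k' _.
rewrite summxE mulr_suml; apply: eq_bigr => i _.
rewrite summxE mulr_suml; apply: eq_bigr => j _.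
by rewrite mxE; ring.
Qed.

(** The reciprocal is a multiple of [1 + z], where [z = phi + z * phi]. Its variable coefficient
    [phi] becomes a second unknown, equal to [phi], so that the quadratic term has constant
    coefficients. *)
Lemma anatV s f : anat s f -> f s != 0 -> anat s (fun t => (f t)^-1).
Proof.
move=> hf f0; pose phi t := 1 - (f s)^-1 * f t.
have hphi : anat s phi by apply: anatB (anat_cst s 1) (anatZ _ hf).
have phi0 : phi s = 0 by rewrite /phi mulVf ?subrr.
have [X [hX eX]] := @anat_quadratic 2 s (fun=> phi)
  (fun i j => if (i == 0) && (j == 1) then delta_mx 0 0 else 0) (fun=> hphi) (fun=> phi0).
apply: (@anat_ext _ (fun t => (f s)^-1 * (1 + X 0 t))); last first.
  by apply: anatZ; apply: anatD (anat_cst s 1) (hX 0).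
apply: near_imp (near_and eX (anat_near_neq0 hf f0)) => t [e ft].
have E0 := e 0; have E1 := e 1; rewrite !big_ord_recl !big_ord0 /= !mxE /= in E0 E1.
rewrite !mulr0 !addr0 ?mulr1 in E0 E1.
apply: (mulIf ft); rewrite mulVf //.
have k : X 0 t = phi t + X 0 t * phi t.
  rewrite {1}E0 add0r; have -> : lift ord0 ord0 = 1 :> 'I_2 by apply: val_inj.
  by have -> : ord0 = 0 :> 'I_2 by []; rewrite E1.
have -> : (f s)^-1 * (1 + X 0 t) * f t = (1 + X 0 t) * (1 - phi t) by rewrite /phi; ring.
by rewrite mulrBr mulr1 mulrDl mul1r -k addrK.
Qed.
(** * Analytic families of polynomials and matrices *)

Definition anpoly s (p : R -> {poly C}) := forall i, anat s (fun t => (p t)`_i).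
Definition anmx s m n (A : R -> 'M[C]_(m, n)) := forall i j, anat s (fun t => A t i j).

Lemma anat_eq s f g : f =1 g -> anat s f -> anat s g.
Proof. by move=> e; apply: anat_ext; apply: near_all. Qed.

Lemma anpoly_ext s p q : near s (fun t => p t = q t) -> anpoly s p -> anpoly s q.
Proof. by move=> e h i; apply: anat_ext (h i); apply: near_imp e => t ->. Qed.

Lemma anpoly_eq s p q : p =1 q -> anpoly s p -> anpoly s q.
Proof. by move=> e; apply: anpoly_ext; apply: near_all. Qed.

Lemma anpoly_cst s p : anpoly s (fun=> p).
Proof. by move=> i; exact: anat_cst. Qed.

Lemma anpolyD s p q : anpoly s p -> anpoly s q -> anpoly s (fun t => p t + q t).
Proof. by move=> hp hq i; apply: anat_eq (anatD (hp i) (hq i)) => t; rewrite coefD. Qed.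

Lemma anpolyN s p : anpoly s p -> anpoly s (fun t => - p t).
Proof. by move=> hp i; apply: anat_eq (anatN (hp i)) => t; rewrite coefN. Qed.

Lemma anpolyC s f : anat s f -> anpoly s (fun t => (f t)%:P).
Proof.
move=> hf [|i]; first by apply: anat_eq hf => t; rewrite coefC.
by apply: anat_eq (anat_cst s 0) => t; rewrite coefC.
Qed.

Lemma anpolyZ s f p : anat s f -> anpoly s p -> anpoly s (fun t => f t *: p t).
Proof. by move=> hf hp i; apply: anat_eq (anatM hf (hp i)) => t; rewrite coefZ. Qed.

Lemma anpolyM s p q : anpoly s p -> anpoly s q -> anpoly s (fun t => p t * q t).
Proof.
move=> hp hq i; apply: (@anat_eq _ (fun t => \sum_(j < i.+1) (p t)`_j * (q t)`_(i - j))).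
  by move=> t; rewrite coefM.
by apply: anat_sum => j _; apply: anatM.
Qed.

Lemma anpolyX s p n : anpoly s p -> anpoly s (fun t => p t ^+ n).
Proof.
move=> h; elim: n => [|n IH].
  by apply: anpoly_eq (anpoly_cst s 1) => t; rewrite expr0.
by apply: anpoly_eq (anpolyM h IH) => t; rewrite exprS.
Qed.

Lemma anpoly_sum s I (r : seq I) (P : pred I) (F : I -> R -> {poly C}) :
  (forall i, anpoly s (F i)) -> anpoly s (fun t => \sum_(i <- r | P i) F i t).
Proof.
move=> h; elim: r => [|i r IH].
  by apply: anpoly_eq (anpoly_cst s 0) => t; rewrite big_nil.
case Pi: (P i); last by apply: anpoly_eq IH => t; rewrite big_cons Pi.
by apply: anpoly_eq (anpolyD (h i) IH) => t; rewrite big_cons Pi.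
Qed.

Lemma anpoly_prod s I (r : seq I) (P : pred I) (F : I -> R -> {poly C}) :
  (forall i, anpoly s (F i)) -> anpoly s (fun t => \prod_(i <- r | P i) F i t).
Proof.
move=> h; elim: r => [|i r IH].
  by apply: anpoly_eq (anpoly_cst s 1) => t; rewrite big_nil.
case Pi: (P i); last by apply: anpoly_eq IH => t; rewrite big_cons Pi.
by apply: anpoly_eq (anpolyM (h i) IH) => t; rewrite big_cons Pi.
Qed.

Lemma anpoly_comp s (p q : R -> {poly C}) N : near s (fun t => (size (p t) <= N)%N) ->
  anpoly s p -> anpoly s q -> anpoly s (fun t => p t \Po q t).
Proof.
move=> hN hp hq; apply: (@anpoly_ext _ (fun t => \sum_(i < N) (p t)`_i *: q t ^+ i)).
  apply: near_imp hN => t le; rewrite comp_polyE [RHS](big_ord_widen N (fun i => (p t)`_i *: q t ^+ i)) //.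
  rewrite [RHS]big_mkcond; apply: eq_bigr => i _; case: ltnP => // ge.
  by rewrite nth_default ?scale0r.
by apply: anpoly_sum => i; apply: anpolyZ => //; apply: anpolyX.
Qed.

Lemma anmx_ext s m n (A B : R -> 'M[C]_(m, n)) :
  near s (fun t => A t = B t) -> anmx s A -> anmx s B.
Proof. by move=> e h i j; apply: anat_ext (h i j); apply: near_imp e => t ->. Qed.

Lemma anmx_cst s m n (A : 'M[C]_(m, n)) : anmx s (fun=> A).
Proof. by move=> i j; exact: anat_cst. Qed.

Lemma anmxD s m n (A B : R -> 'M[C]_(m, n)) :
  anmx s A -> anmx s B -> anmx s (fun t => A t + B t).
Proof. by move=> hA hB i j; apply: anat_eq (anatD (hA i j) (hB i j)) => t; rewrite mxE. Qed.

Lemma anmxN s m n (A : R -> 'M[C]_(m, n)) : anmx s A -> anmx s (fun t => - A t).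
Proof. by move=> hA i j; apply: anat_eq (anatN (hA i j)) => t; rewrite mxE. Qed.

Lemma anmxB s m n (A B : R -> 'M[C]_(m, n)) :
  anmx s A -> anmx s B -> anmx s (fun t => A t - B t).
Proof. by move=> hA hB; apply: anmxD => //; apply: anmxN. Qed.

Lemma anmxZ s m n f (A : R -> 'M[C]_(m, n)) :
  anat s f -> anmx s A -> anmx s (fun t => f t *: A t).
Proof. by move=> hf hA i j; apply: anat_eq (anatM hf (hA i j)) => t; rewrite mxE. Qed.

Lemma anmxM s m n p (A : R -> 'M[C]_(m, n)) (B : R -> 'M[C]_(n, p)) :
  anmx s A -> anmx s B -> anmx s (fun t => A t *m B t).
Proof.
move=> hA hB i j; apply: (@anat_eq _ (fun t => \sum_k A t i k * B t k j)) => [t|].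
  by rewrite mxE.
by apply: anat_sum => k _; apply: anatM.
Qed.

Lemma anmx_sum s m n I (r : seq I) (P : pred I) (F : I -> R -> 'M[C]_(m, n)) :
  (forall i, anmx s (F i)) -> anmx s (fun t => \sum_(i <- r | P i) F i t).
Proof.
move=> h i j; apply: (@anat_eq _ (fun t => \sum_(k <- r | P k) F k t i j)) => [t|].
  by rewrite summxE.
by apply: anat_sum => k _; apply: h.
Qed.

Lemma anat_det s n (A : R -> 'M[C]_n) : anmx s A -> anat s (fun t => \det (A t)).
Proof.
move=> hA; rewrite /determinant; apply: anat_sum => p _.
by apply: anatZ; apply: anat_prod => i _; apply: hA.
Qed.

Lemma anmx_adj s n (A : R -> 'M[C]_n) : anmx s A -> anmx s (fun t => \adj (A t)).
Proof.
move=> hA i j; apply: (@anat_eq _ (fun t => cofactor (A t) j i)) => [t|].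
  by rewrite mxE.
rewrite /cofactor; apply: anatZ; apply: anat_det => a b.
by apply: anat_eq (hA (lift j a) (lift i b)) => t; rewrite !mxE.
Qed.

Lemma anmx_inv s n (A : R -> 'M[C]_n) : anmx s A -> near s (fun t => A t \in unitmx) ->
  anmx s (fun t => invmx (A t)).
Proof.
move=> hA hU; apply: (@anmx_ext _ _ _ (fun t => (\det (A t))^-1 *: \adj (A t))).
  by apply: near_imp hU => t u; rewrite /invmx u.
apply: anmxZ (anmx_adj hA); apply: anatV (anat_det hA) _.
by have := near_self hU; rewrite unitmxE unitfE.
Qed.

Lemma anpoly_char s n (A : R -> 'M[C]_n) : anmx s A -> anpoly s (fun t => char_poly (A t)).
Proof.
move=> hA; rewrite /char_poly /determinant; apply: anpoly_sum => p.
apply: anpolyM; first exact: anpoly_cst.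
apply: anpoly_prod => i.
suff h j : anpoly s (fun t => char_poly_mx (A t) i j) by exact: h.
apply: (@anpoly_eq _ (fun t => 'X *+ (i == j) - (A t i j)%:P)) => [t|].
  by rewrite !mxE.
by apply: anpolyD (anpoly_cst _ _) _; apply: anpolyN; apply: anpolyC.
Qed.

(** * Analytic factorization of polynomials (Hensel) *)

Lemma monicDl (P Q : {poly C}) : P \is monic -> (size Q <= (size P).-1)%N ->
  (P + Q \is monic) /\ size (P + Q) = size P.
Proof.
move=> mP le; have lt : (size Q < size P)%N.
  by rewrite (leq_ltn_trans le) // prednK // size_poly_gt0 monic_neq0.
by split; [rewrite monicE lead_coefDl // -monicE|rewrite size_polyDl].
Qed.

(** With corrections [h1], [h2] of degree below those of [P1], [P2], the equation reads
    [e = h2 * P1 + h1 * P2 + h2 * h1]. Its linear part is the Sylvester matrix, invertible by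
    coprimality; applying the inverse gives an equation for [anat_quadratic]. *)
Lemma hensel s (p : R -> {poly C}) P1 P2 : anpoly s p -> p s = P1 * P2 ->
  P1 \is monic -> P2 \is monic -> coprimep P1 P2 ->
  near s (fun t => p t \is monic /\ size (p t) = size (P1 * P2)) ->
  exists p1 p2, [/\ anpoly s p1, anpoly s p2 &
    near s (fun t => [/\ p t = p1 t * p2 t, p1 t \is monic, p2 t \is monic,
       size (p1 t) = size P1 & size (p2 t) = size P2])].
Proof.
move=> hp p0 m1 m2 cop hm.
pose d1 := (size P1).-1; pose d2 := (size P2).-1.
have s1 : size P1 = d1.+1 by rewrite prednK // size_poly_gt0 monic_neq0.
have s2 : size P2 = d2.+1 by rewrite prednK // size_poly_gt0 monic_neq0.
pose Syl : 'M_(d2 + d1) := Sylvester_mx P1 P2.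
have uS : Syl \in unitmx.
  rewrite unitmxE unitfE; have := resultant_eq0 P1 P2; rewrite /resultant -/Syl => ->.
  by move: cop; rewrite /coprimep => /eqP ->.
have SylE (x : 'rV_(d2 + d1)) :
    x *m Syl = poly_rV (rVpoly (lsubmx x) * P1 + rVpoly (rsubmx x) * P2).
  by rewrite -{1}[x]hsubmxK mul_row_col !mul_rV_lin1 /= linearD.
pose e t := p t - P1 * P2.
pose E (i : 'I_(d2 + d1)) t := (poly_rV (e t) *m invmx Syl) 0 i.
have he : anpoly s e by apply: anpolyD => //; exact: anpoly_cst.
have hE i : anat s (E i).
  have h : anmx s (fun t => poly_rV (e t) *m invmx Syl).
    apply: anmxM (anmx_cst _ _) => a b.
    by apply: anat_eq (he b) => t; rewrite mxE.
  exact: h.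
have E0 i : E i s = 0.
  by rewrite /E /e p0 subrr linear0 mul0mx mxE.
pose D (i : 'I_(d2 + d1)) : 'rV[C]_(d2 + d1) := delta_mx 0 i.
pose b i j : 'rV[C]_(d2 + d1) :=
  - (poly_rV (rVpoly (lsubmx (D i)) * rVpoly (rsubmx (D j))) *m invmx Syl).
have [X [hX eX]] := @anat_quadratic _ s E b hE E0.
pose x t : 'rV[C]_(d2 + d1) := \row_i X i t.
pose h2 t := rVpoly (lsubmx (x t)); pose h1 t := rVpoly (rsubmx (x t)).
have hx k (f : 'rV[C]_(d2 + d1) -> 'rV[C]_k) : (forall a u v, f (a *: u + v) = a *: f u + f v) ->
    anpoly s (fun t => rVpoly (f (x t))).
  move=> lin i.
  have fE t : f (x t) = \sum_i X i t *: f (D i).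
    have f0 : f 0 = 0 by have := lin (-1) 0 0; rewrite scaler0 addr0 scaleN1r addNr.
    rewrite [x t]row_sum_delta; elim: (index_enum _) => [|j l IH]; first by rewrite !big_nil.
    by rewrite !big_cons lin IH mxE.
  apply: (@anat_eq _ (fun t => \sum_j X j t * (rVpoly (f (D j)))`_i)) => [t|].
    by rewrite fE linear_sum coef_sum; apply: eq_bigr => j _; rewrite linearZ coefZ.
  by apply: anat_sum => j _; apply: anatM => //; exact: anat_cst.
have hh1 : anpoly s h1 by apply: hx => a u v; rewrite linearP.
have hh2 : anpoly s h2 by apply: hx => a u v; rewrite linearP.
exists (fun t => P1 + h1 t), (fun t => P2 + h2 t); split.
- by apply: anpolyD => //; exact: anpoly_cst.
- by apply: anpolyD => //; exact: anpoly_cst.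
apply: near_imp (near_and eX hm) => t [ext [mp sp]].
have sz1 : (size (h1 t) <= d1)%N by exact: size_poly.
have sz2 : (size (h2 t) <= d2)%N by exact: size_poly.
have [M1 S1] := monicDl m1 sz1; have [M2 S2] := monicDl m2 sz2.
split => //.
pose W (u v : 'rV[C]_(d2 + d1)) : 'rV[C]_(d2 + d1) :=
  poly_rV (rVpoly (lsubmx u) * rVpoly (rsubmx v)) *m invmx Syl.
have WE : W (x t) (x t) = \sum_i \sum_j (X i t * X j t) *: W (D i) (D j).
  rewrite /W {1 2}[x t]row_sum_delta !linear_sum mulr_suml linear_sum mulmx_suml.
  apply: eq_bigr => i _; rewrite mulr_sumr linear_sum mulmx_suml /=.
  apply: eq_bigr => j _; rewrite !linearZ /= -scalerAl -scalerAr !linearZ /= -!scalemxAl.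
  by rewrite scalerA !mxE.
have xB : x t = (poly_rV (e t) - poly_rV (h2 t * h1 t)) *m invmx Syl.
  rewrite mulmxBl -/(W (x t) (x t)) WE -sumrN; apply/rowP => l; rewrite mxE ext mxE summxE.
  congr (_ + _); apply: eq_bigr => i _; rewrite -sumrN summxE; apply: eq_bigr => j _.
  by rewrite /b !mxE mulrN.
have := SylE (x t); rewrite {1}xB mulmxKV // -linearB => /(congr1 rVpoly).
have sP : size (P1 * P2) = (d2 + d1).+1.
  by rewrite size_monicM ?monic_neq0 // s1 s2 addnS addSn addnC.
(* Both polynomials are monic of the same degree, so the leading terms cancel and [poly_rV] loses no
   coefficient of [e t]. *)
have se : (size (e t) <= d2 + d1)%N.
  apply/leq_sizeP => k; rewrite leq_eqVlt => /orP[/eqP<-|lt].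
    rewrite coefB; have -> : (d2 + d1)%N = (size (p t)).-1 by rewrite sp sP.
    rewrite -lead_coefE {1}sp -lead_coefE (eqP mp).
    by have : P1 * P2 \is monic; [rewrite monicMl|rewrite monicE => /eqP ->; rewrite subrr].
  by rewrite coefB !nth_default ?subrr // ?sp sP.
have szM (u v : {poly C}) a c : (size u <= a)%N -> (size v <= c.+1)%N -> (size (u * v)%R <= a + c)%N.
  move=> ha hc; apply: leq_trans (size_polyMleq u v) _.
  by have := leq_add ha hc; rewrite addnS; case: (_ + _)%N.
rewrite !poly_rV_K.
- rewrite -/(h1 t) -/(h2 t) /e => h.
  have -> : p t = P1 * P2 + (h2 t * P1 + h1 t * P2) + h2 t * h1 t by rewrite -h; ring.
  by ring.
- apply: leq_trans (size_polyD _ _) _; rewrite geq_max se size_polyN szM //.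
  exact: leq_trans (leqnSn _).
- apply: leq_trans (size_polyD _ _) _; rewrite geq_max szM ?s1 //=.
  by rewrite [(d2 + d1)%N]addnC szM ?s2.
Qed.

(** * Local analytic roots of real-rooted polynomials (Rellich) *)

Lemma near_pick s (P : R -> Prop) (d : R) : near s P -> 0 < d ->
  exists e, [/\ 0 < e, e < d, P (s + e) & P (s - e)].
Proof.
move=> [c c0 h] d0; exists (Num.min c d / 2%:R).
have m0 : 0 < Num.min c d by rewrite lt_min c0.
have m1 : Num.min c d <= c by rewrite ge_min lexx.
have m2 : Num.min c d <= d by rewrite ge_min lexx orbT.
have a0 : `|Num.min c d / 2%:R| = Num.min c d / 2%:R by rewrite gtr0_norm //; lra.
split; [lra|lra| |]; apply: h.
  by rewrite addrC addKr a0; lra.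
by rewrite addrC addKr normrN a0; lra.
Qed.

Lemma anat_zero_or_neq0 s f : anat s f ->
  near s (fun t => f t = 0) \/ near s (fun t => t != s -> f t != 0).
Proof.
move=> /anat_factor [|[m [g [hg g0 e]]]]; first by left.
right; apply: near_imp (near_and e (anat_near_neq0 hg g0)) => t [-> gt] ts.
by rewrite mulf_neq0 // expf_neq0 // (inj_eq (@complexI R)) subr_eq0.
Qed.

Lemma anat_punctured_eq s f g : anat s f -> anat s g ->
  near s (fun t => t != s -> f t = g t) -> near s (fun t => f t = g t).
Proof.
move=> hf hg h; case: (anat_zero_or_neq0 (anatB hf hg)) => k.
  by apply: near_imp k => t /eqP; rewrite subr_eq0 => /eqP.
have [e [e0 _ [] + + _]] := near_pick (near_and h k) ltr01.
have ts : s + e != s by rewrite -subr_eq0 addrC addKr gt_eqF.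
by move=> /(_ ts) h1 /(_ ts); rewrite h1 subrr eqxx.
Qed.

Lemma anpoly_punctured_eq s p q N : anpoly s p -> anpoly s q ->
  near s (fun t => (size (p t) <= N)%N) -> near s (fun t => (size (q t) <= N)%N) ->
  near s (fun t => t != s -> p t = q t) -> near s (fun t => p t = q t).
Proof.
move=> hp hq np nq h.
have k (i : 'I_N) : near s (fun t => (p t)`_i = (q t)`_i).
  by apply: anat_punctured_eq => //; apply: near_imp h => t h1 ts; rewrite h1.
apply: near_imp (near_and (near_and np nq) (near_forall_fin k)) => t [[h1 h2] h3].
apply/polyP => i; have [iN|iN] := ltnP i N; first exact: (h3 (Ordinal iN)).
by rewrite !nth_default // (leq_trans _ iN).
Qed.

(** If the order [j] of the zero were below [m], the cofactor [h] would satisfy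
    [|h (s + d)| <= B * d], hence [|h s| <= (B + K) * d], which fails for small [d]. *)
Lemma anat_div_monomial s f B m : anat s f ->
  near s (fun t => t != s -> nc (f t) <= B * `|t - s| ^+ m) ->
  exists2 g, anat s g & near s (fun t => f t = (t - s)%:C ^+ m * g t).
Proof.
move=> hf hB; case: (anat_factor hf) => [f0|[j [h [hh h0 e]]]].
  exists (fun=> 0); first exact: anat_cst.
  by apply: near_imp f0 => t ->; rewrite mulr0.
have [mj|jm] := leqP m j.
  exists (fun t => (t%:C - s%:C) ^+ (j - m) * h t).
    by apply: anatM hh; apply: anatX; apply: anatB (anat_id s) (anat_cst s _).
  by apply: near_imp e => t ->; rewrite -rmorphB mulrA -exprD subnKC.
have [K K0 hK] := anat_lip hh.
have B0 : 0 <= B.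
  have [e1 [e10 _ + _]] := near_pick hB ltr01.
  have ts : s + e1 != s by rewrite -subr_eq0 addrC addKr gt_eqF.
  move=> /(_ ts) h1; have := le_trans (nc_ge0 _) h1.
  by rewrite addrC addKr pmulr_lge0 // exprn_gt0 // normr_gt0 gt_eqF.
have D0 : 0 < nc (h s) / (B + K + 1) by rewrite divr_gt0 ?nc_gt0 //; lra.
have D1 : 0 < Num.min 1 (nc (h s) / (B + K + 1)) by rewrite lt_min ltr01.
have [d [d0 dd [[h1 h2] h3] _]] := near_pick (near_and (near_and hB e) hK) D1.
have ts : s + d != s by rewrite -subr_eq0 addrC addKr gt_eqF.
move: dd; rewrite lt_min => /andP[d1 dd].
move: h1 h3 => /(_ ts); rewrite h2 addrC addKr gtr0_norm // ncM ncX ncR gtr0_norm //.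
rewrite -(subnKC (ltnW jm)) exprD mulrCA ler_pM2l ?exprn_gt0 // => h1.
move=> h3.
have h4 : nc (h (s + d)) <= B * d.
  apply: (le_trans h1); rewrite ler_wpM2l //.
  have : (0 < m - j)%N by rewrite subn_gt0.
  case: (m - j)%N => // n _; rewrite exprS ler_piMr //; first exact: ltW.
  by apply: exprn_ile1; exact: ltW.
have := ncB (h (s + d)) (h (s + d) - h s).
rewrite opprB addrC subrK => h5; exfalso.
move: dd; rewrite ltr_pdivlMr; last by lra.
have := nc_ge0 (h s); nra.
Qed.

(** * Split polynomials: coefficients, shifts and dilations in terms of the roots *)

Definition prodX (s : seq C) : {poly C} := \prod_(z <- s) ('X - z%:P).

Lemma prodX_cons a s : prodX (a :: s) = ('X - a%:P) * prodX s.
Proof. by rewrite /prodX big_cons. Qed.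
Lemma prodX_nil : prodX [::] = 1. Proof. by rewrite /prodX big_nil. Qed.
Lemma prodX_cat s1 s2 : prodX (s1 ++ s2) = prodX s1 * prodX s2.
Proof. by rewrite /prodX big_cat. Qed.
Lemma prodX_monic s : prodX s \is monic. Proof. exact: monic_prod_XsubC. Qed.
Lemma size_prodX s : size (prodX s) = (size s).+1. Proof. exact: size_prod_XsubC. Qed.
Lemma root_prodX s z : root (prodX s) z = (z \in s). Proof. exact: root_prod_XsubC. Qed.

Lemma monic_split (p : {poly C}) : p \is monic -> exists2 s, p = prodX s & (size s).+1 = size p.
Proof.
move=> mp; have [s e] := closed_field_poly_normal p.
have es : p = prodX s by rewrite {1}e (eqP mp) scale1r.
by exists s; rewrite // es size_prodX.
Qed.

Lemma coef_mulXsubC (a : C) P i :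
  (('X - a%:P) * P)`_i = (if i is j.+1 then P`_j else 0) - a * P`_i.
Proof. by rewrite mulrBl coefB coefXM coefCM; case: i. Qed.

Lemma prodX_coef_top s n : size s = n.+1 -> (prodX s)`_n = - \sum_(z <- s) z.
Proof.
elim: n s => [|n IH] [|a s] //= [].
  by move=> /size0nil ->; rewrite prodX_cons prodX_nil coef_mulXsubC coefC big_seq1 sub0r mulr1.
move=> e; rewrite prodX_cons coef_mulXsubC IH // big_cons opprD addrC; congr (_ + _).
have := prodX_monic s; rewrite monicE /lead_coef size_prodX e /= => /eqP ->.
by rewrite mulr1.
Qed.

(** Newton's identity; it makes the sum of the squared roots an analytic function of [t]. *)
Lemma prodX_coef_top2 s n : size s = n.+2 ->
  2%:R * (prodX s)`_n = (\sum_(z <- s) z) ^+ 2 - \sum_(z <- s) z ^+ 2.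
Proof.
elim: n s => [|n IH] [|a s] //= [].
  case: s => [|b [|]] //= _.
  rewrite 2!prodX_cons prodX_nil 2!coef_mulXsubC coefC /= !big_cons !big_nil.
  by ring.
move=> e; rewrite prodX_cons coef_mulXsubC !big_cons mulrBr IH // (prodX_coef_top e).
by ring.
Qed.

Lemma prodX_shift s c : prodX s \Po ('X + c%:P) = prodX [seq z - c | z <- s].
Proof.
elim: s => [|a s IH]; first by rewrite /= prodX_nil comp_polyC.
rewrite /= !prodX_cons comp_polyM IH comp_polyB comp_polyX comp_polyC polyCB.
by congr (_ * _); ring.
Qed.

Lemma prodX_scale s (tau : C) i : (i <= size s)%N ->
  (prodX [seq tau * z | z <- s])`_i = tau ^+ (size s - i) * (prodX s)`_i.
Proof.
elim: s i => [|a s IH] i /=; first by rewrite prodX_nil mul1r.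
rewrite !prodX_cons !coef_mulXsubC; case: i => [|i] ih.
  by rewrite !sub0r IH // !subn0 exprS; ring.
rewrite IH // subSS; have [lt|ge] := ltnP i (size s).
  have -> : (size s - i = (size s - i.+1).+1)%N by rewrite -subSn // subSS.
  by rewrite (IH i.+1) // exprS; ring.
rewrite !(@nth_default _ 0 _ i.+1) ?mulr0 ?subr0 // size_prodX ?size_map //.
Qed.

Lemma prodX_coef_bound s (G : R) i : 0 <= G -> (forall z, z \in s -> nc z <= G) ->
  nc ((prodX s)`_i) <= (1 + G) ^+ size s.
Proof.
move=> G0; elim: s i => [|a s IH] i h.
  rewrite prodX_nil expr0 coefC; case: ifP => _; by rewrite ?nc1 ?nc0.
rewrite prodX_cons coef_mulXsubC /= exprS mulrDl mul1r.
have h' : forall z, z \in s -> nc z <= G by move=> z zs; apply: h; rewrite inE zs orbT.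
apply: (le_trans (ncB _ _)); apply: lerD; last first.
  rewrite ncM; apply: ler_pM; rewrite ?nc_ge0 ?IH //; exact: h (mem_head _ _).
case: i => [|i]; last exact: IH.
by rewrite nc0 exprn_ge0 // addr_ge0.
Qed.

Definition realrooted (p : {poly C}) := forall z, root p z -> Im z = 0.

Lemma sum_sqr_eq0 (s : seq C) : (forall z, z \in s -> Im z = 0) ->
  \sum_(z <- s) z ^+ 2 = 0 -> forall z, z \in s -> z = 0.
Proof.
move=> hr h.
have h2 : \sum_(z <- s) Re z ^+ 2 = 0.
  rewrite -[RHS](congr1 Re h) Csum_Re !big_seq; apply: eq_bigr => z /hr iz.
  by rewrite !expr2 cReM iz mulr0 subr0.
move/eqP: h2; rewrite psumr_eq0 => [/allP k|z _]; last exact: sqr_ge0.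
move=> z zs; have := k z zs; rewrite /= expf_eq0 /= => /eqP rz.
by move: rz (hr z zs); case: z {zs} => a b /= -> ->.
Qed.

(** For odd [m] the power changes sign at [s], so the real part of [g] is nonnegative on the right
    and nonpositive on the left, while its imaginary part vanishes on the right. The Lipschitz bound
    then gives [|g s| <= 2 * K * d], too small for the chosen [d]. *)
Lemma even_order s (q g : R -> C) m : anat s g -> g s != 0 ->
  near s (fun t => t != s -> Im (q t) = 0 /\ 0 <= Re (q t)) ->
  near s (fun t => q t = (t - s)%:C ^+ m * g t) -> ~~ odd m.
Proof.
move=> hg g0 hq e; apply/negP => om.
have [K K0 hK] := anat_lip hg.
have n0 := nc_gt0 g0.
have D0 : 0 < nc (g s) / (4%:R * (K + 1)) by rewrite divr_gt0 //; lra.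
have [d [d0 dd P1 P2]] := near_pick (near_and (near_and hq e) hK) D0.
move: dd; rewrite ltr_pdivlMr; last by lra.
move=> dd.
have dm : 0 < d ^+ m by rewrite exprn_gt0.
case: P1 => -[h1 e1] k1; case: P2 => -[h2 e2] k2.
have ts1 : s + d != s by rewrite -subr_eq0 addrC addKr gt_eqF.
have ts2 : s - d != s by rewrite -subr_eq0 addrC addKr oppr_eq0 gt_eqF.
move: h1 h2 => /(_ ts1) [i1 r1] /(_ ts2) [i2 r2].
move: e1 e2 k1 k2; rewrite ![_ - s]addrC !addKr normrN gtr0_norm // -!rmorphXn /=.
rewrite exprNn -signr_odd om expr1 mulN1r => e1 e2 k1 k2.
move: i1 r1 r2; rewrite e1 e2 cImRM !cReRM => /eqP.
rewrite mulf_eq0 gt_eqF //= => /eqP i1 r1 r2.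
rewrite pmulr_rge0 // in r1; rewrite mulNr oppr_ge0 pmulr_rle0 // in r2.
have a1 := le_trans (nc_Re _) k1; have a2 := le_trans (nc_Im _) k1.
have a3 := le_trans (nc_Re _) k2.
move: a1 a2 a3; rewrite !cReD !cImD !cReN !cImN i1 sub0r normrN !ler_norml => /andP[_ a1] a2 /andP[a3 _].
have := nc_le (g s); have : `|Re (g s)| <= K * d by rewrite ler_norml; lra.
have : `|Im (g s)| <= K * d by rewrite ler_norml.
nra.
Qed.

Lemma poly_rescale N (P Q : {poly C}) (tau : C) s : size P = N.+1 -> size Q = N.+1 ->
  (forall i, (i <= N)%N -> Q`_i = tau ^+ (N - i) * P`_i) -> P = prodX s ->
  Q = prodX [seq tau * z | z <- s].
Proof.
move=> sP sQ h e; have ss : size s = N.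
  by apply: succn_inj; rewrite -size_prodX -e.
apply/polyP => i; have [iN|iN] := leqP i N.
  by rewrite prodX_scale ss // h // e.
by rewrite !nth_default // ?size_prodX ?size_map ?ss ?sQ.
Qed.

Lemma prodX_coprime s1 s2 : (forall z, z \in s1 -> z \notin s2) -> coprimep (prodX s1) (prodX s2).
Proof.
elim: s1 => [|a s1 IH] h; first by rewrite prodX_nil coprime1p.
rewrite prodX_cons coprimepMl coprimep_sym coprimep_XsubC root_prodX h ?mem_head //=.
by apply: IH => z zs; apply: h; rewrite inE zs orbT.
Qed.

Definition roots_at (L : seq (R -> C)) t := prodX [seq f t | f <- L].

(** Real-rootedness is assumed off [s] because this is what the induction can supply: the roots of
    the rescaled polynomial are related to those of [p t] only where [tau t] is invertible. *)
Lemma local_rellich N s (p : R -> {poly C}) : anpoly s p ->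
  near s (fun t => p t \is monic /\ size (p t) = N.+1) ->
  near s (fun t => t != s -> realrooted (p t)) ->
  exists L, (forall f, List.In f L -> anat s f) /\ near s (fun t => p t = roots_at L t).
Proof.
elim/ltn_ind: N s p => N IH s p hp hm hr.
have [N0|N1] := leqP N 1.
  case: N N0 {IH} hm => [|[|//]] _ hm.
    exists [::]; split=> //; apply: near_imp hm => t [mp sp].
    have [r e sr] := monic_split mp; rewrite e; move: sr; rewrite sp => -[/size0nil ->].
    by rewrite /roots_at.
  exists [:: fun t => - (p t)`_0]; split.
    by move=> f [<-|//]; apply: anatN; exact: hp.
  apply: near_imp hm => t [mp sp].
  have [r e sr] := monic_split mp; move: sr; rewrite sp => -[sr].
  have := prodX_coef_top sr; rewrite -e /roots_at /= => ->.
  by case: r sr e => [|a [|]] //= _ ->; rewrite big_seq1 opprK.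
case: N N1 IH hm => [|[|n]] // _; set N := n.+2 => IH hm.
(* The mean of the roots: the coefficient below the leading one is minus their sum. *)
pose mu t := - (N%:R)^-1 * (p t)`_n.+1.
have hmu : anat s mu by apply: anatZ.
pose ph t := p t \Po ('X + (mu t)%:P).
have hph : anpoly s ph.
  apply: (@anpoly_comp _ _ _ N.+1) => //; first by apply: near_imp hm => t [_ ->].
  by apply: anpolyD (anpoly_cst _ _) _; apply: anpolyC.
have N0 : (N%:R : C) != 0 by rewrite pnatr_eq0.
have roots : near s (fun t => exists rs, [/\ size rs = N, p t = prodX rs,
    ph t = prodX [seq z - mu t | z <- rs] & \sum_(z <- [seq z - mu t | z <- rs]) z = 0]).
  apply: near_imp hm => t [mp sp]; have [rs e sr] := monic_split mp.
  have {}sr : size rs = N by apply: succn_inj; rewrite sr sp.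
  exists rs; split => //; first by rewrite /ph e prodX_shift.
  rewrite big_map sumrB big_const_seq count_predT sr iter_addr_0.
  rewrite /mu e prodX_coef_top // mulNr mulrN opprK -[X in _ - X]mulr_natl mulrA.
  by rewrite mulfV // mul1r subrr.
pose q t := - 2%:R * (ph t)`_n.
have hq : anat s q by apply: anatZ.
have qE : near s (fun t => exists rs, [/\ size rs = N, p t = prodX rs,
    ph t = prodX [seq z - mu t | z <- rs] & q t = \sum_(z <- [seq z - mu t | z <- rs]) z ^+ 2]).
  apply: near_imp roots => t [rs [e1 e2 e3 e4]]; exists rs; split=> //.
  have := @prodX_coef_top2 [seq z - mu t | z <- rs] n; rewrite size_map => /(_ e1).
  by rewrite e4 expr0n sub0r /q mulNr e3 => ->; rewrite opprK.
have realr : near s (fun t => t != s -> exists rs, [/\ size rs = N, p t = prodX rs,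
    ph t = prodX [seq z - mu t | z <- rs], q t = \sum_(z <- [seq z - mu t | z <- rs]) z ^+ 2
    & forall z, z \in [seq z - mu t | z <- rs] -> Im z = 0]).
  apply: near_imp (near_and (near_and hm hr) qE) => t [[[mp sp] rr] [rs [e1 e2 e3 e4]]] ts.
  have rz z : z \in rs -> Im z = 0 by move=> zrs; apply: (rr ts); rewrite e2 root_prodX.
  exists rs; split=> // z /mapP[w wrs ->]; rewrite cImD cImN rz // /mu e2.
  rewrite prodX_coef_top // mulNr mulrN opprK.
  have -> : (N%:R^-1 : C) = (N%:R^-1)%:C by rewrite fmorphV rmorph_nat.
  rewrite cImRM Csum_Im big_seq big1 ?mulr0 ?subr0 // => v; exact: rz.
case: (anat_factor hq) => [q0|[m [g [hg g0 eg]]]].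
  exists (nseq N mu); split; first by elim: (N) => //= k h f [<-|/h].
  apply: (@anpoly_punctured_eq _ _ _ N.+1) => //.
  - move=> i; rewrite /roots_at; suff : anpoly s (fun t => \prod_(i < N) ('X - (mu t)%:P)).
      by move=> /(_ i); apply: anat_eq => t; rewrite map_nseq /prodX big_const_ord big_nseq.
    apply: anpoly_prod => j; apply: anpolyD (anpoly_cst _ _) _; apply: anpolyN; exact: anpolyC.
  - by apply: near_imp hm => t [_ ->].
  - by apply: near_all => t; rewrite size_prodX size_map size_nseq.
  apply: near_imp (near_and q0 realr) => t [qt hh] ts.
  (* Real numbers whose squares sum to zero vanish, so every root equals the mean. *)
  have [rs [e1 e2 e3 e4 e5]] := hh ts; rewrite e2 /roots_at; congr prodX.
  have z0 z : z \in rs -> z = mu t.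
    move=> zr; apply/eqP; rewrite -subr_eq0; apply/eqP.
    apply: (sum_sqr_eq0 e5); first by rewrite -e4.
    by apply/mapP; exists z.
  rewrite map_nseq -e1; elim: rs z0 {e1 e2 e3 e4 e5 hh} => //= a rs h z0.
  rewrite (z0 a) ?mem_head // -h // => z zr; apply: z0; by rewrite inE zr orbT.
have em : ~~ odd m.
  apply: (even_order hg g0) eg; apply: near_imp realr => t h ts.
  have [rs [_ _ _ -> rr]] := h ts; rewrite Csum_Im Csum_Re; split.
    by rewrite big_seq big1 // => z /rr iz; rewrite expr2 cImM iz mulr0 mul0r addr0.
  rewrite big_seq; apply: sumr_ge0 => z /rr iz.
  by rewrite expr2 cReM iz mulr0 subr0 -expr2 sqr_ge0.
pose k := m./2; have mk : m = (k * 2)%N by rewrite muln2 /k -[LHS]odd_double_half (negbTE em).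
have [K K0 hK] := anat_lip hg.
(* [G] bounds [g] near [s]; it is at least [1] so that [nc z ^+ 2 <= G] implies [nc z <= G] without
   a square root. *)
pose G := nc (g s) + K + 1.
have G1 : 1 <= G by rewrite /G lerDr addr_ge0 ?nc_ge0.
have G0 : 0 <= G := le_trans ler01 G1.
have hG : near s (fun t => nc (g t) <= G).
  have h1 : near s (fun t => `|t - s| < 1) by exists 1.
  apply: near_imp (near_and h1 hK) => t [h2 h3].
  have := ncD (g t - g s) (g s); rewrite subrK => /le_trans; apply.
  rewrite addrC /G -addrA lerD2l; apply: (le_trans h3).
  by apply: (@le_trans _ _ K); rewrite ?lerDl // ler_piMr // ltW.
pose tau t : C := (t - s)%:C ^+ k.
have tau0 t : t != s -> tau t != 0.
  by move=> ts; rewrite expf_neq0 // (inj_eq (@complexI R)) subr_eq0.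
(* Each squared real root is at most the sum [q t] of all of them, so the centred roots have size at
   most a constant times [tau t]. *)
have scaled : near s (fun t => t != s -> exists ss, [/\ size ss = N,
    ph t = prodX [seq tau t * z | z <- ss], (forall z, z \in ss -> nc z <= G) &
    (forall z, z \in ss -> Im z = 0)]).
  apply: near_imp (near_and (near_and hG eg) realr) => t [[gG et] h] ts.
  have [rs [e1 e2 e3 e4 e5]] := h ts; have t0 := tau0 t ts.
  exists [seq (z - mu t) / tau t | z <- rs]; split.
  - by rewrite size_map.
  - rewrite e3 -map_comp; congr prodX; apply: eq_map => z /=.
    by rewrite mulrCA mulfV // mulr1.
  - move=> z /mapP[w wr ->].
    have n0 : 0 < nc (tau t) by apply: nc_gt0.
    suff h2 : nc (w - mu t) ^+ 2 <= nc (tau t) ^+ 2 * G.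
      have hv : nc ((w - mu t) / tau t) * nc (tau t) = nc (w - mu t).
        by rewrite -ncM mulfVK.
      rewrite -(ler_pM2r n0) hv -ler_sqr ?nnegrE ?nc_ge0 ?mulr_ge0 ?nc_ge0 //.
      apply: (le_trans h2); rewrite exprMn mulrC ler_pM2r ?exprn_gt0 //.
      by rewrite expr2 ler_peMl.
    have -> : nc (tau t) ^+ 2 = nc ((t - s)%:C ^+ m) by rewrite mk exprM !ncX.
    apply: (@le_trans _ _ (nc (q t))); last first.
      by rewrite et ncM ler_wpM2l ?nc_ge0.
    have hwm : w - mu t \in [seq z - mu t | z <- rs] by apply/mapP; exists w.
    have -> : q t = (\sum_(z <- [seq z - mu t | z <- rs]) Re z ^+ 2)%:C.
      rewrite e4 rmorph_sum !big_seq; apply: eq_bigr => x /e5; case: x => a b /= ->.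
      by rewrite complexr0 -rmorphXn.
    rewrite ncR ger0_norm; last by apply: sumr_ge0 => x _; exact: sqr_ge0.
    rewrite nc_sqr (e5 _ hwm) expr0n addr0 (perm_big _ (perm_to_rem hwm)) big_cons /=.
    by rewrite lerDl; apply: sumr_ge0 => x _; exact: sqr_ge0.
  - move=> z /mapP[w wr ->].
    have hwm : w - mu t \in [seq z - mu t | z <- rs] by apply/mapP; exists w.
    rewrite /tau -rmorphXn -fmorphV mulrC cImRM (e5 _ hwm) mulr0 //.
(* The coefficient of degree [i] is homogeneous of degree [N - i] in the roots, so the bound on the
   rescaled roots lets the corresponding power of [t - s] be divided out. *)
have hb (i : 'I_N) : exists2 b, anat s b &
    near s (fun t => (ph t)`_i = (t - s)%:C ^+ (k * (N - i)) * b t).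
  apply: (@anat_div_monomial _ _ ((1 + G) ^+ N)) => //.
  apply: near_imp scaled => t h ts; have [ss [e1 e2 e3 e4]] := h ts.
  rewrite e2 prodX_scale ?e1 ?(ltnW (ltn_ord i)) // ncM mulrC -[in leRHS]ncR -ncX /tau.
  rewrite -exprM; apply: ler_wpM2r; first exact: nc_ge0.
  by have := prodX_coef_bound i G0 e3; rewrite e1.
pose b i := proj1_sig (constructive_indefinite_description _
  (let: ex_intro2 f h1 h2 := hb i in ex_intro (fun f => anat s f /\ near s (fun t => (ph t)`_i = (t - s)%:C ^+ (k * (N - i)) * f t)) f (conj h1 h2))).
have [b1 b2] : (forall i, anat s (b i)) /\
    forall i : 'I_N, near s (fun t => (ph t)`_i = (t - s)%:C ^+ (k * (N - i)) * b i t).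
  by split=> i; rewrite /b; case: (constructive_indefinite_description _ _) => f [].
pose pt t : {poly C} := 'X^N + \sum_(i < N) (b i t) *: 'X^i.
have hpt : anpoly s pt.
  apply: anpolyD (anpoly_cst _ _) _; apply: anpoly_sum => i.
  by apply: anpolyZ => //; exact: anpoly_cst.
have szb t : (size (\sum_(i < N) (b i t) *: 'X^i)%R <= N)%N.
  apply: leq_trans (size_sum _ _ _) _; apply/bigmax_leqP => i _.
  by apply: leq_trans (size_scale_leq _ _) _; rewrite size_polyXn.
have [mpt spt] : (forall t, pt t \is monic) /\ forall t, size (pt t) = N.+1.
  have h t : (size (\sum_(i < N) (b i t) *: 'X^i)%R <= (size ('X^N : {poly C})).-1)%N.
    by rewrite size_polyXn.
  by split=> t; have [h1 h2] := monicDl (monicXn _ _) (h t); rewrite // /pt h2 size_polyXn.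
have cpt t (i : 'I_N) : (pt t)`_i = b i t.
  rewrite /pt coefD coefXn ltn_eqF // add0r coef_sum (bigD1 i) //= coefZ coefXn eqxx mulr1.
  by rewrite big1 ?addr0 // => j ji; rewrite coefZ coefXn eq_sym val_eqE (negbTE ji) mulr0.
have ptN t : (pt t)`_N = 1.
  by have := mpt t; rewrite monicE /lead_coef spt => /eqP.
have resc : near s (fun t => forall i, (i <= N)%N -> (ph t)`_i = tau t ^+ (N - i) * (pt t)`_i).
  apply: near_imp (near_and roots (near_forall_fin b2)) => t [[rs [e1 _ e3 _]] h] i.
  rewrite leq_eqVlt => /orP[/eqP->|iN].
    rewrite subnn expr0 mul1r ptN e3; have := prodX_monic [seq z - mu t | z <- rs].
    by rewrite monicE /lead_coef size_prodX size_map e1 => /eqP.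
  by have := h (Ordinal iN); rewrite -(cpt t (Ordinal iN)) /= => ->; rewrite /tau exprM.
have rrpt : near s (fun t => t != s -> realrooted (pt t)).
  apply: near_imp (near_and scaled resc) => t [h1 h2] ts.
  have [ss [e1 e2 e3 e4]] := h1 ts; suff -> : pt t = prodX ss.
    by move=> z; rewrite root_prodX; exact: e4.
  apply/polyP => i; have [iN|iN] := leqP i N.
    have := h2 i iN; rewrite e2 prodX_scale e1 // => e.
    have tn : tau t ^+ (N - i) != 0 by rewrite expf_neq0 // tau0.
    exact: (mulfI tn (esym e)).
  by rewrite !nth_default ?spt ?size_prodX ?e1.
have [zs ezs szs] := monic_split (mpt s).
have {}szs : size zs = N by apply: succn_inj; rewrite szs spt.
have phN1 : near s (fun t => (ph t)`_n.+1 = 0).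
  apply: near_imp roots => t [rs [e1 _ -> e4]].
  by rewrite prodX_coef_top ?size_map // e4 oppr0.
(* The first two power sums of the rescaled roots are found away from [s], where [tau] can be
   cancelled, and reach [s] by analyticity. *)
have ptN1 : near s (fun t => (pt t)`_n.+1 = 0).
  apply: anat_punctured_eq => //; first exact: anat_cst.
  apply: near_imp (near_and phN1 resc) => t [h1 h2] ts.
  move: (h2 n.+1 (leqnSn _)); rewrite h1 => /esym/eqP.
  by rewrite mulf_eq0 expf_eq0 (negbTE (tau0 t ts)) andbF /= => /eqP.
have ptN2 : near s (fun t => - 2%:R * (pt t)`_n = g t).
  apply: anat_punctured_eq => //; first by apply: anatZ.
  apply: near_imp (near_and resc eg) => t [h2 h3] ts.
  have h4 := h2 n (leq_trans (leqnSn _) (leqnSn _)).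
  apply: (@mulfI _ ((t - s)%:C ^+ m)).
    by rewrite expf_neq0 // (inj_eq (@complexI R)) subr_eq0.
  rewrite -h3 /q h4 (_ : (N - n)%N = 2); last by rewrite /N -addn2 addKn.
  by rewrite /tau -exprM -mk; ring.
have sum0 : \sum_(z <- zs) z = 0.
  have := near_self ptN1; rewrite ezs prodX_coef_top // => /eqP.
  by rewrite oppr_eq0 => /eqP.
have sum2 : \sum_(z <- zs) z ^+ 2 != 0.
  apply: contraNneq g0 => h; rewrite -(near_self ptN2) ezs mulNr prodX_coef_top2 //.
  by rewrite sum0 h expr0n subrr oppr0.
(* Collecting all copies of one root makes the two factors coprime. The second factor has a root,
   because equal roots with sum zero would have zero sum of squares. *)
pose al := head 0 zs.
pose z1 := [seq z <- zs | z == al]; pose z2 := [seq z <- zs | z != al].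
have ez : prodX zs = prodX z1 * prodX z2.
  by rewrite -prodX_cat; apply: perm_big; rewrite perm_sym /z1 /z2 perm_filterC.
have sz : (size z1 + size z2)%N = N by rewrite -szs /z1 /z2 !size_filter count_predC.
have s10 : (0 < size z1)%N.
  rewrite size_filter -has_count; apply/hasP; exists al => //.
  by rewrite /al; move: szs; case: (zs) => //= a l _; exact: mem_head.
have s20 : (0 < size z2)%N.
  case: (ltnP 0 (size z2)) => //; rewrite leqn0 => /nilP z2nil.
  have hal : all (pred1 al) zs.
    apply/allP => z zz /=; apply: contraT => za.
    by have := mem_filter (fun z => z != al) z zs; rewrite -/z2 z2nil zz za.
  have ez0 := all_pred1P _ _ hal; rewrite szs in ez0.
  move: sum0 sum2; rewrite ez0 !big_nseq !iter_addr_0 -mulr_natl => /eqP.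
  by rewrite mulf_eq0 (negbTE N0) /= => /eqP ->; rewrite expr0n mul0rn eqxx.
have cop : coprimep (prodX z1) (prodX z2).
  by apply: prodX_coprime => z; rewrite !mem_filter => /andP[/eqP -> _]; rewrite eqxx.
have hmpt : near s (fun t => pt t \is monic /\ size (pt t) = size (prodX z1 * prodX z2)).
  by apply: near_all => t; rewrite -ez -ezs !spt.
have [p1 [p2 [hp1 hp2 h12]]] :=
  hensel hpt (etrans ezs ez) (prodX_monic _) (prodX_monic _) cop hmpt.
have rr12 : near s (fun t => t != s -> realrooted (p1 t) /\ realrooted (p2 t)).
  apply: near_imp (near_and rrpt h12) => t [h [e _ _ _ _]] /h; rewrite e => k1.
  by split=> z rz; apply: k1; rewrite rootM rz ?orbT.
have lt1 : (size z1 < N)%N by rewrite -sz -addn1 leq_add2l.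
have lt2 : (size z2 < N)%N by rewrite -sz -add1n leq_add2r.
have hm1 : near s (fun t => p1 t \is monic /\ size (p1 t) = (size z1).+1).
  by apply: near_imp h12 => t [_ ? _ -> _]; rewrite size_prodX.
have hm2 : near s (fun t => p2 t \is monic /\ size (p2 t) = (size z2).+1).
  by apply: near_imp h12 => t [_ _ ? _ ->]; rewrite size_prodX.
have rr1 := near_imp (fun t h ts => proj1 (h ts)) rr12.
have rr2 := near_imp (fun t h ts => proj2 (h ts)) rr12.
have [L1 [a1 r1]] := IH _ lt1 s p1 hp1 hm1 rr1.
have [L2 [a2 r2]] := IH _ lt2 s p2 hp2 hm2 rr2.
exists [seq (fun t => mu t + tau t * f t) | f <- L1 ++ L2]; split.
  move=> f /List.in_map_iff[h [<- hin]].
  have hh : anat s h by case: (List.in_app_or _ _ _ hin); [exact: a1|exact: a2].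
  apply: anatD => //; apply: anatM => //.
  apply: (@anat_eq _ (fun t => (t%:C - s%:C) ^+ k)); first by move=> t; rewrite -rmorphB.
  by apply: anatX; apply: anatB (anat_id s) (anat_cst s _).
apply: near_imp (near_and (near_and (near_and r1 r2) h12) (near_and roots resc)) =>
  t [[[e1 e2] [e3 _ _ _ _]] [[rs [f1 f2 f3 _]] h]].
have ept : pt t = prodX [seq f t | f <- L1 ++ L2].
  by rewrite e3 e1 e2 map_cat prodX_cat.
have sph : size (ph t) = N.+1 by rewrite f3 size_prodX size_map f1.
have eph := poly_rescale (spt t) sph h ept.
have -> : p t = ph t \Po ('X + (- mu t)%:P).
  rewrite /ph -comp_polyA comp_polyD comp_polyX comp_polyC polyCN addrNK.
  by rewrite comp_polyXr.
rewrite eph prodX_shift /roots_at; congr prodX.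
by rewrite -!map_comp; apply: eq_map => f /=; rewrite opprK addrC.
Qed.

(** * Continuation along an interval *)

(** Open intervals, possibly unbounded, as open convex sets: this form passes to intersections and
    to overlapping unions. *)
Definition opc (D : R -> Prop) := (forall s, D s -> near s D) /\
  (forall a b t, D a -> D b -> a <= t -> t <= b -> D t).
Definition an (D : R -> Prop) f := forall s, D s -> anat s f.

Lemma near_true s (P : R -> Prop) (D : R -> Prop) : opc D -> D s -> (forall t, D t -> P t) -> near s P.
Proof. by move=> [o _] Ds h; apply: near_imp (o s Ds). Qed.

Lemma opcI D E : opc D -> opc E -> opc (fun t => D t /\ E t).
Proof.
move=> [o1 c1] [o2 c2]; split; first by move=> s [/o1 h1 /o2 h2]; apply: near_and.
by move=> a b t [? ?] [? ?] *; split; [apply: (c1 a b)|apply: (c2 a b)].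
Qed.

Lemma opcU D E z : opc D -> opc E -> D z -> E z -> opc (fun t => D t \/ E t).
Proof.
move=> [o1 c1] [o2 c2] Dz Ez; split.
  move=> s [/o1|/o2]; first by apply: near_imp; left.
  by apply: near_imp; right.
move=> a b t ha hb la lb; have [le|/ltW le] := leP t z.
  by case: ha => h; [left; apply: (c1 a z)|right; apply: (c2 a z)].
by case: hb => h; [left; apply: (c1 z b)|right; apply: (c2 z b)].
Qed.

Lemma opc_ball s d : opc (fun t => `|t - s| < d).
Proof.
split=> [t ts|a b t].
  exists (d - `|t - s|); first by rewrite subr_gt0.
  move=> u; rewrite ltrBrDr; apply: le_lt_trans; have -> : u - s = u - t + (t - s) by ring.
  exact: ler_normD.
by rewrite !ltr_norml => /andP[h1 h2] /andP[h3 h4] h5 h6; apply/andP; split; lra.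
Qed.

(** The hypothesis makes [P] locally constant, so this is connectedness. It is proved at the
    supremum [c] of the points of [[a, b]] where [P] holds: [P] passes from a point near [c] to one
    beyond it, unless [b] is reached. *)
Lemma interval_induction_le (D P : R -> Prop) a b : (forall t, a <= t -> t <= b -> D t) ->
  (forall s, D s -> exists2 d, 0 < d & forall t u, D t -> D u ->
     `|t - s| < d -> `|u - s| < d -> P t -> P u) ->
  a <= b -> P a -> P b.
Proof.
move=> hD hP ab Pa.
pose E x := a <= x /\ x <= b /\ P x.
have [|| c [ub lub]] := completeness E.
- by exists b => x [_ [xb _]]; apply/RleP.
- by exists a; split.
have ac : a <= c by apply/RleP; apply: ub; split.
have cb : c <= b by apply/RleP; apply: lub => x [_ [xb _]]; apply/RleP.
have [d d0 h] := hP c (hD c ac cb).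
have [x [[ax [xb Px]] xc]] : exists x, E x /\ c - d < x.
  apply: NNPP => ne; suff : c <= c - d by lra.
  apply/RleP; apply: lub => x Ex; apply/RleP; rewrite leNgt; apply/negP => lt.
  by apply: ne; exists x.
have xc' : x <= c by apply/RleP; apply: ub; split.
pose u := Num.min (c + d / 2%:R) b.
have ub' : u <= b by rewrite ge_min lexx orbT.
have cu : c <= u by rewrite le_min cb andbT; lra.
have ud : u <= c + d / 2%:R by rewrite ge_min lexx.
have Pu : P u.
  apply: (h x u) Px; first exact: hD.
  - by apply: hD => //; apply: le_trans cu.
  - by rewrite ltr_norml; lra.
  - by rewrite ltr_norml; lra.
have uc : u <= c by apply/RleP; apply: ub; split=> //; apply: le_trans cu.
have [bd|bd] := leP b (c + d / 2%:R); first by move: Pu; rewrite /u min_r.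
by move: uc; rewrite /u min_l ?(ltW bd) //; lra.
Qed.

Lemma interval_induction (D P : R -> Prop) a b : opc D ->
  (forall s, D s -> exists2 d, 0 < d & forall t u, D t -> D u ->
     `|t - s| < d -> `|u - s| < d -> P t -> P u) ->
  D a -> D b -> P a -> P b.
Proof.
move=> [_ cv] hP Da Db; have [ab|/ltW ba] := leP a b.
  by apply: (@interval_induction_le D) => // t; exact: cv.
rewrite -[a]opprK -[b]opprK.
apply: (@interval_induction_le (fun t => D (- t)) (fun t => P (- t))); last by lra.
  by move=> t h1 h2; apply: (cv b a) => //; lra.
move=> s Ds; have [d d0 h] := hP _ Ds; exists d => // t u Dt Du td ud.
by apply: h => //; rewrite -opprD normrN.
Qed.

Lemma an_identity D f a : opc D -> an D f -> D a -> near a (fun t => f t = 0) ->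
  forall t, D t -> f t = 0.
Proof.
move=> oD hf Da fa t Dt; suff : near t (fun t => f t = 0) by exact: near_self.
move: fa; apply: (@interval_induction D (fun t => near t (fun t => f t = 0)) a t oD) => // s Ds.
case: (anat_zero_or_neq0 (hf s Ds)) => [/near_near[d d0 h]|[d d0 h]].
  by exists d => // x u _ _ _ ud _; exact: h.
exists d => // x u _ _ xd _ hx; exfalso.
have [xs|xs] := eqVneq x s; last by have /eqP := near_self hx; apply/negP; exact: h.
have [e [e0 ed h1 _]] := near_pick hx d0.
have : f (x + e) != 0.
  have -> : x + e = e + s by rewrite xs addrC.
  by apply: h; rewrite -1?subr_eq0 addrK ?gt_eqF // gtr0_norm.
by rewrite h1 eqxx.
Qed.

Lemma an_identity2 D f g a : opc D -> an D f -> an D g -> D a -> near a (fun t => f t = g t) ->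
  forall t, D t -> f t = g t.
Proof.
move=> oD hf hg Da h t Dt; apply/eqP; rewrite -subr_eq0; apply/eqP.
apply: (@an_identity D (fun t => f t - g t) a) => // [s Ds|].
  by apply: anatB; [exact: hf|exact: hg].
by apply: near_imp h => x ->; rewrite subrr.
Qed.

(** Where [f] is nonzero it stays so nearby, hence [g] vanishes on a neighbourhood and then
    everywhere by the identity theorem. *)
Lemma an_domain D f g : opc D -> an D f -> an D g -> (forall t, D t -> f t * g t = 0) ->
  (forall t, D t -> f t = 0) \/ (forall t, D t -> g t = 0).
Proof.
move=> oD hf hg h.
have [e|ne] := excluded_middle_informative (exists a, D a /\ f a != 0); last first.
  left=> t Dt; apply/eqP; apply: contraT => ft; case: ne; by exists t.
right; case: e => a [Da fa]; apply: (@an_identity D g a) => //.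
apply: near_imp (near_and (proj1 oD a Da) (anat_near_neq0 (hf a Da) fa)) => t [Dt ft].
by have /eqP := h t Dt; rewrite mulf_eq0 (negbTE ft) => /eqP.
Qed.

Lemma anpoly_roots_at s L : (forall f, List.In f L -> anat s f) -> anpoly s (roots_at L).
Proof.
elim: L => [|f L IH] h.
  by apply: anpoly_eq (anpoly_cst s 1) => t; rewrite /roots_at prodX_nil.
apply: (@anpoly_eq _ (fun t => ('X - (f t)%:P) * roots_at L t)) => [t|].
  by rewrite /roots_at /= prodX_cons.
apply: anpolyM; last by apply: IH => g gL; apply: h; right.
by apply: anpolyD (anpoly_cst _ _) _; apply: anpolyN; apply: anpolyC; apply: h; left.
Qed.

(** A vanishing product of the functions [F - f] has a factor that vanishes on the whole interval,
    even though different factors may vanish at the same time. *)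
Lemma an_branch D L F a : opc D -> D a -> an D F -> (forall f, List.In f L -> an D f) ->
  (forall t, D t -> root (roots_at L t) (F t)) ->
  exists2 f, List.In f L & forall t, D t -> F t = f t.
Proof.
move=> oD Da hF; elim: L => [|f L IH] hL h.
  by have := h a Da; rewrite /roots_at root_prodX.
have hf : an D f by apply: hL; left.
case: (@an_domain D (fun t => F t - f t) (fun t => (roots_at L t).[F t])) => //.
- by move=> s Ds; apply: anatB; [exact: hF|exact: hf].
- move=> s Ds; have hp : anpoly s (roots_at L).
    by apply: anpoly_roots_at => g gL; apply: hL => //; right.
  apply: (@anat_eq _ (fun t => \sum_(i < (size L).+1) (roots_at L t)`_i * F t ^+ i)) => [t|].
    by rewrite horner_coef size_prodX size_map.
  by apply: anat_sum => i _; apply: anatM => //; apply: anatX; exact: hF.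
- move=> t Dt; have /rootP := h t Dt; rewrite /roots_at /= prodX_cons hornerM.
  by rewrite hornerXsubC.
- by move=> k; exists f; [left|move=> t Dt; apply/eqP; rewrite -subr_eq0 k].
move=> k; have [||g gL hg] := IH.
- by move=> g gL; apply: hL; right.
- by move=> t Dt; apply/rootP; exact: k.
by exists g => //; right.
Qed.

Lemma local_rellich_ball N D p s : opc D -> D s -> (forall s, D s -> anpoly s p) ->
  (forall t, D t -> p t \is monic /\ size (p t) = N.+1) ->
  (forall t, D t -> realrooted (p t)) ->
  exists2 d, 0 < d & exists L, (forall t, `|t - s| < d -> D t /\ p t = roots_at L t) /\
    forall f, List.In f L -> an (fun t => `|t - s| < d) f.
Proof.
move=> oD Ds hp hm hr.
have hnr : near s (fun t => t != s -> realrooted (p t)).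
  by apply: (near_true oD Ds) => t Dt _; exact: hr.
have [L [hL eL]] := local_rellich (hp s Ds) (near_true oD Ds hm) hnr.
have hL' : near s (fun t => forall f, List.In f L -> anat t f).
  elim: L hL {eL} => [|f L IH] hL; first by apply: near_all => t f [].
  have h1 : near s (fun t => anat t f) by apply: anat_recenter; apply: hL; left.
  have h2 : near s (fun t => forall g, List.In g L -> anat t g).
    by apply: IH => g gL; apply: hL; right.
  by apply: near_imp (near_and h1 h2) => t [k1 k2] g [<-|/k2].
have [d d0 h] := near_and (near_and (proj1 oD s Ds) eL) hL'.
exists d => //; exists L; split=> [t /h[[]]|f fL t /h[_ ]] //; exact.
Qed.

(** Continuation to a point [s] is propagated along [D] as the property [P s]. Since [p] splits
    analytically near every time, crossings of roots do not stop a branch. *)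
Lemma global_branch N D p a f0 : opc D -> D a -> (forall s, D s -> anpoly s p) ->
  (forall t, D t -> p t \is monic /\ size (p t) = N.+1) ->
  (forall t, D t -> realrooted (p t)) ->
  anat a f0 -> near a (fun t => root (p t) (f0 t)) ->
  exists F, [/\ an D F, near a (fun t => F t = f0 t) & forall t, D t -> root (p t) (F t)].
Proof.
move=> oD Da hp hm hr hf0 rf0.
pose P s := exists I F, [/\ opc I, I a, I s, an I F & near a (fun t => F t = f0 t)] /\
  forall t, I t -> D t /\ root (p t) (F t).
have PD s : D s -> P s.
  move=> Ds; apply: (@interval_induction D P a s oD) => //; last first.
    have [d d0 h] := near_and (near_and (proj1 oD a Da) rf0) (anat_recenter hf0).
    exists (fun t => `|t - a| < d), f0; split; last by move=> t /h[].
    split=> //; rewrite ?subrr ?normr0 //; first exact: opc_ball.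
    - by move=> t /h[].
    - exact: near_all.
  move=> x Dx; have [d d0 [L [h1 h2]]] := local_rellich_ball oD Dx hp hm hr.
  exists d => // t u Dt Du td ud [I [F [[oI Ia It hF Fa] hI]]].
  pose B y := `|y - x| < d; have oB : opc B := opc_ball x d.
  (* On the overlap of the interval reached so far with the ball, the branch follows one of the
     local roots, and that root carries it across the ball. *)
  have [f fL Ff] : exists2 f, List.In f L & forall y, I y /\ B y -> F y = f y.
    apply: (@an_branch (fun y => I y /\ B y) L F t); first exact: opcI.
    - by [].
    - by move=> y [Iy _]; exact: hF.
    - by move=> f fL y [_ By]; exact: h2.
    - by move=> y [Iy By]; have [_ <-] := h1 y By; have [_] := hI y Iy.
  pose G y := if excluded_middle_informative (I y) is left _ then F y else f y.
  have GI y : I y -> G y = F y by rewrite /G; case: excluded_middle_informative.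
  have GB y : B y -> G y = f y.
    by move=> By; rewrite /G; case: excluded_middle_informative => // Iy; apply: Ff.
  exists (fun y => I y \/ B y), G; split; last first.
    move=> y [Iy|By]; first by rewrite GI //; exact: hI.
    rewrite GB //; have [Dy e] := h1 y By; split=> //; rewrite e root_prodX.
    elim: (L) fL => //= g M IH [->|/IH h]; first exact: mem_head.
    by rewrite inE h orbT.
  split; [exact: opcU td|by left|by right| |].
    move=> y [Iy|By].
      by apply: anat_ext (hF y Iy); apply: near_imp (proj1 oI y Iy) => z /GI ->.
    by apply: anat_ext (h2 f fL y By); apply: near_imp (proj1 oB y By) => z /GB ->.
  by apply: near_imp (near_and Fa (proj1 oI a Ia)) => y [e Iy]; rewrite GI.
pose Q s (F : R -> C) := exists I, [/\ opc I, I a, I s, an I F & near a (fun t => F t = f0 t)] /\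
  forall t, I t -> D t /\ root (p t) (F t).
have hQ s : exists F, D s -> Q s F.
  have [Ds|nD] := excluded_middle_informative (D s); last by exists (fun=> 0).
  by have [I [F h]] := PD s Ds; exists F => _; exists I.
pose Fs s := proj1_sig (constructive_indefinite_description _ (hQ s)).
have hFs s : D s -> Q s (Fs s) by rewrite /Fs; case: constructive_indefinite_description.
(* The continuations chosen for different points agree: both equal [f0] near [a], and the identity
   theorem applies on the intersection of their intervals. Hence the diagonal [Fs t t] is
   analytic. *)
have loc s : D s -> near s (fun t => Fs t t = Fs s t).
  move=> Ds; have [I [[oI Ia Is hF Fa] hI]] := hFs s Ds.
  apply: near_imp (proj1 oI s Is) => t It.
  have [Dt _] := hI t It; have [J [[oJ Ja Jt hG Ga] hJ]] := hFs t Dt.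
  apply: (@an_identity2 (fun t => J t /\ I t) _ _ a); first exact: opcI.
  - by move=> y [Jy _]; exact: hG.
  - by move=> y [_ Iy]; exact: hF.
  - by [].
  - by apply: near_imp (near_and Ga Fa) => y [-> ->].
  - by [].
exists (fun t => Fs t t); split.
- move=> s Ds; apply: (@anat_ext _ (Fs s)); first by apply: near_imp (loc s Ds) => t ->.
  by have [I [[_ _ Is hF _] _]] := hFs s Ds; exact: hF.
- have [I [[_ _ _ _ Fa] _]] := hFs a Da.
  by apply: near_imp (near_and (loc a Da) Fa) => t [-> ->].
by move=> t Dt; have [I [[_ _ It _ _] h]] := hFs t Dt; case: (h t It).
Qed.

(** Continuing each local root at [a] separately keeps the multiplicities: the factorization holds
    near [a], and the identity theorem extends it coefficient by coefficient. *)
Theorem global_rellich N D p a : opc D -> D a -> (forall s, D s -> anpoly s p) ->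
  (forall t, D t -> p t \is monic /\ size (p t) = N.+1) ->
  (forall t, D t -> realrooted (p t)) ->
  exists L, (forall f, List.In f L -> an D f) /\ forall t, D t -> p t = roots_at L t.
Proof.
move=> oD Da hp hm hr.
have [d d0 [L [h1 h2]]] := local_rellich_ball oD Da hp hm hr.
have oB := opc_ball a d; have Ba : `|a - a| < d by rewrite subrr normr0.
have [M [hM nM]] : exists M, (forall f, List.In f M -> an D f) /\
    near a (fun t => roots_at M t = roots_at L t).
  have hL f : List.In f L -> anat a f /\ near a (fun t => root (p t) (f t)).
    move=> fL; split; first exact: h2.
    apply: (near_true oB Ba) => t Bt; have [_ ->] := h1 t Bt; rewrite root_prodX.
    elim: (L) fL => //= g M IH [->|/IH h]; first exact: mem_head.
    by rewrite inE h orbT.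
  elim: (L) hL => [|f K IH] hK.
    by exists [::]; split=> //; apply: near_all.
  have [M [hM nM]] : exists M, (forall f, List.In f M -> an D f) /\
      near a (fun t => roots_at M t = roots_at K t).
    by apply: IH => g gK; apply: hK; right.
  have [k1 k2] := hK f (or_introl erefl).
  have [F [F1 F2 F3]] := global_branch oD Da hp hm hr k1 k2.
  exists (F :: M); split; first by move=> g [<-|/hM].
  by apply: near_imp (near_and F2 nM) => t [e1 e2]; rewrite /roots_at /= !prodX_cons e1 -!/(roots_at _ _) e2.
exists M; split=> // t Dt; apply/polyP => i.
apply: (@an_identity2 D (fun t => (p t)`_i) (fun t => (roots_at M t)`_i) a) => //.
- by move=> s Ds; exact: hp.
- by move=> s Ds; apply: anpoly_roots_at => f fM; exact: hM.
have h1' : near a (fun t => p t = roots_at L t).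
  by apply: (near_true oB Ba) => x /h1[].
by apply: near_imp (near_and nM h1') => x [-> ->].
Qed.
(** * Division and kernels over the analytic functions on an interval *)

Lemma anat_bounded s f : anat s f -> exists2 B, 0 <= B & near s (fun t => nc (f t) <= B).
Proof.
move=> /anat_lip[K K0 hK]; exists (nc (f s) + K); first by rewrite addr_ge0 ?nc_ge0.
have h1 : near s (fun t => `|t - s| < 1) by exists 1.
apply: near_imp (near_and h1 hK) => t [h2 h3].
have := ncD (f t - f s) (f s); rewrite subrK => /le_trans; apply.
by rewrite addrC lerD2l; apply: (le_trans h3); rewrite ler_piMr // ltW.
Qed.

Lemma an_nonzero_near D g s : opc D -> an D g -> (exists2 t, D t & g t != 0) -> D s ->
  near s (fun t => t != s -> g t != 0).
Proof.
move=> oD hg [a Da ga] Ds; case: (anat_zero_or_neq0 (hg s Ds)) => // h.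
by move: ga; rewrite (an_identity oD hg Ds h Da) eqxx.
Qed.

(** The bound makes [f] vanish to at least the order of [g] at every zero, so local quotients exist.
    They are unique off the isolated zeros of [g], which glues them. *)
Lemma an_div D f g : opc D -> an D f -> an D g -> (exists2 t, D t & g t != 0) ->
  (forall s, D s -> exists B, near s (fun t => nc (f t) <= B * nc (g t))) ->
  exists2 h, an D h & forall t, D t -> f t = g t * h t.
Proof.
move=> oD hf hg g0 hB.
have loc s : D s -> exists h, anat s h /\ near s (fun t => f t = g t * h t).
  move=> Ds; have gz := an_nonzero_near oD hg g0 Ds.
  case: (anat_factor (hg s Ds)) => [z|[m [k [hk k0 ek]]]].
    have [e [e0 _ [] + + _]] := near_pick (near_and z gz) ltr01.
    have ts : s + e != s by rewrite -subr_eq0 addrC addKr gt_eqF.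
    by move=> h1 /(_ ts); rewrite h1 eqxx.
  have [B hB'] := hB s Ds; have [K K0 hK] := anat_bounded hk.
  have [j hj ej] : exists2 j, anat s j & near s (fun t => f t = (t - s)%:C ^+ m * j t).
    apply: (@anat_div_monomial _ _ (`|B| * K)); first exact: hf.
    apply: near_imp (near_and (near_and hB' hK) ek) => t [[h1 h2] h3] _.
    have h4 : B * nc (g t) <= `|B| * nc (g t) by rewrite ler_wpM2r ?nc_ge0 ?ler_norm.
    apply: (le_trans h1); apply: (le_trans h4); rewrite h3 ncM ncX ncR mulrCA mulrC.
    by rewrite ler_wpM2r ?exprn_ge0 // ler_wpM2l.
  exists (fun t => j t * (k t)^-1); split; first by apply: anatM hj _; apply: anatV.
  apply: near_imp (near_and (near_and ej ek) (anat_near_neq0 hk k0)) => t [[-> ->] kt].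
  by field.
have loc' s : exists h, D s -> anat s h /\ near s (fun t => f t = g t * h t).
  have [Ds|nD] := excluded_middle_informative (D s); last by exists f.
  by have [h hh] := loc s Ds; exists h.
pose H s := proj1_sig (constructive_indefinite_description _ (loc' s)).
have hH s : D s -> anat s (H s) /\ near s (fun t => f t = g t * H s t).
  by rewrite /H; case: constructive_indefinite_description.
exists (fun t => H t t); last by move=> t /hH[_ /near_self].
move=> s Ds; have [h1 h2] := hH s Ds; apply: anat_ext h1.
apply: near_imp (near_and (near_and (proj1 oD s Ds) h2) (an_nonzero_near oD hg g0 Ds)).
move=> t [[Dt e] gt]; have [->//|ts] := eqVneq t s.
by apply: (mulfI (gt ts)); rewrite -e; have [_ /near_self] := hH t Dt.
Qed.

Definition anm (D : R -> Prop) m n (A : R -> 'M[C]_(m, n)) := forall s, D s -> anmx s A.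

Lemma exists_nonzero_mul D f g : opc D -> an D f -> an D g ->
  (exists2 t, D t & f t != 0) -> (exists2 t, D t & g t != 0) ->
  exists2 t, D t & f t * g t != 0.
Proof.
move=> oD hf hg [a Da fa] [b Db gb].
apply: NNPP => ne; case: (an_domain oD hf hg) => [t Dt|h|h].
- by apply/eqP; apply: contraT => h; case: ne; exists t.
- by rewrite h ?eqxx in fa.
- by rewrite h ?eqxx in gb.
Qed.

(* Gaussian elimination: [g] collects the pivots already used. *)
Lemma an_kernel D m n (B : R -> 'M[C]_(m, n)) g : opc D -> anm D B -> an D g ->
  (exists2 t, D t & g t != 0) ->
  (exists v : R -> 'rV[C]_m, [/\ anm D v, exists2 t, D t & v t != 0 &
     forall t, D t -> v t *m B t = 0]) \/
  exists s, [/\ D s, g s != 0 & forall u : 'rV_m, u *m B s = 0 -> u = 0].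
Proof.
move=> oD; elim: m B g => [|m IH] B g hB hg g0.
  by right; case: g0 => s Ds gs; exists s; split=> // u _; rewrite thinmx0.
have [z|nz] := excluded_middle_informative (forall j t, D t -> B t ord0 j = 0).
  left; exists (fun=> delta_mx 0 ord0); split; first by move=> s _; exact: anmx_cst.
    have [t Dt _] := g0; exists t => //; apply/eqP => /rowP/(_ ord0)/eqP.
    by rewrite !mxE eqxx oner_eq0.
  by move=> t Dt; rewrite -rowE; apply/rowP => j; rewrite !mxE z.
have [j [t0 [Dt0 p0]]] : exists j t, D t /\ B t ord0 j != 0.
  apply: NNPP => ne; apply: nz => j t Dt; apply/eqP; apply: contraT => h.
  by case: ne; exists j, t.
pose p t := B t ord0 j; have hp : an D p by move=> s Ds; exact: hB.
have pn : exists2 t, D t & p t != 0 by exists t0.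
(* Rows are multiplied by the pivot [p] instead of being divided by it, so the entries stay analytic
   where [p] vanishes. *)
pose B2 t : 'M[C]_(m, n) := \matrix_(i, k)
  (B t (lift ord0 i) k * p t - B t (lift ord0 i) j * B t ord0 k).
have hB2 : anm D B2.
  move=> s Ds i k; apply: (@anat_eq _ (fun t => B t (lift ord0 i) k * p t -
    B t (lift ord0 i) j * B t ord0 k)) => [t|]; first by rewrite mxE.
  by apply: anatB; apply: anatM; do ?[exact: hB]; exact: hp.
have hgp : an D (fun t => g t * p t) by move=> s Ds; apply: anatM; [exact: hg|exact: hp].
case: (IH B2 _ hB2 hgp (exists_nonzero_mul oD hg hp g0 pn)).
  move=> [w [hw [t1 Dt1 w1] wB]]; left.
  (* The first coordinate cancels column [j]; the factor [p t] in the others is the price of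
     elimination without division. *)
  pose v t : 'rV[C]_m.+1 := \row_k (if unlift ord0 k is Some i then w t 0 i * p t
    else - \sum_i w t 0 i * B t (lift ord0 i) j).
  exists v; split.
  - move=> s Ds i k; rewrite /v; case: (unliftP ord0 k) => [l|] ->.
      apply: (@anat_eq _ (fun t => w t 0 l * p t)) => [t|]; first by rewrite mxE liftK.
      by apply: anatM; [exact: hw|exact: hp].
    apply: (@anat_eq _ (fun t => - \sum_i w t 0 i * B t (lift ord0 i) j)) => [t|].
      by rewrite mxE unlift_none.
    by apply: anatN; apply: anat_sum => l _; apply: anatM; [exact: hw|exact: hB].
  - have [l wl] : exists l, w t1 0 l != 0.
      apply: NNPP => ne; move/eqP: w1; apply; apply/rowP => l; rewrite mxE.
      by apply/eqP; apply: contraT => h; case: ne; exists l.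
    have hwl : an D (fun t => w t 0 l) by move=> s Ds; exact: hw.
    have wln : exists2 t, D t & w t 0 l != 0 by exists t1.
    have [t Dt h] := exists_nonzero_mul oD hwl hp wln pn; exists t => //.
    by apply: contraNneq h => /rowP/(_ (lift ord0 l)); rewrite !mxE liftK => ->.
  - move=> t Dt; apply/rowP => k; transitivity ((w t *m B2 t) 0 k); last by rewrite wB // !mxE.
    rewrite !mxE big_ord_recl !mxE unlift_none mulNr mulr_suml -sumrN -big_split; apply: eq_bigr => i _.
    by rewrite !mxE liftK /=; ring.
move=> [s [Ds gps hu]]; right; exists s; move: gps; rewrite mulf_eq0 negb_or => /andP[gs ps].
split=> // u uB.
have ej k : u 0 ord0 * B s ord0 k + \sum_i u 0 (lift ord0 i) * B s (lift ord0 i) k = 0.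
  by have /rowP/(_ k) := uB; rewrite !mxE big_ord_recl.
have w0 : (\row_i u 0 (lift ord0 i)) = 0 :> 'rV_m.
  apply: hu; apply/rowP => k; rewrite !mxE.
  have -> : \sum_i (\row_i0 u 0 (lift ord0 i0)) 0 i * B2 s i k =
     p s * (\sum_i u 0 (lift ord0 i) * B s (lift ord0 i) k) -
     (\sum_i u 0 (lift ord0 i) * B s (lift ord0 i) j) * B s ord0 k.
    rewrite mulr_sumr mulr_suml -sumrB; apply: eq_bigr => i _.
    by rewrite !mxE; ring.
  have /eqP := ej k; rewrite addrC addr_eq0 => /eqP ->.
  have /eqP := ej j; rewrite addrC addr_eq0 => /eqP ->.
  by rewrite /p; ring.
have wi i : u 0 (lift ord0 i) = 0 by have /rowP/(_ i) := w0; rewrite !mxE.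
have u0 : u 0 ord0 = 0.
  have := ej j; rewrite big1 ?addr0 => [/eqP|i _]; last by rewrite wi mul0r.
  by rewrite mulf_eq0 (negbTE ps) orbF => /eqP.
by apply/rowP => k; rewrite mxE; case: (unliftP ord0 k) => [i|] ->.
Qed.

(** * Analytic diagonalization of Hermitian pencils *)

Definition adjm m n (A : 'M[C]_(m, n)) : 'M[C]_(n, m) := (map_mx conjc A)^T.

Lemma adjmM m n p (A : 'M[C]_(m, n)) (B : 'M[C]_(n, p)) : adjm (A *m B) = adjm B *m adjm A.
Proof. by rewrite /adjm map_mxM trmx_mul. Qed.
Lemma adjmK m n (A : 'M[C]_(m, n)) : adjm (adjm A) = A.
Proof. by apply/matrixP => i j; rewrite !mxE conjcK. Qed.
Lemma adjmD m n (A B : 'M[C]_(m, n)) : adjm (A + B) = adjm A + adjm B.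
Proof. by apply/matrixP => i j; rewrite !mxE rmorphD. Qed.
Lemma adjmN m n (A : 'M[C]_(m, n)) : adjm (- A) = - adjm A.
Proof. by apply/matrixP => i j; rewrite !mxE rmorphN. Qed.
Lemma adjmZ m n a (A : 'M[C]_(m, n)) : adjm (a *: A) = conjc a *: adjm A.
Proof. by apply/matrixP => i j; rewrite !mxE rmorphM. Qed.
Lemma adjm_entry m n (A : 'M[C]_(m, n)) i j : adjm A i j = (A j i)^*.
Proof. by rewrite !mxE. Qed.
Lemma anmx_adjm s m n (A : R -> 'M[C]_(m, n)) : anmx s A -> anmx s (fun t => adjm (A t)).
Proof. by move=> hA i j; apply: anat_eq (anatJ (hA j i)) => t; rewrite adjm_entry. Qed.

Lemma conj_fixed_Im (x : C) : x^* = x -> Im x = 0.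
Proof. by case: x => a b [] /= h; lra. Qed.
Lemma Im0_conj (x : C) : Im x = 0 -> x^* = x.
Proof. by case: x => a b /= ->; rewrite oppr0. Qed.

(** The determinant of a rank-one perturbation, from two triangular factorizations of one block
    matrix. The extra factor [y] replaces an inverse, since [y] will be a polynomial. *)
Lemma det_rank_one (A : comNzRingType) N (y c : A) (p : 'cV[A]_N) (q : 'rV[A]_N) :
  q *m p = 1%:M -> y * \det (y%:M - c *: (p *m q)) = y ^+ N * (y - c).
Proof.
move=> qp; pose X : 'M[A]_(N + 1) := block_mx y%:M (c *: p) q 1%:M.
have e1 : \det X = \det (y%:M - c *: (p *m q)).
  have -> : \det X = \det (X *m block_mx 1%:M 0 (- q) 1%:M).
    by rewrite det_mulmx det_lblock !det1 !mulr1.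
  rewrite mulmx_block !mulmx1 !mulmx0 !add0r mul1mx addrN mulmxN -scalemxAl.
  by rewrite det_ublock det1 mulr1.
have : \det (X *m block_mx 1%:M (- c *: p) 0 y%:M) = y ^+ N * (y - c).
  rewrite mulmx_block !mulmx1 !mulmx0 !addr0 mul1mx mul_mx_scalar mul_scalar_mx.
  rewrite scalerA mulrN scaleNr scalerA addNr det_lblock det_scalar -scalemxAr qp.
  by rewrite det_mx11 !mxE eqxx mulr1n mulr1 addrC.
by move=> <-; rewrite det_mulmx det_ublock det1 mul1r det_scalar1 e1 mulrC.
Qed.

(** Brauer's deflation: a rank-one update along the left eigenvector [q] moves one copy of the
    eigenvalue [l] to [k] and keeps the others. *)
Lemma char_poly_rank_one N (T : 'M[C]_N) (l k : C) (p : 'cV[C]_N) (q : 'rV[C]_N) :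
  q *m p = 1%:M -> q *m T = l *: q ->
  char_poly (T + (k - l) *: (p *m q)) * ('X - l%:P) = char_poly T * ('X - k%:P).
Proof.
move=> qp qT; pose P := map_mx polyC (p *m q); pose y : {poly C} := 'X - l%:P.
have y0 : y != 0 by rewrite polyXsubC_eq0.
pose c := (k - l)%:P.
have PT : P *m map_mx polyC T = l%:P *: P.
  by rewrite -map_mxM -mulmxA qT -scalemxAr map_mxZ.
pose Tm := map_mx polyC T.
have eT : char_poly_mx (T + (k - l) *: (p *m q)) = ('X%:M - Tm) - c *: P.
  by rewrite /char_poly_mx map_mxD map_mxZ opprD addrA.
(* From [P T = l P] the product is [y (X - T) - c (X - l) P], and [X - l] is [y]. *)
have e : (y%:M - c *: P) *m char_poly_mx T = y *: char_poly_mx (T + (k - l) *: (p *m q)).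
  rewrite eT [in RHS]scalerBr mulmxBl mul_scalar_mx; congr (_ - _).
  rewrite -scalemxAl /char_poly_mx mulmxBr PT mul_mx_scalar -scalerBl -/y.
  by rewrite !scalerA mulrC.
have /(congr1 determinant) := e; rewrite det_mulmx detZ -!/(char_poly _) => e2.
have qp' : map_mx polyC q *m map_mx polyC p = 1%:M by rewrite -map_mxM qp map_mx1.
have := det_rank_one y c qp'; rewrite -map_mxM -/P => e3.
apply: (mulfI (expf_neq0 N y0)); rewrite mulrA -e2 mulrAC [_ * y]mulrC e3.
by rewrite mulrAC mulrA /y /c polyCB; ring.
Qed.

Definition form N (M : 'M[C]_N) (u w : 'rV[C]_N) : C := (u *m M *m adjm w) 0 0.
(** The lower bound is uniform near each time, which is what bounds the coordinates of a vector by
    its norm across the zeros of that vector in [an_normalize]. *)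
Definition uposdef (D : R -> Prop) N (M : R -> 'M[C]_N) :=
  forall s, D s -> exists2 kap, 0 < kap &
    near s (fun t => forall u : 'rV_N, kap * (\sum_i nc (u 0 i) ^+ 2) <= Re (form (M t) u u)).

Lemma formZl N (M : 'M[C]_N) a u w : form M (a *: u) w = a * form M u w.
Proof. by rewrite /form -!scalemxAl mxE. Qed.
Lemma formZr N (M : 'M[C]_N) a u w : form M u (a *: w) = conjc a * form M u w.
Proof. by rewrite /form adjmZ -scalemxAr mxE. Qed.
Lemma form_conj N (M : 'M[C]_N) u w : adjm M = M -> (form M u w)^* = form M w u.
Proof. by move=> hM; rewrite /form -adjm_entry !adjmM adjmK hM mulmxA. Qed.
Lemma form_self_Im N (M : 'M[C]_N) u : adjm M = M -> Im (form M u u) = 0.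
Proof. by move=> hM; apply: conj_fixed_Im; exact: form_conj. Qed.

Lemma anat_form s N (M : R -> 'M[C]_N) u w : anmx s M -> anmx s u -> anmx s w ->
  anat s (fun t => form (M t) (u t) (w t)).
Proof. by move=> hM hu hw; apply: anmxM; [apply: anmxM|apply: anmx_adjm]. Qed.

Lemma sum_sqr_gt0 N (u : 'rV[C]_N) : u != 0 -> 0 < \sum_i nc (u 0 i) ^+ 2.
Proof.
move=> u0; have [i ui] : exists i, u 0 i != 0.
  apply: NNPP => ne; move/eqP: u0; apply; apply/rowP => i; rewrite mxE.
  by apply/eqP; apply: contraT => h; case: ne; exists i.
rewrite (bigD1 i) //=; apply: ltr_wpDr; last by rewrite exprn_gt0 // nc_gt0.
by apply: sumr_ge0 => j _; exact: sqr_ge0.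
Qed.

Lemma uposdef_form_gt0 D N (M : R -> 'M[C]_N) t u : uposdef D M -> D t -> u != 0 ->
  0 < Re (form (M t) u u).
Proof.
move=> hM Dt u0; have [kap k0 /near_self h] := hM t Dt.
by apply: lt_le_trans (h u); apply: mulr_gt0 => //; exact: sum_sqr_gt0.
Qed.

Lemma uposdef_unit D N (M : R -> 'M[C]_N) t : uposdef D M -> D t -> M t \in unitmx.
Proof.
move=> hM Dt; rewrite unitmxE unitfE; apply/negP => /det0P[u u0 uM].
by have := uposdef_form_gt0 hM Dt u0; rewrite /form uM mul0mx mxE ltxx.
Qed.

(** The form [q] on [v] is nonnegative, so [X^2 - q] is real-rooted and [global_rellich] provides an
    analytic square root [g]. The coordinates of [v] are bounded by multiples of [g], hence
    divisible by it, even where [v] vanishes. *)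
Lemma an_normalize D a N (M : R -> 'M[C]_N) (v : R -> 'rV[C]_N) : opc D -> D a ->
  anm D M -> (forall t, D t -> adjm (M t) = M t) -> uposdef D M ->
  anm D v -> (exists2 t, D t & v t != 0) ->
  exists g w, [/\ an D g, anm D w, exists2 t, D t & g t != 0 &
    forall t, D t -> v t = g t *: w t /\ form (M t) (w t) (w t) = 1].
Proof.
move=> oD Da hM sM pM hv [t0 Dt0 v0].
pose q t := form (M t) (v t) (v t).
have hq : an D q by move=> s Ds; apply: anat_form; [exact: hM|exact: hv|exact: hv].
have qI t : D t -> Im (q t) = 0 by move=> Dt; apply: form_self_Im; exact: sM.
have qR t : D t -> 0 <= Re (q t).
  move=> Dt; have [kap k0 /near_self h] := pM t Dt; apply: le_trans (h (v t)).
  apply: mulr_ge0; first exact: ltW.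
  by apply: sumr_ge0 => i _; exact: sqr_ge0.
pose p t : {poly C} := 'X^2 + (- q t)%:P.
have hp s : D s -> anpoly s p.
  by move=> Ds; apply: anpolyD (anpoly_cst _ _) _; apply: anpolyC; apply: anatN; exact: hq.
have mp t : D t -> p t \is monic /\ size (p t) = 3.
  move=> _; have h : (size (- q t)%:P <= (size ('X^2 : {poly C})).-1)%N.
    by rewrite size_polyXn; apply: leq_trans (size_polyC_leq1 _) _.
  by have [h1 h2] := monicDl (monicXn _ 2) h; split; rewrite // h2 size_polyXn.
have rp t : D t -> realrooted (p t).
  move=> Dt z /rootP; rewrite !hornerE => /eqP; rewrite subr_eq0 => /eqP e.
  move: (qI t Dt) (qR t Dt); rewrite -e expr2 cImM cReM; case: z {e} => x y /= h1 h2.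
  have /eqP : x * y = 0 by lra.
  by rewrite mulf_eq0 => /orP[/eqP x0|/eqP //]; rewrite x0 in h2; nra.
have [L [hL eL]] := global_rellich oD Da hp mp rp.
have [g gL] : exists g, List.In g L.
  case: L eL {hL} => [|g L] eL; last by exists g; left.
  by have := proj2 (mp a Da); rewrite eL // /roots_at prodX_nil size_polyC oner_eq0.
have hg : an D g by exact: hL.
have rg t : D t -> root (p t) (g t).
  move=> Dt; rewrite eL // root_prodX; elim: (L) gL => //= f K IH [->|/IH h].
    exact: mem_head.
  by rewrite inE h orbT.
have gq t : D t -> g t ^+ 2 = q t.
  by move=> Dt; have /rootP := rg t Dt; rewrite !hornerE => /eqP; rewrite subr_eq0 => /eqP.
have gr t : D t -> (g t)^* = g t by move=> Dt; apply: Im0_conj; exact: rp (rg t Dt).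
have gn : exists2 t, D t & g t != 0.
  exists t0 => //; apply/eqP => g0; have := uposdef_form_gt0 pM Dt0 v0.
  by rewrite -/(q t0) -gq // g0 expr0n ltxx.
have hw i : exists2 h, an D h & forall t, D t -> v t 0 i = g t * h t.
  apply: an_div => //; first by move=> s Ds; exact: hv.
  (* [1 + kap^-1] dominates the square root of [kap^-1]. *)
  move=> s Ds; have [kap k0 hk] := pM s Ds; exists (1 + kap^-1).
  apply: near_imp (near_and (proj1 oD s Ds) hk) => t [Dt h].
  have kv : 0 < kap^-1 by rewrite invr_gt0.
  have h1 : kap * nc (v t 0 i) ^+ 2 <= nc (g t) ^+ 2.
    rewrite -[leRHS]ncX gq //; apply: (@le_trans _ _ (Re (q t))).
      apply: le_trans (h (v t)); rewrite ler_pM2l // (bigD1 i) //= lerDl.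
      by apply: sumr_ge0 => j _; exact: sqr_ge0.
    by apply: le_trans (nc_Re _); exact: ler_norm.
  rewrite -ler_sqr ?nnegrE ?nc_ge0 //; last first.
    by apply: mulr_ge0; rewrite ?nc_ge0 //; lra.
  rewrite -(ler_pM2l k0); apply: (le_trans h1); rewrite exprMn mulrA ler_peMl ?sqr_ge0 //.
  have : kap * kap^-1 = 1 by rewrite mulfV // gt_eqF.
  by nra.
pose wi i := proj1_sig (constructive_indefinite_description _ (let: ex_intro2 h h1 h2 := hw i in
  ex_intro (fun h => an D h /\ forall t, D t -> v t 0 i = g t * h t) h (conj h1 h2))).
have [w1 w2] : (forall i, an D (wi i)) /\ forall i t, D t -> v t 0 i = g t * wi i t.
  by split=> i; rewrite /wi; case: constructive_indefinite_description => h [].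
pose w t : 'rV[C]_N := \row_i wi i t.
have anw : anm D w.
  by move=> s Ds i j; apply: anat_eq (w1 j s Ds) => t; rewrite mxE.
have vw t : D t -> v t = g t *: w t.
  by move=> Dt; apply/rowP => i; rewrite !mxE w2.
exists g, w; split => // t Dt; split; first exact: vw.
have hf : an D (fun t => form (M t) (w t) (w t)).
  by move=> s Ds; apply: anat_form; [exact: hM|exact: anw|exact: anw].
(* Normalization is clear where [g] is nonzero; at its zeros it follows because analytic functions
   on [D] have no zero divisors. *)
case: (@an_domain D (fun t => g t ^+ 2) (fun t => form (M t) (w t) (w t) - 1)) => //.
- by move=> s Ds; apply: anatX; exact: hg.
- by move=> s Ds; apply: anatB (anat_cst _ _); exact: hf.
- move=> x Dx; apply/eqP; rewrite mulrBr mulr1 subr_eq0; apply/eqP.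
  by rewrite [in RHS]gq // /q [v x]vw // formZl formZr gr // mulrA -expr2.
- move=> h; have [x Dx gx] := gn; have /eqP := h x Dx.
  by rewrite expf_eq0 (negbTE gx).
- by move=> /(_ t Dt)/eqP; rewrite subr_eq0 => /eqP.
Qed.

Lemma nth_In (L : seq (R -> C)) (P : (R -> C) -> Prop) k : (forall f, List.In f L -> P f) ->
  (k < size L)%N -> P (nth (fun=> 0) L k).
Proof.
elim: L k => [|f L IH] [|k] //= h; first by move=> _; apply: h; left.
by rewrite ltnS => kL; apply: IH => // g gL; apply: h; right.
Qed.

Lemma anmx_scalar s n f : anat s f -> anmx s (fun t => (f t)%:M : 'M[C]_n).
Proof.
move=> hf i j; apply: (@anat_eq _ (fun t => (i == j)%:R * f t)) => [t|]; last exact: anatZ.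
by rewrite mxE mulr_natl.
Qed.

(** The eigenvalues are branches of the characteristic polynomial of [T = L M^-1], whose left
    eigenvectors solve the pencil equation. The index [k] counts multiplicity, also for branches
    that coincide identically. *)
Theorem an_pencil D a N (L : 'M[C]_N) (M : R -> 'M[C]_N) : opc D -> D a -> adjm L = L ->
  anm D M -> (forall t, D t -> adjm (M t) = M t) -> uposdef D M ->
  exists (lam : nat -> R -> C) (v : nat -> R -> 'rV[C]_N),
    [/\ forall k, (k < N)%N -> an D (lam k), forall k, (k < N)%N -> anm D (v k) &
     forall t, D t -> (forall k, (k < N)%N -> v k t *m L = lam k t *: (v k t *m M t)) /\
       forall k l, (k < N)%N -> (l < N)%N -> form (M t) (v k t) (v l t) = (k == l)%:R].
Proof.
move=> oD Da sL hM sM pM.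
pose T t := L *m invmx (M t).
have uM t : D t -> M t \in unitmx by move=> Dt; exact: uposdef_unit pM Dt.
have TM t : D t -> T t *m M t = L by move=> Dt; rewrite /T mulmxKV // uM.
have hT : anm D T.
  move=> s Ds; apply: anmxM (anmx_cst _ _) _; apply: anmx_inv (hM s Ds) _.
  by apply: near_imp (proj1 oD s Ds) => t; exact: uM.
have hp s : D s -> anpoly s (fun t => char_poly (T t)).
  by move=> Ds; apply: anpoly_char; exact: hT.
have mp t : D t -> char_poly (T t) \is monic /\ size (char_poly (T t)) = N.+1.
  by move=> _; rewrite char_poly_monic size_char_poly.
have rp t : D t -> realrooted (char_poly (T t)).
  move=> Dt z; rewrite -eigenvalue_root_char => /eigenvalueP[u uT u0].
  have e : form L u u = z * form (M t) u u.
    by rewrite /form -[in LHS](TM t Dt) mulmxA uT -!scalemxAl mxE.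
  apply: conj_fixed_Im; have /(congr1 conjc) := e.
  rewrite form_conj // rmorphM /= form_conj ?sM // e => /eqP.
  rewrite -subr_eq0 -mulrBl mulf_eq0 => /orP[|/eqP f0].
    by rewrite subr_eq0 => /eqP.
  by have := uposdef_form_gt0 pM Dt u0; rewrite f0 ltxx.
have [LL [hLL eLL]] := global_rellich oD Da hp mp rp.
have sLL : size LL = N.
  apply: succn_inj; rewrite -(proj2 (mp a Da)) eLL // size_prodX size_map //.
pose lam k := nth (fun=> 0 : C) LL k.
have hlam k : (k < N)%N -> an D (lam k).
  by move=> kN; apply: (@nth_In LL (an D)) => //; rewrite sLL.
have chi t : D t -> char_poly (T t) = \prod_(0 <= k < N) ('X - (lam k t)%:P).
  move=> Dt; rewrite eLL // /roots_at /prodX big_map (big_nth (fun=> 0)) sLL //.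
have lamr k t : (k < N)%N -> D t -> (lam k t)^* = lam k t.
  move=> kN Dt; apply: Im0_conj; apply: (rp t Dt).
  rewrite eLL // root_prodX; have := @mem_nth _ 0 [seq f t | f <- LL] k.
  by rewrite size_map sLL (nth_map (fun=> 0)) ?sLL //; apply.
(* All eigenvalues are real, so a treated eigenvalue moved to [ii] differs from every [lam k t] at
   every time. *)
pose ii : C := 0 +i* 1.
have iR : conjc ii != ii by rewrite eq_complex /= eqxx eqNr oner_eq0.
have step k : (k <= N)%N -> exists v : nat -> R -> 'rV[C]_N,
    (forall i, (i < k)%N -> anm D (v i)) /\ forall t, D t ->
    (forall i, (i < k)%N -> v i t *m T t = lam i t *: v i t) /\
    forall i j, (i < k)%N -> (j < k)%N -> form (M t) (v i t) (v j t) = (i == j)%:R.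
  elim: k => [|k IH] kN.
    by exists (fun _ _ => 0).
  have [v [hv ev]] := IH (ltnW kN).
  pose Tk j t := T t + \sum_(i < j) (ii - lam i t) *: (M t *m adjm (v i t) *m v i t).
  have vTk t j : (j <= k)%N -> D t ->
      char_poly (Tk j t) * \prod_(i < j) ('X - (lam i t)%:P) = char_poly (T t) * ('X - ii%:P) ^+ j.
    move=> + Dt; elim: j => [|j IHj] jk.
      by rewrite /Tk !big_ord0 addr0.
    have [ev1 ev2] := ev t Dt.
    have -> : Tk j.+1 t = Tk j t + (ii - lam j t) *: (M t *m adjm (v j t) *m v j t).
      by rewrite /Tk big_ord_recr /= addrA.
    have qp : v j t *m (M t *m adjm (v j t)) = 1%:M.
      apply/matrixP => x y; rewrite !ord1 mulmxA -/(form _ _ _) ev2 // eqxx mxE eqxx //.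
    have qT : v j t *m Tk j t = lam j t *: v j t.
      rewrite /Tk mulmxDr ev1 // mulmx_sumr big1 ?addr0 // => i _.
      rewrite -scalemxAr !mulmxA.
      have -> : v j t *m M t *m adjm (v i t) = 0.
        apply/matrixP => x y; rewrite !ord1 -/(form _ _ _) ev2 ?(ltn_trans (ltn_ord i)) //.
        by rewrite gtn_eqF // mxE.
      by rewrite mul0mx scaler0.
    have h := char_poly_rank_one ii qp qT.
    move: h (IHj (ltnW jk)); set c1 := char_poly (_ + _); set c2 := char_poly (Tk j t).
    set c3 := char_poly (T t); move=> h h2; clearbody c1 c2 c3.
    by rewrite big_ord_recr /= [_ * ('X - _)]mulrC mulrA h mulrAC h2 exprSr mulrA.
  (* Cancelling the treated factors in [vTk] leaves those of index at least [k] times a power of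
     ['X - ii%:P], so [lam k t] is still an eigenvalue of [Tk k t]. *)
  have ker t : D t -> exists2 u : 'rV[C]_N, u != 0 & u *m (Tk k t - (lam k t)%:M) = 0.
    move=> Dt; suff : eigenvalue (Tk k t) (lam k t).
      move=> /eigenvalueP[u uT u0]; exists u => //.
      by rewrite mulmxBr uT mul_mx_scalar subrr.
    rewrite eigenvalue_root_char; have := vTk t k (leqnn k) Dt.
    pose Pk := \prod_(i < k) ('X - (lam i t)%:P).
    have Pk0 : Pk != 0 by rewrite monic_neq0 // monic_prod_XsubC.
    rewrite chi // (big_cat_nat (n := k)) ?(ltnW kN) // big_mkord -/Pk mulrAC -mulrA mulrC.
    move=> /(mulfI Pk0) ->; rewrite rootM big_ltn // rootM root_XsubC eqxx.
    by rewrite orbT.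
  have hTk : anm D (Tk k).
    move=> s Ds; apply: anmxD (hT s Ds) _; apply: anmx_sum => i; apply: anmxZ.
      by apply: anatB (anat_cst _ _) _; apply: hlam => //; exact: ltn_trans kN.
    apply: anmxM; last exact: hv.
    by apply: anmxM (hM s Ds) _; apply: anmx_adjm; exact: hv.
  have [w [hw w0 wB]] : exists v : R -> 'rV[C]_N, [/\ anm D v, exists2 t, D t & v t != 0 &
      forall t, D t -> v t *m (Tk k t - (lam k t)%:M) = 0].
    have hB : anm D (fun t => Tk k t - (lam k t)%:M).
      move=> s Ds; apply: anmxB (hTk s Ds) _; apply: anmx_scalar; exact: hlam.
    have h1 : an D (fun=> 1) by move=> s _; exact: anat_cst.
    have n1 : exists2 t, D t & (1 : C) != 0 by exists a; rewrite ?oner_eq0.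
    case: (an_kernel oD hB h1 n1) => // -[s [Ds _ h]].
    by have [u u0 /h u1] := ker s Ds; rewrite u1 eqxx in u0.
  have wTk t : D t -> w t *m Tk k t = lam k t *: w t.
    by move=> /wB/eqP; rewrite mulmxBr subr_eq0 mul_mx_scalar => /eqP.
  (* [M t *m adjm (v j t)] is a right eigenvector of [Tk k t] for [ii] and [w t] a left one for the
     real [lam k t], so their product vanishes. The shift terms then die on [w], which is an
     eigenvector of [T] itself. *)
  have wv t j : (j < k)%N -> D t -> form (M t) (w t) (v j t) = 0.
    move=> jk Dt; have [ev1 ev2] := ev t Dt; have jN := ltn_trans jk kN.
    have e1 : T t *m (M t *m adjm (v j t)) = lam j t *: (M t *m adjm (v j t)).
      rewrite mulmxA TM // -{1}sL -adjmM -(TM t Dt) mulmxA ev1 // -scalemxAl adjmZ.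
      by rewrite lamr // adjmM sM.
    have e2 : Tk k t *m (M t *m adjm (v j t)) = ii *: (M t *m adjm (v j t)).
      rewrite /Tk mulmxDl e1 mulmx_suml (bigD1 (Ordinal jk)) //= big1 ?addr0.
        have f1 : v j t *m (M t *m adjm (v j t)) = 1%:M.
          by apply/matrixP => x y; rewrite !ord1 mulmxA -/(form _ _ _) ev2 // eqxx mxE eqxx.
        by rewrite -scalemxAl -mulmxA f1 mulmx1 -scalerDl addrC subrK.
      move=> i ij; rewrite -scalemxAl -mulmxA.
      have -> : v i t *m (M t *m adjm (v j t)) = 0.
        apply/matrixP => x y; rewrite !ord1 mulmxA -/(form _ _ _) ev2 // mxE.
        by move: ij; rewrite -val_eqE /= => /negbTE ->.
      by rewrite mulmx0 scaler0.
    have : lam k t * form (M t) (w t) (v j t) = ii * form (M t) (w t) (v j t).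
      rewrite -formZl -wTk // /form -!mulmxA e2 -scalemxAr mxE //.
    move/eqP; rewrite -subr_eq0 -mulrBl mulf_eq0 subr_eq0 => /orP[/eqP li|/eqP //].
    by move: iR; rewrite -li lamr // eqxx.
  have wT t : D t -> w t *m T t = lam k t *: w t.
    move=> Dt; rewrite -wTk // /Tk mulmxDr mulmx_sumr big1 ?addr0 // => i _.
    rewrite -scalemxAr !mulmxA.
    have -> : w t *m M t *m adjm (v i t) = 0.
      by apply/matrixP => x y; rewrite !ord1 -/(form _ _ _) wv // mxE.
    by rewrite mul0mx scaler0.
  have [g [x [hg hx gn gx]]] := an_normalize oD Da hM sM pM hw w0.
  (* [w] may vanish at isolated times, but [g] is not the zero function, so identities for
     [w = g *: x] pass to [x]. *)
  have xdiv f : an D f -> (forall t, D t -> g t * f t = 0) -> forall t, D t -> f t = 0.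
    move=> hf h t Dt; case: (an_domain oD hg hf h) => [z|]; last exact.
    by have [y Dy gy] := gn; rewrite z ?eqxx in gy.
  have xv j t : (j < k)%N -> D t -> form (M t) (x t) (v j t) = 0.
    move=> jk; apply: (xdiv (fun t => form (M t) (x t) (v j t))).
      by move=> s Ds; apply: anat_form; [exact: hM|exact: hx|exact: hv].
    by move=> y Dy; have [e _] := gx y Dy; rewrite -formZl -e wv.
  have xT t : D t -> x t *m T t = lam k t *: x t.
    move=> Dt; apply/eqP; rewrite -subr_eq0; apply/eqP/rowP => i; rewrite [RHS]mxE.
    apply: (xdiv (fun t => (x t *m T t - lam k t *: x t) 0 i)) Dt.
      move=> s Ds; apply: anmxB; first by apply: anmxM; [exact: hx|exact: hT].
      by apply: anmxZ; [exact: hlam|exact: hx].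
    move=> y Dy; have [e _] := gx y Dy.
    have : g y *: (x y *m T y - lam k y *: x y) = 0.
      by rewrite scalerBr scalemxAl scalerA mulrC -scalerA -e wT // subrr.
    by move/rowP/(_ i); rewrite mxE [in RHS]mxE.
  exists (fun i => if i == k then x else v i); split.
    by move=> i; rewrite ltnS leq_eqVlt; case: eqP => // _ /=; exact: hv.
  move=> t Dt; have [ev1 ev2] := ev t Dt; split.
    by move=> i; rewrite ltnS leq_eqVlt; case: eqP => [->|_] /=; [rewrite xT|exact: ev1].
  move=> i j; rewrite !ltnS [(i <= k)%N]leq_eqVlt [(j <= k)%N]leq_eqVlt.
  case: (eqVneq i k) => [->|ik]; case: (eqVneq j k) => [->|jk] //=.
  - by move=> _ _; have [_ ->] := gx t Dt.
  - by move=> _ jk'; rewrite xv.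
  - by move=> ik' _; rewrite -form_conj ?sM // xv // conjc0 (negbTE ik).
  - exact: ev2.
have [v [hv ev]] := step N (leqnn N).
exists lam, v; split=> // t Dt; have [ev1 ev2] := ev t Dt; split=> // k kN.
by rewrite -(TM t Dt) mulmxA ev1 // scalemxAl.
Qed.
(** * The differential equation for [w = 1 - c / K] *)

Definition en m n (A : 'M[C]_(m, n)) : R := \sum_i \sum_j nc (A i j).

Lemma en_ge0 m n (A : 'M[C]_(m, n)) : 0 <= en A.
Proof. by apply: sumr_ge0 => i _; apply: sumr_ge0 => j _; exact: nc_ge0. Qed.
Lemma en_entry m n (A : 'M[C]_(m, n)) i j : nc (A i j) <= en A.
Proof.
rewrite /en (bigD1 i) //= (bigD1 j) //= -addrA lerDl addr_ge0 //.
  by apply: sumr_ge0 => k _; exact: nc_ge0.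
by apply: sumr_ge0 => k _; apply: sumr_ge0 => l _; exact: nc_ge0.
Qed.
Lemma en_le m n (A : 'M[C]_(m, n)) B : (forall i j, nc (A i j) <= B) -> en A <= m%:R * n%:R * B.
Proof.
move=> h; apply: (@le_trans _ _ (\sum_(i < m) \sum_(j < n) B)).
  by apply: ler_sum => i _; apply: ler_sum.
by rewrite !sumr_const !card_ord -[(B *+ n) *+ m]mulr_natl -[B *+ n]mulr_natl mulrA.
Qed.
Lemma enZ m n c (A : 'M[C]_(m, n)) : en (c *: A) = nc c * en A.
Proof.
rewrite /en mulr_sumr; apply: eq_bigr => i _; rewrite mulr_sumr; apply: eq_bigr => j _.
by rewrite mxE ncM.
Qed.
Lemma enD m n (A B : 'M[C]_(m, n)) : en (A + B) <= en A + en B.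
Proof.
rewrite /en -big_split; apply: ler_sum => i _; rewrite -big_split; apply: ler_sum => j _.
by rewrite mxE ncD.
Qed.
Lemma en_sum m n I (r : seq I) (P : pred I) (F : I -> 'M[C]_(m, n)) :
  en (\sum_(i <- r | P i) F i) <= \sum_(i <- r | P i) en (F i).
Proof.
elim/big_rec2: _ => [|i a b _ h].
  by rewrite /en big1 // => i _; rewrite big1 // => j _; rewrite mxE nc0.
by apply: (le_trans (enD _ _)); rewrite lerD2l.
Qed.
Lemma enM m n p (A : 'M[C]_(m, n)) (B : 'M[C]_(n, p)) : en (A *m B) <= en A * en B.
Proof.
rewrite {1}/en; apply: (@le_trans _ _ (\sum_i \sum_j \sum_k nc (A i k) * nc (B k j))).
  apply: ler_sum => i _; apply: ler_sum => j _; rewrite mxE.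
  by apply: (le_trans (nc_sum _ _ _)); apply: ler_sum => k _; rewrite ncM.
rewrite {2}/en mulr_suml; apply: ler_sum => i _; rewrite exchange_big mulr_suml.
apply: ler_sum => k _; rewrite -mulr_sumr; apply: ler_wpM2l; first exact: nc_ge0.
rewrite [leRHS](bigD1 k) //= lerDl; apply: sumr_ge0 => l _.
by apply: sumr_ge0 => j _; exact: nc_ge0.
Qed.

(** The norm is left abstract because it has to depend on the time [s]: it must be submultiplicative
    and below [1] at [1 - c s / K]. Comparison with [en] controls the entries. *)
Definition matnorm n (nu : 'M[C]_n.+1 -> R) (K : R) := 0 < K /\
  [/\ forall a b, nu (a * b) <= nu a * nu b, forall a b, nu (a + b) <= nu a + nu b,
      forall c a, nu (c *: a) <= nc c * nu a, forall a, en a <= K * nu a &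
      forall a, nu a <= K * en a].

Lemma matnorm_ge0 n (nu : 'M[C]_n.+1 -> R) K a : matnorm nu K -> 0 <= nu a.
Proof. by move=> [K0 [_ _ _ h _]]; rewrite -(pmulr_rge0 _ K0); apply: le_trans (h a); exact: en_ge0. Qed.

Lemma matnorm_entry n (nu : 'M[C]_n.+1 -> R) K (a : 'M[C]_n.+1) i j : matnorm nu K -> nc (a i j) <= K * nu a.
Proof. by move=> [_ [_ _ _ h _]]; apply: le_trans (h a); exact: en_entry. Qed.

Lemma matnorm_sum n (nu : 'M[C]_n.+1 -> R) K I (r : seq I) (P : pred I) F : matnorm nu K ->
  nu (\sum_(i <- r | P i) F i) <= \sum_(i <- r | P i) nu (F i).
Proof.
move=> hnu; have [K0 [_ hD hZ _ _]] := hnu; elim/big_rec2: _ => [|i a b _ h].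
  by have := hZ 0 0; rewrite nc0 mul0r scale0r.
by apply: (le_trans (hD _ _)); rewrite lerD2l.
Qed.

Lemma matnormX n (nu : 'M[C]_n.+1 -> R) K a k : matnorm nu K -> nu (a ^+ k.+1) <= nu a ^+ k.+1.
Proof.
move=> hnu; have [K0 [hM _ _ _ _]] := hnu; elim: k => [|k IH]; first by rewrite !expr1.
rewrite exprS [leRHS]exprS; apply: (le_trans (hM _ _)).
by apply: ler_wpM2l => //; exact: matnorm_ge0 hnu.
Qed.

Lemma matnorm_powB n (nu : 'M[C]_n.+1 -> R) K a b q k : matnorm nu K -> nu a <= q -> nu b <= q ->
  nu (a ^+ k.+1 - b ^+ k.+1) <= k.+1%:R * q ^+ k * nu (a - b).
Proof.
move=> hnu; have [K0 [hM hD _ _ _]] := hnu => aq bq.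
have q0 : 0 <= q by apply: le_trans aq; exact: matnorm_ge0 hnu.
elim: k => [|k IH]; first by rewrite !expr1 expr0 mulr1 mul1r.
have -> : a ^+ k.+2 - b ^+ k.+2 = a * (a ^+ k.+1 - b ^+ k.+1) + (a - b) * b ^+ k.+1.
  by rewrite (exprS a k.+1) (exprS b k.+1) mulrBr mulrBl addrA subrK.
have n0 := matnorm_ge0 (a - b) hnu.
have -> : k.+2%:R * q ^+ k.+1 * nu (a - b) =
    k.+1%:R * q ^+ k.+1 * nu (a - b) + q ^+ k.+1 * nu (a - b) by rewrite -[k.+2%:R]natr1; ring.
apply: (le_trans (hD _ _)); apply: lerD.
  apply: (le_trans (hM _ _)).
  have -> : k.+1%:R * q ^+ k.+1 * nu (a - b) = q * (k.+1%:R * q ^+ k * nu (a - b)).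
    by rewrite exprS; ring.
  by apply: ler_pM => //; exact: matnorm_ge0 hnu.
apply: (le_trans (hM _ _)); rewrite mulrC ler_wpM2r //.
apply: (le_trans (matnormX _ _ hnu)).
by rewrite lerXn2r // ?nnegrE //; exact: matnorm_ge0 hnu.
Qed.

Lemma geom_shift_le (K q : R) m : 0 <= K -> 0 <= q -> q < 1 ->
  \sum_(j < m) K * q ^+ j <= K / (1 - q).
Proof. by move=> K0 q0 q1; rewrite -mulr_sumr ler_wpM2l ?geom_le. Qed.

(* [Lg w = - log (1 - w)] *)
Definition Lg n (w : 'M[C]_n.+1) : 'M[C]_n.+1 :=
  \matrix_(i, j) csum_val (fun k => k.+1%:R^-1 * (w ^+ k.+1) i j).

Lemma nc_natV k : nc (k.+1%:R^-1 : C) = (k.+1%:R)^-1.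
Proof.
have -> : (k.+1%:R^-1 : C) = (k.+1%:R^-1 : R)%:C by rewrite fmorphV rmorph_nat.
by rewrite ncR ger0_norm // invr_ge0 ler0n.
Qed.

Lemma natV_le1 k : (k.+1%:R : R)^-1 <= 1.
Proof. by rewrite invf_le1 ?ltr0n // ler1n. Qed.

Lemma natV_ge0 k : 0 <= (k.+1%:R : R)^-1.
Proof. by rewrite invr_ge0 ler0n. Qed.

Lemma Lg_sum n (nu : 'M[C]_n.+1 -> R) K (w : 'M[C]_n.+1) i j : matnorm nu K -> nu w < 1 ->
  csum (fun k => k.+1%:R^-1 * (w ^+ k.+1) i j) (Lg w i j).
Proof.
move=> hnu w1; have w0 := matnorm_ge0 w hnu; have K0 : 0 <= K by apply: ltW; case: hnu.
rewrite mxE; apply: (@csum_valP _ (K / (1 - nu w))) => m.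
apply: le_trans (geom_shift_le m K0 w0 w1); apply: ler_sum => k _.
rewrite ncM nc_natV; apply: (@le_trans _ _ (1 * (K * nu w ^+ k.+1))).
  apply: ler_pM; rewrite ?nc_ge0 ?natV_ge0 ?natV_le1 //.
  apply: (le_trans (matnorm_entry _ _ _ hnu)); apply: ler_wpM2l => //.
  exact: matnormX hnu.
by rewrite mul1r exprS; apply: ler_wpM2l => //; rewrite ler_piMl ?exprn_ge0 // ltW.
Qed.

(** The factor [k.+1] in [matnorm_powB] cancels the coefficient of the logarithm and leaves a
    geometric series. *)
Lemma Lg_lip n (nu : 'M[C]_n.+1 -> R) K q : matnorm nu K -> q < 1 ->
  exists2 B, 0 <= B & forall a b, nu a <= q -> nu b <= q ->
    en (Lg a - Lg b) <= B * en (a - b).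
Proof.
move=> hnu q1; have [K0 [_ _ _ _ hE]] := hnu; have K0' := ltW K0.
(* For negative [q] no matrix satisfies the bound. *)
have [q0|q0] := ltP q 0.
  exists 0 => // a b aq _; have := matnorm_ge0 a hnu.
  by rewrite leNgt (le_lt_trans aq).
have B0 : 0 <= K / (1 - q) by apply: divr_ge0 => //; lra.
exists (n.+1%:R * n.+1%:R * (K / (1 - q) * K)); first by apply: mulr_ge0; apply: mulr_ge0.
move=> a b aq bq; rewrite -[leRHS]mulrA; apply: en_le => i j; rewrite mxE [X in _ + X]mxE.
have a1 := le_lt_trans aq q1; have b1 := le_lt_trans bq q1.
have h := csumD (Lg_sum i j hnu a1) (csumZ (-1) (Lg_sum i j hnu b1)).
rewrite mulN1r in h; apply: csum_nc_le h => m.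
have n0 := matnorm_ge0 (a - b) hnu.
apply: (@le_trans _ _ (\sum_(k < m) (K * nu (a - b)) * q ^+ k)).
  apply: ler_sum => k _.
  have -> : k.+1%:R^-1 * (a ^+ k.+1) i j + -1 * (k.+1%:R^-1 * (b ^+ k.+1) i j) =
     k.+1%:R^-1 * (a ^+ k.+1 - b ^+ k.+1) i j :> C.
    by rewrite mxE [X in _ = _ * (_ + X)]mxE mulN1r mulrBr.
  rewrite ncM nc_natV; have k0 : (0 : R) < k.+1%:R by rewrite ltr0n.
  rewrite mulrC ler_pdivrMr //; apply: (le_trans (matnorm_entry _ _ _ hnu)).
  have -> : K * nu (a - b) * q ^+ k * k.+1%:R = K * (k.+1%:R * q ^+ k * nu (a - b)) by ring.
  by apply: ler_wpM2l => //; exact: matnorm_powB hnu aq bq.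
apply: (le_trans (geom_shift_le _ _ q0 q1)); first by rewrite mulr_ge0.
have -> : K * nu (a - b) / (1 - q) = K / (1 - q) * nu (a - b) by ring.
by rewrite -[leRHS]mulrA; apply: ler_wpM2l.
Qed.

(* Taylor coefficients of [w ^+ j.+1] in terms of those of [w]. *)
Fixpoint pw n (W : nat -> 'M[C]_n.+1) j k : 'M[C]_n.+1 :=
  if j is j'.+1 then \sum_(i < k.+1) W i * pw W j' (k - i)%N else W k.

Lemma pw_ext n (W V : nat -> 'M[C]_n.+1) j k : (forall i, (i <= k)%N -> W i = V i) ->
  pw W j k = pw V j k.
Proof.
elim: j k => [|j IH] k h /=; first exact: h.
apply: eq_bigr => i _; have ik : (i <= k)%N by rewrite -ltnS.
rewrite (h i ik) (IH (k - i)%N) // => l le; apply: h; exact: leq_trans le (leq_subr _ _).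
Qed.

Lemma pw_l1 n (nu : 'M[C]_n.+1 -> R) K (W : nat -> 'M[C]_n.+1) (r q : R) j m : matnorm nu K -> 0 <= r ->
  \sum_(k < m) nu (W k) * r ^+ k <= q -> \sum_(k < m) nu (pw W j k) * r ^+ k <= q ^+ j.+1.
Proof.
move=> hnu r0 h; have [K0 [hM _ _ _ _]] := hnu.
have p0 V k : 0 <= nu (V k) * r ^+ k.
  by move=> *; rewrite mulr_ge0 ?exprn_ge0 //; exact: matnorm_ge0 hnu.
elim: j => [|j IH]; first by rewrite expr1.
pose x k := nu (W k) * r ^+ k; pose y k := nu (pw W j k) * r ^+ k.
apply: (@le_trans _ _ (\sum_(k < m) \sum_(i < k.+1) x i * y (k - i)%N)).
  apply: ler_sum => k _ /=.
  apply: (le_trans (ler_wpM2r _ (matnorm_sum _ _ _ hnu))); first exact: exprn_ge0.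
  rewrite mulr_suml; apply: ler_sum => i _; rewrite /x /y.
  have -> : r ^+ k = r ^+ i * r ^+ (k - i) by rewrite -exprD subnKC // -ltnS.
  have -> : nu (W i) * r ^+ i * (nu (pw W j (k - i)) * r ^+ (k - i)) =
     (nu (W i) * nu (pw W j (k - i))) * (r ^+ i * r ^+ (k - i)) by ring.
  by apply: ler_wpM2r; rewrite ?mulr_ge0 ?exprn_ge0.
apply: le_trans (sum_triangle m (p0 W) (p0 (pw W j))) _.
rewrite exprS; apply: ler_pM => //; apply: sumr_ge0 => i _; exact: p0.
Qed.

Lemma is_lim_seq_sum (I : finType) (u : I -> nat -> R) (l : I -> R) :
  (forall i, is_lim_seq (u i) (Finite (l i))) ->
  is_lim_seq (fun n => \sum_i u i n) (Finite (\sum_i l i)).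
Proof.
move=> h; elim: (index_enum I) => [|i r IH].
  by apply: (is_lim_seq_ext (fun=> 0)) => [n|]; rewrite big_nil //; apply: is_lim_seq_const.
rewrite big_cons; apply: (is_lim_seq_ext (fun n => Rplus (u i n) (\sum_(j <- r) u j n))) => [n|].
  by rewrite big_cons.
exact: is_lim_seq_plus'.
Qed.

Lemma sum_nc_limit_le (I : finType) (c : I -> R) (u : I -> nat -> C) (l : I -> C) B :
  (forall i, 0 <= c i) ->
  (forall J, \sum_(j < J) \sum_i c i * nc (u i j) <= B) -> (forall i, csum (u i) (l i)) ->
  \sum_i c i * nc (l i) <= B.
Proof.
move=> c0 hB hl.
apply: (@lim_le_const (fun J => \sum_i c i * nc (\sum_(j < J) u i j))).
  apply: is_lim_seq_sum => i.
  exact: (is_lim_seq_scal_l _ (c i) (Finite (nc (l i))) (clim_nc (hl i))).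
move=> J; apply: le_trans (hB J); rewrite exchange_big; apply: ler_sum => i _.
by rewrite -mulr_sumr; apply: ler_wpM2l => //; exact: nc_sum.
Qed.

(** Taylor coefficients of [Lg w]. By [pw_ext] the [k]-th one involves only [W 0, ..., W k], which
    makes the recursion of [ode_solution] well founded. *)
Definition lgc n (W : nat -> 'M[C]_n.+1) k : 'M[C]_n.+1 :=
  \matrix_(i, j) csum_val (fun p => p.+1%:R^-1 * pw W p k i j).

Section PowerSeriesLog.
Variables (n : nat) (nu : 'M[C]_n.+1 -> R) (K : R) (W : nat -> 'M[C]_n.+1) (r q : R) (m : nat).
Hypotheses (hnu : matnorm nu K) (r0 : 0 < r) (q0 : 0 <= q) (q1 : q < 1).
Hypothesis hW : \sum_(k < m) nu (W k) * r ^+ k <= q.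

Lemma lgc_sum k i j : (k < m)%N -> csum (fun p => p.+1%:R^-1 * pw W p k i j) (lgc W k i j).
Proof.
move=> km; have K0 : 0 <= K by apply: ltW; case: hnu.
have rk : 0 < r ^+ k by rewrite exprn_gt0.
rewrite mxE; apply: (@csum_valP _ (K / r ^+ k / (1 - q))) => J.
have K1 : 0 <= K / r ^+ k by apply: divr_ge0 => //; exact: ltW.
apply: le_trans (geom_shift_le J K1 q0 q1); apply: ler_sum => p _.
rewrite ncM nc_natV; apply: (@le_trans _ _ (1 * (K / r ^+ k * q ^+ p))); last by rewrite mul1r.
apply: ler_pM; rewrite ?nc_ge0 ?natV_ge0 ?natV_le1 //.
apply: (le_trans (matnorm_entry _ _ _ hnu)); rewrite -mulrA; apply: ler_wpM2l => //.
rewrite mulrC ler_pdivlMr //; apply: (@le_trans _ _ (q ^+ p.+1)).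
  apply: le_trans (pw_l1 p hnu (ltW r0) hW); rewrite (bigD1 (Ordinal km)) //= lerDl.
  by apply: sumr_ge0 => l _; apply: mulr_ge0; [exact: matnorm_ge0 hnu|apply: exprn_ge0; exact: ltW].
by rewrite exprS ler_piMl ?exprn_ge0 // ltW.
Qed.

(** The power [w ^+ p.+1] contributes at most a constant times [q ^+ p], so the sum over [p] is
    geometric. Only the first [m] coefficients are controlled, because the estimate feeds an
    induction on [m]. *)
Lemma lgc_l1 : \sum_(k < m) en (lgc W k) * r ^+ k <= K / (1 - q).
Proof.
have K0 : 0 <= K by apply: ltW; case: hnu.
have -> : \sum_(k < m) en (lgc W k) * r ^+ k =
   \sum_(x : 'I_m * ('I_n.+1 * 'I_n.+1)) r ^+ x.1 * nc (lgc W x.1 x.2.1 x.2.2).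
  rewrite -(pair_bigA _ (fun (k : 'I_m) (y : 'I_n.+1 * 'I_n.+1) => r ^+ k * nc (lgc W k y.1 y.2))) /=; apply: eq_bigr => k _.
  rewrite -(pair_bigA _ (fun i j => r ^+ k * nc (lgc W k i j))) /= mulrC mulr_sumr.
  by apply: eq_bigr => i _; rewrite mulr_sumr.
apply: (@sum_nc_limit_le ('I_m * ('I_n.+1 * 'I_n.+1))%type (fun x => r ^+ x.1)
   (fun x p => p.+1%:R^-1 * pw W p x.1 x.2.1 x.2.2) (fun x => lgc W x.1 x.2.1 x.2.2)).
- by move=> x; apply: exprn_ge0; exact: ltW.
- move=> J; apply: le_trans (geom_shift_le J K0 q0 q1); apply: ler_sum => p _.
  apply: (@le_trans _ _ (\sum_(k < m) K * (nu (pw W p k) * r ^+ k))); last first.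
    rewrite -mulr_sumr; apply: ler_wpM2l => //.
    apply: (le_trans (pw_l1 p hnu (ltW r0) hW)).
    by rewrite exprS ler_piMl ?exprn_ge0 // ltW.
  rewrite -(pair_bigA _ (fun (k : 'I_m) (y : 'I_n.+1 * 'I_n.+1) => r ^+ k * nc (p.+1%:R^-1 * pw W p k y.1 y.2))) /=.
  apply: ler_sum => k _; have [_ [_ _ _ hE _]] := hnu.
  rewrite mulrA -mulr_sumr mulrC; apply: ler_wpM2r; first by apply: exprn_ge0; exact: ltW.
  apply: le_trans (hE _).
  rewrite -(pair_bigA _ (fun i j => nc (p.+1%:R^-1 * pw W p k i j))) /=.
  apply: ler_sum => i _; apply: ler_sum => j _; rewrite ncM nc_natV.
  by rewrite ler_piMl ?nc_ge0 ?natV_le1.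
- by move=> x; apply: lgc_sum.
Qed.
End PowerSeriesLog.

Lemma csum_lin n (Phi : {linear 'M[C]_n.+1 -> 'M[C]_n.+1}) (u : nat -> 'M[C]_n.+1) (l : 'M[C]_n.+1) :
  (forall i j, csum (fun k => u k i j) (l i j)) ->
  forall i j, csum (fun k => Phi (u k) i j) (Phi l i j).
Proof.
move=> h i j.
have E (A : 'M[C]_n.+1) : Phi A i j = \sum_a \sum_b Phi (delta_mx a b) i j * A a b.
  rewrite {1}[A]matrix_sum_delta linear_sum summxE; apply: eq_bigr => a _.
  rewrite linear_sum summxE; apply: eq_bigr => b _.
  by rewrite linearZ mxE mulrC.
rewrite E; apply: (csum_ext (u := fun k => \sum_a \sum_b Phi (delta_mx a b) i j * u k a b)).
  by move=> k; rewrite [RHS]E.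
by apply: csum_sum => a; apply: csum_sum => b; apply: csumZ.
Qed.

Lemma pseries_derive (a : nat -> R) (F : R -> R) (r B x l : R) : 0 < r ->
  (forall k, `|a k| * r ^+ k <= B) ->
  (forall t, `|t| < r -> is_series (fun k => a k * t ^+ k) (F t)) -> `|x| < r ->
  is_series (fun k => k.+1%:R * a k.+1 * x ^+ k) l -> is_derive F x l.
Proof.
move=> r0 hB hF xr hl.
have FE t : `|t| < r -> PSeries a t = F t.
  move=> tr; apply: is_series_unique; apply: is_series_ext (hF t tr) => k.
  by rewrite RpowE.
have cv : Rbar_lt (Finite (Rabs x)) (CV_radius a).
  apply: (@Rbar_lt_le_trans _ (Finite r)); first by apply/RltP; rewrite RabsE.
  have [ub _] := CV_radius_bounded a; apply: ub; exists B => k; apply/RleP.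
  by rewrite RpowE RabsE normrM normrX (gtr0_norm r0).
have lE : PSeries (PS_derive a) x = l.
  apply: is_series_unique; apply: is_series_ext hl => k.
  by rewrite RpowE /PS_derive INRE.
have h := is_derive_PSeries a x cv; rewrite lE in h.
apply: is_derive_ext_loc h.
have d0 : 0 < r - `|x| by rewrite subr_gt0.
have d0' := elimT RltP d0.
exists (mkposreal _ d0') => y hy; apply: FE.
have {}hy : `|y - x| < r - `|x| by apply/RltP; rewrite -RabsE; exact: hy.
have := ler_normD (y - x) x; rewrite subrK; lra.
Qed.

Lemma is_derive_shift (F : R -> R) (s t l : R) :
  is_derive (fun y => F (s + y)) t l -> is_derive F (s + t) l.
Proof.
move=> h.
have h2 : is_derive (fun x : R => Rminus x s) (s + t) (1 : R).
  have := is_derive_minus (fun x : R => x) (fun=> s) (s + t) _ _ (is_derive_id _)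
    (is_derive_const s (s + t)).
  by rewrite /minus opp_zero plus_zero_r.
have e : Rminus (s + t) s = t by rewrite RminusE addrC addKr.
have h1 := eq_ind_r (fun x => is_derive (fun y => F (s + y)) x l) h e.
have h3 := is_derive_comp (fun y => F (s + y)) (fun x => Rminus x s) (s + t) l 1 h1 h2.
have h4 : is_derive (fun x => F (s + Rminus x s)) (s + t) l.
  by move: h3; rewrite /scal /= /mult /= Rmult_1_l.
apply: (@is_derive_ext R_AbsRing R_NormedModule _ _ _ _ _ h4) => x.
by rewrite RminusE addrC subrK.
Qed.

Lemma csum_val_ext u v : u =1 v -> csum_val u = csum_val v.
Proof. by move=> e; rewrite /csum_val; congr (_ +i* _); apply: Series_ext => k; rewrite e. Qed.

(* In the recursion for the Taylor coefficients of [w] the bound [q < 1] on the [l1]-norm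
   survives each step once the radius is small. *)
Lemma ode_solution n (nu : 'M[C]_n.+1 -> R) K (Phi : {linear 'M[C]_n.+1 -> 'M[C]_n.+1}) phi
    (w0 : 'M[C]_n.+1) s : matnorm nu K -> nu w0 < 1 ->
  0 <= phi -> (forall a, nu (Phi a) <= phi * en a) ->
  exists w : R -> 'M[C]_n.+1, [/\ anmx s w, w s = w0 & near s (fun t => forall i j,
    is_derive (fun x => Re (w x i j)) t (Re (Phi (Lg (w t)) i j)) /\
    is_derive (fun x => Im (w x i j)) t (Im (Phi (Lg (w t)) i j)))].
Proof.
move=> hnu w01 phi0 hPhi; have [K0 [hM hD hZ hE hE']] := hnu; have K0' := ltW K0.
have nw0 := matnorm_ge0 w0 hnu.
(* Comparison of coefficients in [w' = Phi (Lg w)]. *)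
pose Psi (W : nat -> 'M[C]_n.+1) k := if k is k'.+1 then k'.+1%:R^-1 *: Phi (lgc W k') else w0.
have [W hW] : exists W, forall k, W k = Psi W k.
  apply: (strong_rec 0) => -[|k] f g h //=; congr (_ *: Phi _); apply/matrixP => i j.
  rewrite !mxE; apply: csum_val_ext => p; congr (_ * _).
  by rewrite (@pw_ext _ f g) // => l le; apply: h.
pose q := (1 + nu w0) / 2%:R.
have q0 : 0 <= q by rewrite /q; lra.
have q1 : q < 1 by rewrite /q; lra.
have qw : nu w0 < q by rewrite /q; lra.
pose B := K / (1 - q); have B0 : 0 <= B by apply: divr_ge0 => //; lra.
(* The terms after the first add at most [r * phi * B] to [nu w0]; this radius keeps the total below
   [q]. The [+ 1] covers [phi * B = 0]. *)
pose r := (q - nu w0) / (phi * B + 1).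
have D0 : 0 < phi * B + 1 by apply: ltr_wpDl => //; exact: mulr_ge0.
have r0 : 0 < r by apply: divr_gt0 => //; lra.
have rB : r * (phi * B) <= q - nu w0.
  rewrite /r mulrAC ler_pdivrMr //; apply: ler_wpM2l; first by lra.
  by rewrite lerDl.
have S m : \sum_(k < m) nu (W k) * r ^+ k <= q.
  elim: m => [|m IH]; first by rewrite big_ord0.
  rewrite big_ord_recl expr0 mulr1 {1}hW /=.
  have h : \sum_(k < m) nu (W (lift ord0 k)) * r ^+ (lift ord0 k) <=
      r * (phi * (\sum_(k < m) en (lgc W k) * r ^+ k)).
    rewrite !mulr_sumr; apply: ler_sum => k _; rewrite /= hW /= exprS.
    have -> : r * (phi * (en (lgc W k) * r ^+ k)) = (phi * en (lgc W k)) * (r * r ^+ k) by ring.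
    apply: ler_wpM2r; first by apply: mulr_ge0; [exact: ltW|apply: exprn_ge0; exact: ltW].
    apply: (le_trans (hZ _ _)); apply: le_trans (hPhi _); rewrite nc_natV.
    by rewrite ler_piMl ?natV_le1 //; exact: matnorm_ge0 hnu.
  have h2 := lgc_l1 hnu r0 q0 q1 IH.
  have h3 : r * (phi * (\sum_(k < m) en (lgc W k) * r ^+ k)) <= r * (phi * B).
    by apply: ler_wpM2l; [exact: ltW|apply: ler_wpM2l].
  lra.
have l1p p i j : l1 r (fun k => pw W p k i j) (K * q ^+ p.+1).
  move=> m; apply: le_trans (ler_wpM2l K0' (pw_l1 p hnu (ltW r0) (S m))).
  rewrite mulr_sumr; apply: ler_sum => k _; rewrite mulrA.
  apply: ler_wpM2r; first by apply: exprn_ge0; exact: ltW.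
  exact: matnorm_entry hnu.
have l1W i j : l1 r (fun k => W k i j) (K * q) by have := l1p 0%N i j; rewrite expr1.
have l1G i j : l1 r (fun k => lgc W k i j) B.
  move=> m; apply: le_trans (lgc_l1 hnu r0 q0 q1 (S m)); apply: ler_sum => k _.
  by apply: ler_wpM2r; [apply: exprn_ge0; exact: ltW|exact: en_entry].
pose w u : 'M[C]_n.+1 := \matrix_(i, j) csum_val (fun k => W k i j * (u - s)%:C ^+ k).
have hw i j t : `|t| < r -> psum (fun k => W k i j) t (w (s + t) i j).
  move=> tr; rewrite mxE [s + t]addrC addrK.
  exact: csum_valP (l1_abs (ltW tr) (l1W i j)).
have hwp p i j t : `|t| < r -> psum (fun k => pw W p k i j) t ((w (s + t) ^+ p.+1) i j).
  move=> tr; elim: p i j => [|p IH] i j; first by rewrite expr1; exact: hw.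
  rewrite exprS mxE.
  apply: (csum_ext (u := fun k => \sum_l conv (fun k => W k i l) (fun k => pw W p k l j) k * t%:C ^+ k)).
    move=> k; rewrite -mulr_suml; congr (_ * _); rewrite /= summxE exchange_big.
    by apply: eq_bigr => h _; rewrite mxE.
  apply: csum_sum => l; exact: psum_conv (ltW tr) (l1W i l) (l1p p l j) (hw i l t tr) (IH l j).
have hG i j t : `|t| < r -> psum (fun k => lgc W k i j) t (Lg (w (s + t)) i j).
  move=> tr; have [l hl _] := psum_ex (ltW tr) (l1G i j).
  suff -> : Lg (w (s + t)) i j = l by [].
  rewrite mxE; apply: csum_valE.
  (* One ratio below [1] for both indices: powers of [w] decay like [q], Taylor terms like the ratio
     of [t] to the radius. *)
  pose x := Num.max q (`|t| / r).
  have t0 : 0 <= `|t| / r by apply: divr_ge0 => //; exact: ltW.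
  have x0 : 0 <= x by rewrite le_max q0.
  have x1 : x < 1 by rewrite gt_max q1 ltr_pdivrMr // mul1r.
  have qx : q <= x by rewrite le_max lexx.
  have tx : `|t| / r <= x by rewrite le_max lexx orbT.
  apply: (@csum_swap (fun p k => p.+1%:R^-1 * pw W p k i j * t%:C ^+ k) _
            (fun k => lgc W k i j * t%:C ^+ k) l K x x0 x1 _ _ _ hl).
  - move=> p k; rewrite !ncM ncX ncR nc_natV.
    have h1 : nc (pw W p k i j) * r ^+ k <= K * q ^+ p.+1 := l1_term k (ltW r0) (l1p p i j).
    have rk : 0 < r ^+ k by rewrite exprn_gt0.
    have -> : (p.+1%:R)^-1 * nc (pw W p k i j) * `|t| ^+ k =
       (p.+1%:R)^-1 * ((nc (pw W p k i j) * r ^+ k) * (`|t| / r) ^+ k).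
      have -> : `|t| ^+ k = r ^+ k * (`|t| / r) ^+ k.
        by rewrite -exprMn mulrCA mulfV ?mulr1 // gt_eqF.
      by rewrite !mulrA.
    apply: (@le_trans _ _ (1 * ((K * q ^+ p.+1) * (`|t| / r) ^+ k))).
      apply: ler_pM; rewrite ?natV_ge0 ?natV_le1 //.
        by apply: mulr_ge0; [apply: mulr_ge0; rewrite ?nc_ge0 // ltW|exact: exprn_ge0].
      by apply: ler_wpM2r => //; exact: exprn_ge0.
    have a0 : 0 <= K * q ^+ p.+1 by apply: mulr_ge0 => //; exact: exprn_ge0.
    have b0 : 0 <= (`|t| / r) ^+ k by exact: exprn_ge0.
    rewrite mul1r; apply: ler_pM => //.
      apply: ler_wpM2l => //; apply: (@le_trans _ _ (q ^+ p)).
        by rewrite exprS ler_piMl ?exprn_ge0 // ltW.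
      by rewrite lerXn2r ?nnegrE.
    by rewrite lerXn2r ?nnegrE.
  - move=> p; apply: csum_ext (csumZ p.+1%:R^-1 (hwp p i j t tr)) => k.
    by rewrite mulrA.
  - move=> k; have := lgc_sum hnu r0 q0 q1 (S k.+1) i j (ltnSn k).
    move=> /(csumZ (t%:C ^+ k)); rewrite mulrC; apply: csum_ext => p.
    by rewrite mulrC.
exists w; split.
- move=> i j; exists r => //; exists (fun k => W k i j), (K * q); split; first exact: l1W.
  exact: hw.
- apply/matrixP => i j; have := hw i j 0; rewrite normr0 addr0 => /(_ r0) h.
  by rewrite (csum_uniq h (psum0 _)) hW.
apply: (near_shift r0) => t tr i j.
have hP : csum (fun k => Phi (t%:C ^+ k *: lgc W k) i j) (Phi (Lg (w (s + t))) i j).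
  apply: csum_lin => a b; apply: csum_ext (hG a b t tr) => k.
  by rewrite [RHS]mxE mulrC.
have hP' : csum (fun k => k.+1%:R * W k.+1 i j * t%:C ^+ k) (Phi (Lg (w (s + t))) i j).
  apply: csum_ext hP => k; rewrite linearZ mxE [in RHS]hW mxE mulrA mulfV ?mul1r 1?mulrC //.
  by rewrite pnatr_eq0.
have tk k : t%:C ^+ k = (t ^+ k)%:C by rewrite rmorphXn.
have nk k : (k.+1%:R : C) = (k.+1%:R : R)%:C by rewrite rmorph_nat.
have [d1 d2] := proj1 (csumE _ _) hP'.
have wk k : nc (W k i j) * r ^+ k <= K * q := l1_term k (ltW r0) (l1W i j).
split; apply: is_derive_shift.
  apply: (@pseries_derive (fun k => Re (W k i j)) _ r (K * q)) => //.
  - move=> k; apply: le_trans (wk k); apply: ler_wpM2r; last exact: nc_Re.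
    by apply: exprn_ge0; exact: ltW.
  - move=> y yr; have [h _] := proj1 (csumE _ _) (hw i j y yr).
    by apply: is_series_ext h => k; rewrite -rmorphXn mulrC cReRM mulrC.
  - by apply: is_series_ext d1 => k; rewrite tk nk mulrC cReRM -mulrA cReRM; ring.
apply: (@pseries_derive (fun k => Im (W k i j)) _ r (K * q)) => //.
- move=> k; apply: le_trans (wk k); apply: ler_wpM2r; last exact: nc_Im.
  by apply: exprn_ge0; exact: ltW.
- move=> y yr; have [_ h] := proj1 (csumE _ _) (hw i j y yr).
  by apply: is_series_ext h => k; rewrite -rmorphXn mulrC cImRM mulrC.
- by apply: is_series_ext d2 => k; rewrite tk nk mulrC cImRM -mulrA cImRM; ring.
Qed.

(** * Uniqueness for the differential equation *)

Lemma halving_zero (x M : R) : 0 <= x -> (forall k, x <= M * 2%:R^-1 ^+ k) -> x = 0.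
Proof.
move=> x0 h; apply/eqP; rewrite eq_le x0 andbT leNgt; apply/negP => xp.
have M0 : 0 <= M by have := h 0%N; rewrite expr0 mulr1; apply: le_trans.
have h0 : (0 : R) <= 2%:R^-1 by rewrite invr_ge0 ler0n.
have h1 : (2%:R^-1 : R) < 1 by rewrite invf_lt1 ?ltr1n ?ltr0n.
have Mp : 0 < M + 1 by lra.
have e0 : 0 < x / (M + 1) by apply: divr_gt0.
have [k hk] := proj1 (is_lim_seq_eps _ _) (geom_lim h0 h1) _ e0.
have := hk k (leqnn k); rewrite subr0 ger0_norm ?exprn_ge0 // ltr_pdivlMr // => lt.
have := h k; have := exprn_ge0 k h0; nra.
Qed.

Lemma between (lo s t x : R) : lo <= s -> lo <= t -> Rmin s t <= x -> x <= Rmax s t ->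
  lo <= x /\ `|x - s| <= `|t - s|.
Proof.
rewrite RminE RmaxE => ls lt; rewrite ge_min le_max => h1 h2.
have [st|ts] := leP s t.
  have sx : s <= x by case/orP: h1 => // tx; apply: le_trans tx.
  have xt : x <= t by case/orP: h2 => // xs; apply: le_trans xs _.
  by split; [exact: le_trans sx|rewrite !ger0_norm ?subr_ge0 // lerB].
have tx : t <= x by case/orP: h1 => // sx; apply: le_trans sx; exact: ltW.
have xs : x <= s by case/orP: h2 => // xt; apply: le_trans xt _; exact: ltW.
by split; [exact: le_trans tx|rewrite !ler0_norm ?subr_le0 ?(ltW ts) // lerN2 lerB].
Qed.

Lemma mvt_bound (f df : R -> R) (s t lo d B : R) : lo <= s -> lo <= t -> `|t - s| < d ->
  (forall x, lo < x -> `|x - s| < d -> is_derive f x (df x)) ->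
  (forall x, lo <= x -> `|x - s| < d -> continuity_pt f x) ->
  (forall x, lo <= x -> `|x - s| <= `|t - s| -> `|df x| <= B) ->
  f s = 0 -> `|f t| <= B * `|t - s|.
Proof.
move=> ls lt td hd hc hB fs.
have [||c [[c1 c2] e]] := MVT_gen f s t df.
- move=> x [/RltP x1 /RltP x2].
  have [lx xs] := between ls lt (ltW x1) (ltW x2).
  apply: hd; last exact: le_lt_trans td.
  by move: x1; rewrite RminE gt_min => /orP[]; apply: le_lt_trans.
- move=> x [/RleP x1 /RleP x2].
  have [lx xs] := between ls lt x1 x2.
  by apply: hc => //; exact: le_lt_trans td.
have [lc cs] := between ls lt (introT RleP c1) (introT RleP c2).
move: e; rewrite fs RminusE subr0 => ->; rewrite RmultE RminusE normrM.
by apply: ler_wpM2r; rewrite ?normr_ge0 //; exact: hB.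
Qed.

(** Derivatives strictly after [lo], continuity from [lo] on: at the initial time the flow has only
    a one-sided derivative, and this is exactly what the mean value theorem asks. *)
Definition solves n (Phi : 'M[C]_n.+1 -> 'M[C]_n.+1) (lo s d : R) (w : R -> 'M[C]_n.+1) :=
  forall i j,
   (forall t, lo < t -> `|t - s| < d ->
    is_derive (fun x => Re (w x i j)) t (Re (Phi (Lg (w t)) i j)) /\
    is_derive (fun x => Im (w x i j)) t (Im (Phi (Lg (w t)) i j))) /\
   (forall t, lo <= t -> `|t - s| < d ->
    continuity_pt (fun x => Re (w x i j)) t /\ continuity_pt (fun x => Im (w x i j)) t).

(* On a short interval a bound [M] on the difference improves to [M / 2]. *)
Lemma ode_unique n (nu : 'M[C]_n.+1 -> R) K (Phi : {linear 'M[C]_n.+1 -> 'M[C]_n.+1}) phi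
    (lo s d q : R) (w1 w2 : R -> 'M[C]_n.+1) : matnorm nu K -> q < 1 ->
  0 <= phi -> (forall a, nu (Phi a) <= phi * en a) -> lo <= s -> 0 < d ->
  solves Phi lo s d w1 -> solves Phi lo s d w2 ->
  (forall t, lo <= t -> `|t - s| < d -> nu (w1 t) <= q /\ nu (w2 t) <= q) -> w1 s = w2 s ->
  exists2 e, 0 < e & forall t, lo <= t -> `|t - s| < e -> w1 t = w2 t.
Proof.
move=> hnu q1 phi0 hPhi ls d0 s1 s2 hq e0; have [K0 [_ hD hZ hE hE']] := hnu; have K0' := ltW K0.
have [B B0 hB] := Lg_lip hnu q1.
pose L := K * (phi * B); have L0 : 0 <= L by do 2![apply: mulr_ge0 => //].
pose N : R := n.+1%:R * n.+1%:R; have N0 : 0 <= N by apply: mulr_ge0; exact: ler0n.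
have D0 : 0 < 4%:R * (N * L) + 1 by apply: ltr_wpDl => //; apply: mulr_ge0; rewrite ?ler0n // mulr_ge0.
(* [N] counts the entries; real and imaginary parts give a factor [2], the halving another. The
   [+ 1] keeps the inverse positive when [L = 0]. *)
pose e := Num.min d (4%:R * (N * L) + 1)^-1.
have e_gt0 : 0 < e by rewrite lt_min d0 invr_gt0.
have ed : e <= d by rewrite ge_min lexx.
have eL : (4%:R * (N * L)) * e <= 1.
  apply: (@le_trans _ _ ((4%:R * (N * L) + 1) * (4%:R * (N * L) + 1)^-1)); last by rewrite mulfV ?gt_eqF.
  apply: ler_pM; [|exact: ltW|by rewrite lerDl|by rewrite ge_min lexx orbT].
  by apply: mulr_ge0; rewrite ?ler0n // mulr_ge0.
pose Del t := w1 t - w2 t.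
have step M : 0 <= M -> (forall t, lo <= t -> `|t - s| < e -> en (Del t) <= M) ->
    forall t, lo <= t -> `|t - s| < e -> en (Del t) <= M / 2%:R.
  move=> M0 hM t lt te.
  have bd x i j : lo <= x -> `|x - s| <= `|t - s| -> nc (Phi (Lg (w1 x) - Lg (w2 x)) i j) <= L * M.
    move=> lx xs; have xe := le_lt_trans xs te; have xd := lt_le_trans xe ed.
    have [q1' q2'] := hq x lx xd.
    apply: (le_trans (matnorm_entry _ _ _ hnu)); rewrite /L -mulrA; apply: ler_wpM2l => //.
    apply: (le_trans (hPhi _)); rewrite -mulrA; apply: ler_wpM2l => //.
    apply: (le_trans (hB _ _ q1' q2')); apply: ler_wpM2l => //; exact: hM.
  have td := lt_le_trans te ed.
  have ent i j : nc (Del t i j) <= 2%:R * (L * M) * e.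
    apply: (le_trans (nc_le _)).
    have LM : 0 <= L * M by apply: mulr_ge0.
    have h1 : `|Re (Del t i j)| <= L * M * `|t - s|.
      rewrite /Del mxE [X in _ + X]mxE cReD cReN.
      apply: (@mvt_bound (fun x => Rminus (Re (w1 x i j)) (Re (w2 x i j)))
        (fun x => Re (Phi (Lg (w1 x) - Lg (w2 x)) i j)) s t lo d (L * M)) => //.
      - move=> x lx xd; rewrite linearB mxE [X in _ + X]mxE cReD cReN.
        have [[g1 _] [g2 _]] := (proj1 (s1 i j) x lx xd, proj1 (s2 i j) x lx xd).
        exact: (is_derive_minus _ _ _ _ _ g1 g2).
      - move=> x lx xd; have [g1 _] := proj2 (s1 i j) x lx xd.
        by have [g2 _] := proj2 (s2 i j) x lx xd; exact: continuity_pt_minus.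
      - by move=> x lx xs; apply: le_trans (nc_Re _) _; exact: bd.
      - by rewrite e0 RminusE subrr.
    have h2 : `|Im (Del t i j)| <= L * M * `|t - s|.
      rewrite /Del mxE [X in _ + X]mxE cImD cImN.
      apply: (@mvt_bound (fun x => Rminus (Im (w1 x i j)) (Im (w2 x i j)))
        (fun x => Im (Phi (Lg (w1 x) - Lg (w2 x)) i j)) s t lo d (L * M)) => //.
      - move=> x lx xd; rewrite linearB mxE [X in _ + X]mxE cImD cImN.
        have [[_ g1] [_ g2]] := (proj1 (s1 i j) x lx xd, proj1 (s2 i j) x lx xd).
        exact: (is_derive_minus _ _ _ _ _ g1 g2).
      - move=> x lx xd; have [_ g1] := proj2 (s1 i j) x lx xd.
        by have [_ g2] := proj2 (s2 i j) x lx xd; exact: continuity_pt_minus.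
      - by move=> x lx xs; apply: le_trans (nc_Im _) _; exact: bd.
      - by rewrite e0 RminusE subrr.
    have h3 : L * M * `|t - s| <= L * M * e by apply: ler_wpM2l => //; exact: ltW.
    apply: (le_trans (lerD h1 h2)); apply: (le_trans (lerD h3 h3)).
    by rewrite -[leRHS]mulrA mulr_natl mulr2n.
  apply: (le_trans (en_le ent)); rewrite -/N.
  have -> : N * (2%:R * (L * M) * e) = ((4%:R * (N * L)) * e) * (M / 2%:R).
    have h2 : M = 2%:R * (M / 2%:R) by rewrite mulrCA mulfV ?mulr1 // pnatr_eq0.
    have h4 : (4%:R : R) = 2%:R * 2%:R by rewrite -natrM.
    by rewrite {1}h2 h4; move: (M / 2%:R) => Z; ring.
  by rewrite ler_piMl // divr_ge0.
have start t : lo <= t -> `|t - s| < e -> en (Del t) <= 2%:R * (K * q).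
  move=> lt te; have [g1 g2] := hq t lt (lt_le_trans te ed).
  rewrite /Del; apply: (le_trans (enD _ _)).
  have -> : en (- w2 t) = en (w2 t).
    by apply: eq_bigr => i _; apply: eq_bigr => j _; rewrite mxE ncN.
  rewrite mulr_natl mulr2n; apply: lerD.
    by apply: le_trans (hE _) _; apply: ler_wpM2l.
  by apply: le_trans (hE _) _; apply: ler_wpM2l.
have q0 : 0 <= q.
  have [|g1 _] := hq s ls; first by rewrite subrr normr0.
  by apply: le_trans g1; exact: matnorm_ge0 hnu.
have all k t : lo <= t -> `|t - s| < e -> en (Del t) <= (2%:R * (K * q)) * 2%:R^-1 ^+ k.
  elim: k t => [|k IH] t lt te; first by rewrite expr0 mulr1; exact: start.
  have Kq : 0 <= 2%:R * (K * q) * 2%:R^-1 ^+ k.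
    by apply: mulr_ge0; [apply: mulr_ge0; rewrite ?ler0n // mulr_ge0|apply: exprn_ge0; rewrite invr_ge0 ler0n].
  rewrite exprSr [leRHS]mulrA; exact: step Kq IH t lt te.
exists e => // t lt te; apply/matrixP => i j; apply/eqP; rewrite -subr_eq0; apply/eqP.
apply: nc_eq0; apply/eqP; rewrite eq_le nc_ge0 andbT.
have z := halving_zero (en_ge0 _) (fun k => all k t lt te).
rewrite -[leRHS]z; apply: le_trans (en_entry (Del t) i j); rewrite /Del !mxE; exact: lexx.
Qed.
(** * Matrices over [Cx] as matrices over [R[i]] *)

Definition cx (z : Cx) : C := fst z +i* snd z.
Definition xc (z : C) : Cx := (Re z, Im z).

Lemma cxK : cancel cx xc. Proof. by case. Qed.
Lemma xcK : cancel xc cx. Proof. by case. Qed.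
Lemma cx_inj : injective cx. Proof. exact: can_inj cxK. Qed.
Lemma cxD a b : cx (Cadd a b) = cx a + cx b. Proof. by []. Qed.
Lemma cxM a b : cx (Cmul a b) = cx a * cx b.
Proof. by case: a b => [? ?] []. Qed.
Lemma cx0 : cx Cx0 = 0. Proof. by []. Qed.
Lemma cx_sum f N : cx (Csum f N) = \sum_(i < N) cx (f i).
Proof. by elim: N => [|N IH]; rewrite ?big_ord0 ?big_ord_recr //= cxD IH. Qed.

Definition toM n (A : Mat) : 'M[C]_n := \matrix_(i, j) cx (A i j).
Definition ofM n (A : 'M[C]_n.+1) : Mat := fun i j => xc (A (inord i) (inord j)).

Lemma ofMK n (A : 'M[C]_n.+1) : toM n.+1 (ofM A) = A.
Proof. by apply/matrixP => i j; rewrite mxE xcK !inord_val. Qed.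
Lemma toM_eq n A B : Meq n A B <-> toM n A = toM n B.
Proof.
split=> [h|h i j /ssrnat.ltP ni /ssrnat.ltP nj]; first by apply/matrixP => i j; rewrite !mxE h //; apply/ssrnat.ltP.
by apply: cx_inj; have /matrixP/(_ (Ordinal ni) (Ordinal nj)) := h; rewrite !mxE.
Qed.
Lemma toMM n A B : toM n (Mmul n A B) = toM n A *m toM n B.
Proof.
apply/matrixP => i j; rewrite !mxE cx_sum; apply: eq_bigr => k _.
by rewrite !mxE cxM.
Qed.
Lemma toMD n A B : toM n (Madd A B) = toM n A + toM n B.
Proof. by apply/matrixP => i j; rewrite !mxE. Qed.
Lemma toMN n A : toM n (Mopp A) = - toM n A.
Proof. by apply/matrixP => i j; rewrite !mxE. Qed.
Lemma toMZ n z A : toM n (Mscal z A) = cx z *: toM n A.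
Proof. by apply/matrixP => i j; rewrite !mxE cxM. Qed.
Lemma toMJ n A : toM n (Madj A) = adjm (toM n A).
Proof. by apply/matrixP => i j; rewrite !mxE. Qed.
Lemma toM_diag n d : toM n (Mdiag d) = diag_mx (\row_i cx (d i)).
Proof.
apply/matrixP => i j; rewrite !mxE /Mdiag; case: (Nat.eqb_spec i j) => [e|ne].
  by rewrite (ord_inj e) eqxx mulr1n.
by rewrite (_ : (i == j) = false) ?mulr0n //; apply/eqP => e; apply: ne; rewrite e.
Qed.
Lemma toM1 n : toM n Mid = 1%:M.
Proof.
have -> : Mid = Mdiag (fun=> Cx1) by [].
rewrite toM_diag -diag_const_mx; congr diag_mx.
by apply/rowP => i; rewrite !mxE.
Qed.
Lemma toM_tr n A : cx (Mtr n A) = \tr (toM n A).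
Proof. by rewrite cx_sum; apply: eq_bigr => i _; rewrite mxE. Qed.

Definition cmx n (z a : 'M[C]_n) : 'M[C]_n := z *m a - a *m z.
Definition lap n (x y a : 'M[C]_n) : 'M[C]_n := cmx y (cmx y a) + cmx x (cmx x a).

Lemma toM_lap n x y a : toM n (Lap n x y a) = lap (toM n x) (toM n y) (toM n a).
Proof. by rewrite /Lap /Mcomm /Msub !(toMD, toMN, toMM). Qed.

Lemma cmxP n (z : 'M[C]_n) k a b : cmx z (k *: a + b) = k *: cmx z a + cmx z b.
Proof. by rewrite /cmx mulmxDr mulmxDl scalerBr -scalemxAr -scalemxAl opprD addrACA. Qed.

(** * Positive matrices and their logarithms *)

Definition rdiag n (d : 'I_n -> R) : 'M[C]_n := diag_mx (\row_i (d i)%:C).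
Definition conjd n (U : 'M[C]_n) (d : 'I_n -> R) := U *m rdiag d *m adjm U.

Lemma toM_conjd n (d : nat -> R) U :
  toM n (Mmul n (Mmul n U (Mdiag (fun k => RtoC (d k)))) (Madj U)) = conjd (toM n U) (fun i => d i).
Proof. by rewrite !toMM toMJ toM_diag. Qed.

Lemma conjd_entry n (U : 'M[C]_n) d i j :
  conjd U d i j = \sum_l (d l)%:C * (U i l * conjc (U j l)).
Proof.
rewrite mxE; apply: eq_bigr => l _; rewrite /rdiag mul_mx_diag !mxE.
by rewrite [X in X * _]mulrC mulrA.
Qed.

(** The spectral theorem is the constant case [M = 1] of [an_pencil], read at one time. *)
Lemma hermitian_diag n (A : 'M[C]_n) : adjm A = A ->
  exists (U : 'M[C]_n) (d : 'I_n -> R), [/\ adjm U *m U = 1%:M, U *m adjm U = 1%:M & A = conjd U d].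
Proof.
move=> hA.
have o : opc (fun=> True) by split=> // s _; apply: near_all.
have [|||lam [v [_ _ /(_ 0 I)[h1 h2]]]] := @an_pencil (fun=> True) 0 n A (fun=> 1%:M) o I hA.
- by move=> s _; apply: anmx_cst.
- by move=> t _; apply/matrixP => i j; rewrite !mxE conjc_nat eq_sym.
- move=> s _; exists 1 => //; apply: near_all => t u; rewrite mul1r /form mulmx1 mxE Csum_Re.
  by apply: ler_sum => i _; rewrite adjm_entry cReM nc_sqr; case: (u 0 i) => a b /=; rewrite mulrN opprK !expr2.
pose V : 'M[C]_n := \matrix_(i, j) v i 0 0 j.
have rV (i : 'I_n) : row i V = v i 0 by apply/rowP => j; rewrite !mxE.
have VV : V *m adjm V = 1%:M.
  apply/matrixP => i j; have := h2 i j (ltn_ord i) (ltn_ord j); rewrite /form mulmx1 mxE => e.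
  rewrite [RHS]mxE -val_eqE /= -e mxE; apply: eq_bigr => l _.
  by rewrite !adjm_entry !mxE.
have VV' : adjm V *m V = 1%:M by apply: mulmx1C.
have VA : V *m A = diag_mx (\row_i lam i 0) *m V.
  apply/row_matrixP => i; rewrite row_mul rV (h1 i (ltn_ord i)) mulmx1.
  by rewrite row_mul row_diag_mx mxE -scalemxAl -rowE rV.
have lR (i : 'I_n) : lam i 0 = (Re (lam i 0))%:C.
  have e : form A (v i 0) (v i 0) = lam i 0.
    have := h2 i i (ltn_ord i) (ltn_ord i); rewrite eqxx /form (h1 i (ltn_ord i)).
    by rewrite -scalemxAl => h; rewrite mxE h mulr1.
  have := form_self_Im (v i 0) hA; rewrite e; case: (lam i 0) => a b /= ->.
  by [].
exists (adjm V), (fun i => Re (lam i 0)); rewrite /conjd adjmK; split=> //.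
rewrite -[LHS]mul1mx -VV' -mulmxA VA mulmxA; congr (_ *m diag_mx _ *m _).
by apply/rowP => i; rewrite !mxE -lR.
Qed.

Lemma posdef_diag n A : posdef n.+1 A -> exists (U : 'M[C]_n.+1) (d : 'I_n.+1 -> R),
  [/\ adjm U *m U = 1%:M, U *m adjm U = 1%:M, forall i, 0 < d i & toM n.+1 A = conjd U d].
Proof.
move=> [/toM_eq hA hp]; rewrite toMJ in hA.
have [U [d [u1 u2 e]]] := hermitian_diag hA.
exists U, d; split=> // i.
have [|_ /RltP //] := hp (RtoC (d i)) (fun k => xc (U (inord k) i)).
have uAi k : \sum_j toM n.+1 A k j * U j i = (d i)%:C * U k i.
  have := congr1 (fun M : 'M_n.+1 => (M *m U) k i) e.
  rewrite /conjd -mulmxA u1 mulmx1 /rdiag mul_mx_diag [LHS]mxE [RHS]mxE => ->.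
  by rewrite mxE mulrC.
split.
  apply: NNPP => ne; have : (adjm U *m U) i i = 0.
    rewrite mxE big1 // => k _; suff -> : U k i = 0 by rewrite mulr0.
    apply: NNPP => uk; apply: ne; exists k; split; first by apply/ssrnat.ltP.
    by move=> e0; apply: uk; rewrite -cx0 -e0 xcK inord_val.
  by rewrite u1 mxE eqxx => /eqP; rewrite oner_eq0.
move=> k /ssrnat.ltP kn; apply: cx_inj; rewrite cx_sum cxM xcK -[RHS](uAi (inord k)).
by apply: eq_bigr => j _; rewrite cxM xcK mxE inordK // inord_val.
Qed.

(** [posdef_diag] shows that a logarithm exists; the diagonalization returned is the one attached to
    the value that [epsilon] chose, so both matrices share it. *)
Lemma Mlog_diag n A : posdef n.+1 A -> exists (U : 'M[C]_n.+1) (d : 'I_n.+1 -> R),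
  [/\ adjm U *m U = 1%:M, U *m adjm U = 1%:M, forall i, 0 < d i, toM n.+1 A = conjd U d &
      toM n.+1 (Mlog n.+1 A) = conjd U (fun i => ln (d i))].
Proof.
move=> hA; have [U [d [u1 u2 d0 e]]] := posdef_diag hA.
have toU V : unitary n.+1 V <-> adjm (toM n.+1 V) *m toM n.+1 V = 1%:M /\ toM n.+1 V *m adjm (toM n.+1 V) = 1%:M.
  by rewrite /unitary !toM_eq !toMM toMJ toM1.
have ex : exists B, is_log n.+1 A B.
  exists (ofM (conjd U (fun i => ln (d i)))), (ofM U), (fun k => d (inord k)); split; last split; last split.
  - by apply/toU; rewrite ofMK.
  - by move=> k _; apply/RltP; apply: d0.
  - apply/toM_eq; rewrite toM_conjd ofMK e; congr (_ *m diag_mx _ *m _).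
    by apply/rowP => i; rewrite !mxE inord_val.
  - apply/toM_eq; rewrite (toM_conjd _ (fun k => ln (d (inord k)))) !ofMK; congr (_ *m diag_mx _ *m _).
    by apply/rowP => i; rewrite !mxE inord_val.
have [V [f [/toU[v1 v2] [f0 [/toM_eq e1 /toM_eq e2]]]]] := epsilon_spec (inhabits Mzero) (is_log n.+1 A) ex.
exists (toM n.+1 V), (fun i => f i); split=> //.
- by move=> i; apply/RltP/f0; apply/ssrnat.ltP.
- by rewrite e1 toM_conjd.
- by rewrite [Mlog _ _]/Mlog e2 (toM_conjd _ (fun k => ln (f k))).
Qed.

Lemma Minv_spec n A : posdef n.+1 A ->
  toM n.+1 A *m toM n.+1 (Minv n.+1 A) = 1%:M /\ toM n.+1 (Minv n.+1 A) *m toM n.+1 A = 1%:M.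
Proof.
move=> hA; have [U [d [u1 u2 d0 e]]] := posdef_diag hA.
have dd : rdiag d *m rdiag (fun i => (d i)^-1) = 1%:M.
  apply/matrixP => i j; rewrite /rdiag mul_mx_diag !mxE; case: eqP => [->|_]; last by rewrite mul0r.
  by rewrite !mulr1n -rmorphM /= mulfV // gt_eqF.
have AB : toM n.+1 A *m conjd U (fun i => (d i)^-1) = 1%:M.
  rewrite e /conjd -!mulmxA (mulmxA (adjm U)) u1 mul1mx (mulmxA (rdiag _)) dd mul1mx.
  by [].
have ex : exists B, Meq n.+1 (Mmul n.+1 A B) Mid /\ Meq n.+1 (Mmul n.+1 B A) Mid.
  exists (ofM (conjd U (fun i => (d i)^-1))); rewrite !toM_eq !toMM toM1 ofMK; split=> //.
  exact: mulmx1C.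
have := epsilon_spec (inhabits Mzero) _ ex.
by rewrite !toM_eq !toMM toM1.
Qed.

(** The power series [F] has derivative [1 / (1 - t)], so [F t + ln (1 - t)] is constant on [[0, x]]
    and vanishes at [0]. *)
Lemma ln_series (y : R) : 0 < y -> y <= 1 ->
  is_series (fun k => (k.+1%:R)^-1 * (1 - y) ^+ k.+1) (- ln y).
Proof.
move=> y0 y1; pose x := 1 - y.
have x0 : 0 <= x by rewrite subr_ge0.
have x1 : x < 1 by rewrite gtrBl.
have yE : y = Rminus 1 x by rewrite RminusE /x opprB addrC subrK.
pose a k : R := if k is k'.+1 then (k'.+1%:R)^-1 else 0.
pose F t := Series (fun k => a k * t ^+ k).
have a1 k : `|a k| <= 1.
  by case: k => [|k] /=; rewrite ?normr0 // ger0_norm ?natV_ge0 ?natV_le1.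
have hF t : `|t| < 1 -> is_series (fun k => a k * t ^+ k) (F t).
  move=> t1; apply: Series_correct; apply: (@ex_series_le R_AbsRing R_CompleteNormedModule _ (fun k => pow `|t| k)).
    move=> k; apply/RleP; rewrite RpowE /norm /= /abs /= RabsE normrM normrX.
    by rewrite ler_piMl // exprn_ge0.
  by exists (Rinv (Rminus 1 `|t|)); apply: is_series_geom; apply/RltP; rewrite RabsE normr_id.
have dF t : 0 <= t -> t < 1 -> is_derive F t (1 - t)^-1.
  move=> t0 t1; have tn : `|t| < 1 by rewrite ger0_norm.
  apply: (@pseries_derive a F 1 1 t _ ltr01) => //.
    by move=> k; rewrite expr1n mulr1.
  apply: (is_series_ext (fun k => pow t k)) => [k|].
    by rewrite RpowE /= mulfV ?mul1r // pnatr_eq0.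
  by have := is_series_geom t; rewrite RinvE RminusE; apply; apply/RltP; rewrite RabsE.
have F0 : F 0 = 0.
  rewrite /F (Series_ext _ (fun=> Rmult 0 0)) ?Series_scal_l ?Rmult_0_l //.
  by move=> [|k]; rewrite ?mul0r ?Rmult_0_l // expr0n mulr0.
have FE : F x = - ln y.
  have [xz|xp] := eqVneq x 0; first by rewrite yE xz F0 Rminus_0_r ln_1 oppr0.
  have xp' : 0 < x by rewrite lt_neqAle eq_sym xp.
  have := @eq_is_derive R_NormedModule (fun t => Rplus (F t) (ln (Rminus 1 t))) 0 x.
  rewrite F0 Rminus_0_r ln_1 => h; have {}h := h _ (elimT RltP xp').
  suff e : 0 = Rplus (F x) (ln (Rminus 1 x)).
    rewrite yE; by apply/eqP; rewrite -addr_eq0; apply/eqP; rewrite -[LHS]e.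
  rewrite -h ?Rplus_0_l // => t [/RleP t0 /RleP tx].
  have t1 := le_lt_trans tx x1.
  have n0 : 1 - t != 0 by rewrite subr_eq0 gt_eqF.
  have -> : @zero R_NormedModule = plus (1 - t)^-1 (Rmult (Rminus 0 1) (Rinv (Rminus 1 t))).
    by rewrite /zero /plus /= RinvE RmultE RplusE !RminusE sub0r mulN1r subrr.
  apply: is_derive_plus; first exact: dF.
  apply: (is_derive_comp ln (fun t => Rminus 1 t)).
    by apply/is_derive_Reals; apply: derivable_pt_lim_ln; apply/RltP; rewrite RminusE subr_gt0.
  apply: (is_derive_minus (fun=> R1)); first exact: is_derive_const.
  exact: is_derive_id.
have xn : `|x| < 1 by rewrite ger0_norm.
have := hF x xn; rewrite FE => h.
apply: (is_series_ext (fun k => a k.+1 * x ^+ k.+1)) => //.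
apply: (is_series_incr_1 (fun k => a k * x ^+ k)).
by rewrite /plus /= mul0r Rplus_0_r.
Qed.

Section Diagonal.
Variables (n : nat) (U : 'M[C]_n.+1).
Hypothesis UU : adjm U *m U = 1%:M.
Let UU' : U *m adjm U = 1%:M. Proof. exact: mulmx1C. Qed.

Lemma conjdX d k : conjd U d ^+ k.+1 = conjd U (fun i => d i ^+ k.+1).
Proof.
elim: k => [|k IH].
  by rewrite expr1; congr (_ *m diag_mx _ *m _); apply/rowP => i; rewrite !mxE.
rewrite exprS IH -mulmxE /conjd !mulmxA -(mulmxA (U *m _)) UU mulmx1.
congr (_ *m _); rewrite -mulmxA; congr (_ *m _); rewrite /rdiag mul_diag_mx.
apply/matrixP => i j; rewrite !mxE; case: (i == j); last by rewrite mulr0.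
by rewrite !mulr1n -rmorphM.
Qed.

Lemma conjd_affine d (K : R) : 1%:M - K^-1%:C *: conjd U d = conjd U (fun i => 1 - d i / K).
Proof.
rewrite -UU' /conjd -[X in _ = _ *m X]/(adjm U) scalemxAl scalemxAr.
rewrite -{1}[U]mulmx1 -mulmxBl -mulmxBr; congr (_ *m _ *m _).
apply/matrixP => i j; rewrite !mxE; case: (i == j); rewrite ?mulr0 ?subr0 //.
by rewrite !mulr1n rmorphB rmorph1 rmorphM mulrC.
Qed.

(** The logarithm series is applied to each [d i / K], which lies in [(0, 1]]. The scalar [ln K] is
    harmless, since commutators kill it in [lap_scalar_sub]. *)
Lemma Lg_conjd d (K : R) : 0 < K -> (forall i, 0 < d i) -> (forall i, d i <= K) ->
  Lg (1%:M - K^-1%:C *: conjd U d) = (ln K)%:C%:M - conjd U (fun i => ln (d i)).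
Proof.
move=> K0 d0 dK; apply/matrixP => i j; rewrite mxE; apply: csum_valE.
have -> : ((ln K)%:C%:M - conjd U (fun i => ln (d i))) i j =
    \sum_l (U i l * conjc (U j l)) * (- ln (d l / K)%R)%:C.
  rewrite mxE [X in _ + X]mxE conjd_entry.
  have -> : (ln K)%:C%:M i j = \sum_l (ln K)%:C * (U i l * conjc (U j l)).
    rewrite -mulr_sumr; have <- : (U *m adjm U) i j = \sum_l U i l * conjc (U j l).
      by rewrite mxE; apply: eq_bigr => l _; rewrite adjm_entry.
    by rewrite UU' !mxE mulr_natr.
  rewrite -sumrB; apply: eq_bigr => l _; rewrite -mulrBl mulrC -rmorphB; congr (_ * _%:C).
  have k0 : Rlt 0 (Rinv K) by apply: Rinv_0_lt_compat; apply/RltP.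
  have dl : Rlt 0 (d l) by apply/RltP.
  have Kp : Rlt 0 K by apply/RltP.
  by have := ln_mult _ _ dl k0; rewrite ln_Rinv // RplusE RoppE => ->; rewrite opprB.
apply: (csum_ext (u := fun k => \sum_l (U i l * conjc (U j l)) * ((k.+1%:R)^-1 * (1 - d l / K) ^+ k.+1)%:C)).
  move=> k; rewrite conjd_affine conjdX conjd_entry mulr_sumr; apply: eq_bigr => l _.
  rewrite rmorphM fmorphV rmorph_nat mulrC -mulrA; by [].
apply: csum_sum => l; apply: csumZ; apply/csumE; split.
  have dl : 0 < d l / K by exact: divr_gt0.
  have dl1 : d l / K <= 1 by rewrite ler_pdivrMr // mul1r.
  exact: ln_series.
rewrite [Im _]/=; apply/is_series_lim; apply: (is_lim_seq_ext (fun=> 0)) => [k|]; last exact: is_lim_seq_const.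
by rewrite big1.
Qed.

(* The maximal row sum in the basis that diagonalises [c s]: unlike the entry sum it is below
   [1] on [1 - c s / K]. *)
Definition rowmax (a : 'M[C]_n.+1) : R :=
  \big[Num.max/0]_i \sum_j nc ((adjm U *m a *m U) i j).

Lemma rowmax_ge a i : \sum_j nc ((adjm U *m a *m U) i j) <= rowmax a.
Proof. by rewrite /rowmax; apply: le_bigmax. Qed.

Lemma rowmax_le a B : 0 <= B -> (forall i, \sum_j nc ((adjm U *m a *m U) i j) <= B) -> rowmax a <= B.
Proof. by move=> B0 h; apply: bigmax_le. Qed.

Lemma rowmax_matnorm : exists K, matnorm rowmax K.
Proof.
(* A change of basis costs [en U * en (adjm U)] in either direction, and passing from row sums to
   the sum of all entries costs [n.+1]; one constant serves both comparisons. *)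
pose K := n.+1%:R * (en U * en (adjm U)) + 1; exists K.
have u0 : 0 <= en U * en (adjm U) by apply: mulr_ge0; exact: en_ge0.
have K1 : 1 <= K by rewrite lerDr mulr_ge0.
have K0 : 0 < K by apply: lt_le_trans K1.
have r0 a : 0 <= rowmax a.
  by apply: le_trans (rowmax_ge a 0); apply: sumr_ge0 => j _; exact: nc_ge0.
split=> //; split.
- move=> a b; apply: rowmax_le => [|i]; first exact: mulr_ge0.
  have -> : adjm U *m (a * b) *m U = (adjm U *m a *m U) *m (adjm U *m b *m U).
    by rewrite -mulmxE !mulmxA -(mulmxA _ U) UU' mulmx1.
  move: (adjm U *m a *m U) (rowmax_ge a i) (rowmax_ge b) => x hx hy.
  apply: (@le_trans _ _ (\sum_j \sum_k nc (x i k) * nc ((adjm U *m b *m U) k j))).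
    apply: ler_sum => j _; rewrite mxE; apply: (le_trans (nc_sum _ _ _)).
    by apply: ler_sum => k _; rewrite ncM.
  rewrite exchange_big; apply: (@le_trans _ _ (\sum_k nc (x i k) * rowmax b)).
    by apply: ler_sum => k _; rewrite -mulr_sumr ler_wpM2l ?nc_ge0.
  by rewrite -mulr_suml ler_wpM2r.
- move=> a b; apply: rowmax_le => [|i]; first exact: addr_ge0.
  apply: le_trans (lerD (rowmax_ge a i) (rowmax_ge b i)); rewrite -big_split.
  by apply: ler_sum => j _; rewrite mulmxDr mulmxDl mxE ncD.
- move=> c a; apply: rowmax_le => [|i]; first by rewrite mulr_ge0 ?nc_ge0.
  apply: le_trans (ler_wpM2l (nc_ge0 c) (rowmax_ge a i)); rewrite mulr_sumr.
  by apply: ler_sum => j _; rewrite -scalemxAr -scalemxAl mxE ncM.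
- move=> a.
  have -> : a = U *m (adjm U *m a *m U) *m adjm U.
    by rewrite !mulmxA UU' mul1mx -mulmxA UU' mulmx1.
  have -> : rowmax (U *m (adjm U *m a *m U) *m adjm U) = rowmax a.
    by rewrite !mulmxA UU' mul1mx -mulmxA UU' mulmx1.
  apply: (le_trans (enM _ _)); apply: (@le_trans _ _ (en U * (n.+1%:R * rowmax a) * en (adjm U))).
    apply: ler_wpM2r; first exact: en_ge0.
    apply: (le_trans (enM _ _)); apply: ler_wpM2l; first exact: en_ge0.
    apply: (@le_trans _ _ (\sum_(i < n.+1) rowmax a)).
      by apply: ler_sum => i _; exact: rowmax_ge.
    by rewrite sumr_const card_ord mulr_natl.
  have -> : en U * (n.+1%:R * rowmax a) * en (adjm U) = n.+1%:R * (en U * en (adjm U)) * rowmax a by ring.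
  by apply: ler_wpM2r => //; rewrite lerDl.
- move=> a; apply: rowmax_le => [|i]; first by apply: mulr_ge0; [exact: ltW|exact: en_ge0].
  apply: (@le_trans _ _ (en (adjm U *m a *m U))).
    rewrite /en [leRHS](bigD1 i) //= lerDl; apply: sumr_ge0 => k _; apply: sumr_ge0 => j _; exact: nc_ge0.
  apply: (le_trans (enM _ _)); apply: (@le_trans _ _ (en (adjm U) * en a * en U)).
    by apply: ler_wpM2r; [exact: en_ge0|exact: enM].
  have -> : en (adjm U) * en a * en U = (en U * en (adjm U)) * en a by ring.
  apply: ler_wpM2r; first exact: en_ge0.
  have : en U * en (adjm U) <= n.+1%:R * (en U * en (adjm U)) by rewrite ler_peMl // ler1n.
  by move=> h; apply: (le_trans h); rewrite lerDl.
Qed.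

Lemma rowmax_conjd d q : 0 <= q -> (forall i, 0 <= d i <= q) -> rowmax (conjd U d) <= q.
Proof.
move=> q0 hd; apply: rowmax_le => // i.
rewrite /conjd !mulmxA UU mul1mx -mulmxA UU mulmx1 (bigD1 i) //= big1 ?addr0 => [|j ji].
  by rewrite !mxE eqxx mulr1n ncR ger0_norm; case/andP: (hd i).
by rewrite !mxE eq_sym (negPf ji) mulr0n nc0.
Qed.
End Diagonal.

(** * Analyticity of the flow *)

Lemma within_near t0 f s l : Rderiv_within (Ici t0) f s l -> forall e, 0 < e ->
  near s (fun t => t0 <= t -> `|f t - f s| <= e).
Proof.
move=> h e e0; have [d [/RltP d0 hd]] := h 1 Rlt_0_1.
have l0 : 0 < `|l| + 1 by rewrite ltr_wpDl.
exists (Num.min d (e / (`|l| + 1))); first by rewrite lt_min d0 divr_gt0.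
move=> t; rewrite lt_min ltr_pdivlMr // => /andP[td te] t0t.
have [->|ts] := eqVneq t s; first by rewrite subrr normr0 ltW.
have := hd t (elimT RleP t0t) (elimN eqP ts).
rewrite RabsE => /(_ (elimT RltP td)) /RltP; rewrite RabsE RminusE RdivE !RminusE => h1.
have ts0 : t - s != 0 by rewrite subr_eq0.
have -> : f t - f s = ((f t - f s) / (t - s)) * (t - s) by rewrite mulfVK.
rewrite normrM; apply: ltW; apply: le_lt_trans te; rewrite mulrC ler_wpM2l //.
have := ler_normD ((f t - f s) / (t - s) - l) l; rewrite subrK => /le_trans; apply.
by rewrite addrC lerD2l ltW.
Qed.

(** Composing with [Num.max t0] freezes [f] before [t0] and turns one-sided continuity into the
    ordinary notion. *)
Lemma within_continuity t0 f t l : t0 <= t -> Rderiv_within (Ici t0) f t l ->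
  continuity_pt (fun x => f (Num.max t0 x)) t.
Proof.
move=> t0t h e /RltP e0.
have e2 : 0 < e / 2%:R by rewrite divr_gt0 // ltr0n.
have [d d0 hd] := within_near h e2.
exists d; split; first exact/RltP.
move=> x [_]; rewrite /dist /= /R_dist => /RltP; rewrite RabsE RminusE => xd.
apply/RltP; rewrite RabsE RminusE (max_r t0t).
have m : t0 <= Num.max t0 x by rewrite le_max lexx.
have xt : `|Num.max t0 x - t| < d.
  have [tx|xt] := leP t0 x; first exact: xd.
  apply: le_lt_trans xd; rewrite ler0_norm ?subr_le0 // ler0_norm ?subr_le0 ?(le_trans (ltW xt)) //.
  by rewrite lerN2 lerB // ltW.
by have := hd _ xt m; lra.
Qed.

Lemma within_is_derive t0 f t l : t0 < t -> Rderiv_within (Ici t0) f t l ->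
  is_derive (fun x => f (Num.max t0 x)) t l.
Proof.
move=> t0t h; apply/is_derive_Reals => e e0; have [d [/RltP d0 hd]] := h e e0.
have m0 : 0 < Num.min d (t - t0) by rewrite lt_min d0 subr_gt0.
exists (mkposreal _ (elimT RltP m0)) => u u0 /=; rewrite RabsE => /RltP.
rewrite lt_min RplusE => /andP[ud ut].
have tu : t0 <= t + u.
  by have := ler_norm (- u); rewrite normrN; lra.
rewrite (max_r (ltW t0t)) (max_r tu).
have tuE : Rminus (t + u) t = u by rewrite RminusE addrC addKr.
have := hd (t + u) (elimT RleP tu); rewrite tuE; apply.
  by move=> e1; apply: u0; have := congr1 (fun z => Rminus z t) e1; rewrite tuE RminusE subrr.
by apply/RltP; rewrite RabsE.
Qed.

Lemma en_linear n (Phi : {linear 'M[C]_n.+1 -> 'M[C]_n.+1}) :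
  exists2 B, 0 <= B & forall a, en (Phi a) <= B * en a.
Proof.
exists (\sum_i \sum_j en (Phi (delta_mx i j))).
  by apply: sumr_ge0 => i _; apply: sumr_ge0 => j _; exact: en_ge0.
move=> a; rewrite {1}[a]matrix_sum_delta linear_sum mulr_suml.
apply: (le_trans (en_sum _ _ _)); apply: ler_sum => i _.
rewrite linear_sum mulr_suml; apply: (le_trans (en_sum _ _ _)); apply: ler_sum => j _.
by rewrite linearZ enZ mulrC ler_wpM2l ?en_ge0 // en_entry.
Qed.

Lemma near_en m n (P : R -> Prop) (A : R -> 'M[C]_(m, n)) (B : 'M[C]_(m, n)) s :
  (forall i j e, 0 < e -> near s (fun t => P t -> nc (A t i j - B i j) <= e)) ->
  forall e, 0 < e -> near s (fun t => P t -> en (A t - B) <= e).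
Proof.
move=> h e e0; pose N : R := m%:R * n%:R + 1.
have N0 : 0 < N by rewrite ltr_wpDl // mulr_ge0 ?ler0n.
have eN : 0 < e / N by rewrite divr_gt0.
apply: near_imp (near_forall_fin (fun i => near_forall_fin (fun j => h i j _ eN))) => t ht Pt.
apply: le_trans (en_le (B := e / N) _) _ => [i j|].
  by rewrite mxE [X in _ + X]mxE; exact: ht.
by rewrite mulrCA ler_piMr ?(ltW e0) // ler_pdivrMr // mul1r lerDl.
Qed.

Lemma near_en_anmx m n (A : R -> 'M[C]_(m, n)) s : anmx s A ->
  forall e, 0 < e -> near s (fun t => en (A t - A s) <= e).
Proof.
move=> hA e e0; suff : near s (fun t => True -> en (A t - A s) <= e).
  by apply: near_imp => t; apply.
apply: near_en e0 => i j e1 e10; have [K K0 hK] := anat_lip (hA i j).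
have h1 : near s (fun t => `|t - s| < e1 / (K + 1)).
  by exists (e1 / (K + 1)) => //; rewrite divr_gt0 // ltr_wpDl // ltW.
apply: near_imp (near_and h1 hK) => t [h2 h3] _; apply: (le_trans h3).
have K1 : 0 < K + 1 by rewrite ltr_wpDl // ltW.
move: h2; rewrite ltr_pdivlMr // mulrC => /ltW; apply: le_trans.
by apply: ler_wpM2r; rewrite ?normr_ge0 // lerDl.
Qed.

Lemma lap_linear n (x y : 'M[C]_n) : linear (lap x y).
Proof.
by move=> k a b; rewrite /lap !cmxP [LHS]addrACA -scalerDr.
Qed.
HB.instance Definition _ n (x y : 'M[C]_n) :=
  GRing.isLinear.Build C 'M[C]_n 'M[C]_n *:%R (lap x y) (lap_linear x y).

(** Named so that the scaled Laplacian carries a linear structure and can serve as [Phi]. *)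
Definition slap n (x y : 'M[C]_n) (k : C) (a : 'M[C]_n) := k *: lap x y a.
Lemma slap_linear n (x y : 'M[C]_n) k : linear (slap x y k).
Proof. by move=> l a b; rewrite /slap linearP scalerDr !scalerA [k * l]mulrC. Qed.
HB.instance Definition _ n (x y : 'M[C]_n) k :=
  GRing.isLinear.Build C 'M[C]_n 'M[C]_n *:%R (slap x y k) (slap_linear x y k).

Lemma lap_scalar_sub n (x y a : 'M[C]_n) k : lap x y (k%:M - a) = - lap x y a.
Proof.
have E (z b : 'M[C]_n) : cmx z (- b) = - cmx z b.
  by rewrite /cmx mulmxN mulNmx -opprD.
have F (z : 'M[C]_n) : cmx z (k%:M - a) = - cmx z a.
  by rewrite /cmx mulmxBr mulmxBl scalar_mxC opprD addrACA subrr add0r -opprD.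
by rewrite /lap !F !E [RHS]opprD.
Qed.

Lemma conjd_trace n (U : 'M[C]_n.+1) d : adjm U *m U = 1%:M -> Re (\tr (conjd U d)) = \sum_i d i.
Proof.
move=> UU; rewrite mxtrace_mulC mulmxA UU mul1mx /mxtrace Csum_Re.
by apply: eq_bigr => i _; rewrite !mxE eqxx.
Qed.

Section Flow.
Variables (n : nat) (x y : Mat) (c : R -> Mat) (t0 : R).
Let X := toM n.+1 x.
Let Y := toM n.+1 y.
Let A t := toM n.+1 (c t).
Hypothesis hpos : forall t, Ici t0 t -> posdef n.+1 (c t).
Hypothesis hder : forall t, Ici t0 t ->
  Mderiv_within n.+1 (Ici t0) c t (Mopp (Lap n.+1 x y (Mlog n.+1 (c t)))).

Lemma flow_der (i j : 'I_n.+1) t : t0 <= t ->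
  Rderiv_within (Ici t0) (fun u => Re (A u i j)) t (- Re (lap X Y (toM n.+1 (Mlog n.+1 (c t))) i j)) /\
  Rderiv_within (Ici t0) (fun u => Im (A u i j)) t (- Im (lap X Y (toM n.+1 (Mlog n.+1 (c t))) i j)).
Proof.
move=> t0t; have [h1 h2] := hder (elimT RleP t0t) (elimT ssrnat.ltP (ltn_ord i)) (elimT ssrnat.ltP (ltn_ord j)).
rewrite -toM_lap mxE; split.
  by move=> e e0; have [d [d0 hd]] := h1 e e0; exists d; split=> // s ts st sd; rewrite !mxE; exact: hd.
by move=> e e0; have [d [d0 hd]] := h2 e e0; exists d; split=> // s ts st sd; rewrite !mxE; exact: hd.
Qed.

Lemma flow_cont s : t0 <= s -> forall e, 0 < e -> near s (fun t => t0 <= t -> en (A t - A s) <= e).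
Proof.
move=> t0s; apply: near_en => i j e e0; have e2 : 0 < e / 2%:R by rewrite divr_gt0 // ltr0n.
have [h1 h2] := flow_der i j t0s.
apply: near_imp (near_and (within_near h1 e2) (within_near h2 e2)) => t [g1 g2] t0t.
apply: (le_trans (nc_le _)); rewrite cReD cImD cReN cImN.
have := g1 t0t; have := g2 t0t; lra.
Qed.

Lemma flow_anat s : t0 <= s -> exists2 cs, anmx s cs & near s (fun t => t0 <= t -> A t = cs t).
Proof.
move=> t0s; have [U [d [u1 u2 d0 e]]] := posdef_diag (hpos (elimT RleP t0s)).
(* The trace at [s] plus [1]: by continuity [K] still bounds the trace, hence every eigenvalue, of
   [A t] for nearby [t]. *)
pose K := \sum_i d i + 1.
have dsum (f : 'I_n.+1 -> R) i : (forall i, 0 < f i) -> f i <= \sum_i f i.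
  by move=> f0; rewrite (bigD1 i) //= lerDl; apply: sumr_ge0 => j _; exact: ltW.
have K0 : 0 < K by rewrite ltr_wpDl //; apply: sumr_ge0 => i _; exact: ltW.
have dK i : d i <= K by apply: (le_trans (dsum _ i d0)); rewrite lerDl.
pose w1 t := 1%:M - K^-1%:C *: A (Num.max t0 t).
pose q0 := \big[Num.max/0]_i (1 - d i / K).
have q0_ge : 0 <= q0 by apply: bigmax_ge_id.
have q0_lt : q0 < 1.
  by apply: bigmax_lt => // i _; rewrite gtrBl divr_gt0.
have w1s : w1 s = conjd U (fun i => 1 - d i / K).
  by rewrite /w1 (max_r t0s) /A e (conjd_affine u1).
have nus : rowmax U (w1 s) <= q0.
  rewrite w1s; apply: (rowmax_conjd u1) => // i; rewrite subr_ge0 ler_pdivrMr // mul1r dK.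
  exact: (@le_bigmax _ _ _ 0 (fun i => 1 - d i / K) i).
have [Kn hnu] := rowmax_matnorm u1; have [Kn0 [_ hD _ _ hE']] := hnu.
(* For [w = 1 - c / K] the flow gives [w' = K^-1 * lap (log c)], and [log c] is [- Lg w] up to a
   scalar; hence the minus sign. *)
pose Phi : {linear 'M[C]_n.+1 -> 'M[C]_n.+1} := slap X Y (- K^-1)%:C.
have [B B0 hB] := en_linear Phi.
have hPhi a : rowmax U (Phi a) <= (Kn * B) * en a.
  by apply: (le_trans (hE' _)); rewrite -mulrA; apply: ler_wpM2l (hB a); exact: ltW.
have KB0 : 0 <= Kn * B by apply: mulr_ge0 => //; exact: ltW.
have [w2 [aw2 w2s dw2]] := ode_solution s hnu (le_lt_trans nus q0_lt) KB0 hPhi.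
pose q := (1 + q0) / 2%:R.
have q1 : q < 1 by rewrite /q; lra.
have dq : 0 < (q - q0) / Kn by apply: divr_gt0 => //; rewrite /q; lra.
have w1B t : t0 <= t -> w1 t - w1 s = K^-1%:C *: (A s - A t).
  by move=> t0t; rewrite /w1 (max_r t0t) (max_r t0s) opprB addrC addrA subrK scalerBr.
have nu_near (w : R -> 'M[C]_n.+1) t : w s = w1 s -> en (w t - w s) <= (q - q0) / Kn -> rowmax U (w t) <= q.
  move=> ws h; rewrite -[w t](subrK (w s)); apply: (le_trans (hD _ _)).
  have : rowmax U (w t - w s) <= q - q0.
    by apply: (le_trans (hE' _)); move: h; rewrite ler_pdivlMr // mulrC.
  by rewrite ws => h1; have := lerD h1 nus; rewrite subrK.
have n1 : near s (fun t => t0 <= t -> rowmax U (w1 t) <= q).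
  have dq' : 0 < ((q - q0) / Kn) * K by apply: mulr_gt0.
  apply: near_imp (flow_cont t0s dq') => t h t0t; apply: (nu_near w1) => //.
  rewrite w1B // enZ ncR ger0_norm ?invr_ge0 ?(ltW K0) // mulrC ler_pdivrMr //.
  rewrite (_ : A s - A t = (-1) *: (A t - A s)) ?enZ ?ncN ?nc1 ?mul1r ?h //.
  by rewrite scaleN1r opprB.
have n2 : near s (fun t => rowmax U (w2 t) <= q).
  by apply: near_imp (near_en_anmx aw2 dq) => t h; apply: nu_near.
have n3 : near s (fun t => t0 <= t -> Re (\tr (A t)) <= K).
  apply: near_imp (flow_cont t0s ltr01) => t h t0t.
  rewrite -[A t](subrK (A s)) linearD cReD addrC; apply: lerD.
    by rewrite /A e (conjd_trace _ u1).
  apply: le_trans (h t0t); apply: (le_trans (ler_norm _)); apply: (le_trans (nc_Re _)).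
  apply: (le_trans (nc_sum _ _ _)); apply: ler_sum => i _.
  rewrite (bigD1 i) //= lerDl; apply: sumr_ge0 => j _; exact: nc_ge0.
(* The diagonalization varies with [t] here, while the norm keeps the basis fixed at [s]; [Lg]
   itself refers to no basis. *)
have Lg_w1 t : t0 <= t -> Re (\tr (A t)) <= K -> Phi (Lg (w1 t)) = K^-1%:C *: lap X Y (toM n.+1 (Mlog n.+1 (c t))).
  move=> t0t tK; have [V [f [v1 v2 f0 e1 e2]]] := Mlog_diag (hpos (elimT RleP t0t)).
  have fK i : f i <= K.
    by apply: (le_trans (dsum _ i f0)); rewrite -(conjd_trace f v1) -e1.
  have PhiE a : Phi a = (- K^-1)%:C *: lap X Y a by [].
  rewrite PhiE /w1 (max_r t0t) /A e1 (Lg_conjd v1 K0 f0 fK) -e2 lap_scalar_sub.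
  by rewrite rmorphN scalerN scaleNr opprK.
have [dl dl0 hdl] := near_and n1 (near_and n2 (near_and n3 dw2)).
have RlinP (f : R -> R) (b : R) t l : is_derive f t (- l) ->
    is_derive (fun u => Rminus b (Rmult K^-1 (f u))) t (K^-1 * l).
  move=> h; have := is_derive_minus (fun=> b) _ _ _ _ (is_derive_const b t) (is_derive_scal f t K^-1 _ h).
  by rewrite /minus /plus /zero /opp /= Rplus_0_l RmultE mulrN RoppE opprK.
have ReW t i j : Re (w1 t i j) = Rminus (Re (1%:M i j)) (Rmult K^-1 (Re (A (Num.max t0 t) i j))).
  by rewrite /w1 mxE [X in _ + X]mxE [X in - X]mxE cReD cReN cReRM.
have ImW t i j : Im (w1 t i j) = Rminus (Im (1%:M i j)) (Rmult K^-1 (Im (A (Num.max t0 t) i j))).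
  by rewrite /w1 mxE [X in _ + X]mxE [X in - X]mxE cImD cImN cImRM.
have S1 : solves Phi t0 s dl w1.
  move=> i j; split=> t t0t td.
    have t0t' := ltW t0t; have [_ [_ [/(_ t0t') tK _]]] := hdl t td.
    have [h1 h2] := flow_der i j t0t'.
    rewrite (Lg_w1 t t0t' tK) mxE cReRM cImRM; split.
      apply: is_derive_ext (RlinP _ (Re (1%:M i j)) t _ (within_is_derive t0t h1)) => u.
      by rewrite ReW.
    apply: is_derive_ext (RlinP _ (Im (1%:M i j)) t _ (within_is_derive t0t h2)) => u.
    by rewrite ImW.
  have [h1 h2] := flow_der i j t0t.
  split.
    apply: (@continuity_pt_ext (fun u => Rminus (Re (1%:M i j)) (Rmult K^-1 (Re (A (Num.max t0 u) i j))))) => [u|].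
      by rewrite ReW.
    apply: continuity_pt_minus; first exact: continuity_pt_const.
    by apply: continuity_pt_mult; [exact: continuity_pt_const|exact: within_continuity h1].
  apply: (@continuity_pt_ext (fun u => Rminus (Im (1%:M i j)) (Rmult K^-1 (Im (A (Num.max t0 u) i j))))) => [u|].
    by rewrite ImW.
  apply: continuity_pt_minus; first exact: continuity_pt_const.
  by apply: continuity_pt_mult; [exact: continuity_pt_const|exact: within_continuity h2].
have S2 : solves Phi t0 s dl w2.
  move=> i j; split=> t t0t td; have [_ [_ [_ /(_ i j)[h1 h2]]]] := hdl t td => //.
  split; apply: derivable_continuous_pt.
    by exists (Re (Phi (Lg (w2 t)) i j)); apply/is_derive_Reals.
  by exists (Im (Phi (Lg (w2 t)) i j)); apply/is_derive_Reals.
have [|e1 e10 he1] := ode_unique hnu q1 KB0 hPhi t0s dl0 S1 S2 _ (esym w2s).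
  by move=> t t0t td; have [h1 [h2 _]] := hdl t td; split; [exact: h1|].
exists (fun t => K%:C *: (1%:M - w2 t)).
  by apply: anmxZ (anat_cst _ _) _; apply: anmxB aw2; exact: anmx_cst.
exists e1 => // t te t0t; rewrite -he1 // /w1 (max_r t0t) opprB addrC subrK.
by rewrite scalerA -rmorphM /= mulfV ?scale1r // gt_eqF.
Qed.
End Flow.

(** * The pencil [(lap, right multiplication by c)] *)

(** Vectorization turns the trace inner product into the standard one, so operators on matrices
    become the two matrices of a Hermitian pencil. *)
Lemma mxvec_dot m n (B W : 'M[C]_(m, n)) : (mxvec B *m adjm (mxvec W)) 0 0 = \tr (B *m adjm W).
Proof.
rewrite mxE (reindex _ (curry_mxvec_bij m n)) /= /mxtrace.
transitivity (\sum_p B p.1 p.2 * conjc (W p.1 p.2)).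
  by apply: eq_bigr => -[i j] _; rewrite adjm_entry !mxvecE.
rewrite -(pair_bigA _ (fun i j => B i j * conjc (W i j))) /=.
apply: eq_bigr => i _; rewrite mxE; apply: eq_bigr => j _.
by rewrite adjm_entry.
Qed.

Lemma form_lin_mx n (f : {linear 'M[C]_n.+1 -> 'M[C]_n.+1}) (v w : 'rV[C]_(n.+1 * n.+1)) :
  form (lin_mx f) v w = \tr (f (vec_mx v) *m adjm (vec_mx w)).
Proof. by rewrite -mxvec_dot /form -[in LHS](vec_mxK v) -[in LHS](vec_mxK w) mul_vec_lin. Qed.

Lemma form_delta N (M : 'M[C]_N) i j : form M (delta_mx 0 i) (delta_mx 0 j) = M i j.
Proof.
rewrite /form -rowE mxE (bigD1 j) //= big1 ?addr0 => [|k kj].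
  by rewrite adjm_entry !mxE !eqxx conjc_nat mulr1.
by rewrite adjm_entry !mxE (negPf kj) andbF conjc_nat mulr0.
Qed.

Lemma adjm_lin_mx n (f : {linear 'M[C]_n.+1 -> 'M[C]_n.+1}) :
  (forall a b, \tr (f a *m adjm b) = \tr (a *m adjm (f b))) -> adjm (lin_mx f) = lin_mx f.
Proof.
move=> hf; apply/matrixP => i j; rewrite adjm_entry -!form_delta !form_lin_mx hf.
set a := vec_mx _; set b := vec_mx _.
have -> : f b *m adjm a = adjm (a *m adjm (f b)) by rewrite adjmM adjmK.
by rewrite /mxtrace rmorph_sum; apply: eq_bigr => k _; rewrite adjm_entry.
Qed.

Lemma cmx_selfadjoint n (z a b : 'M[C]_n) : adjm z = z ->
  \tr (cmx z a *m adjm b) = \tr (a *m adjm (cmx z b)).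
Proof.
have trB (p q : 'M[C]_n) : \tr (p - q) = \tr p - \tr q by exact: linearB.
move=> hz; have -> : adjm (cmx z b) = adjm b *m z - z *m adjm b by rewrite adjmD adjmN !adjmM hz.
rewrite mulmxBl mulmxBr !trB.
by congr (_ - _); [rewrite -mulmxA mxtrace_mulC mulmxA|rewrite mulmxA].
Qed.

(** Each commutator with a Hermitian matrix is self-adjoint for the trace product, hence so is the
    sum of their squares. *)
Lemma lap_selfadjoint n (x y a b : 'M[C]_n) : adjm x = x -> adjm y = y ->
  \tr (lap x y a *m adjm b) = \tr (a *m adjm (lap x y b)).
Proof.
move=> hx hy; rewrite /lap adjmD mulmxDl mulmxDr !mxtraceD.
rewrite (cmx_selfadjoint (cmx y a) b hy) (cmx_selfadjoint a (cmx y b) hy).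
by rewrite (cmx_selfadjoint (cmx x a) b hx) (cmx_selfadjoint a (cmx x b) hx).
Qed.

Lemma anmx_lin_mulmxr s n (B : R -> 'M[C]_n.+1) : anmx s B ->
  anmx s (fun t => lin_mx (mulmxr (B t)) : 'M[C]_(n.+1 * n.+1)).
Proof.
move=> hB i j; case/mxvec_indexP: j => a b.
apply: (@anat_eq _ (fun t => ((vec_mx (delta_mx 0 i) : 'M[C]_n.+1) *m B t) a b)) => [t|].
  by rewrite /lin_mx [RHS]mxE /= mxvecE.
exact: (anmxM (anmx_cst _ _) hB).
Qed.

Lemma form_sum N (M : 'M[C]_N) u w : form M u w = \sum_i \sum_j u 0 i * M i j * conjc (w 0 j).
Proof.
rewrite /form mxE exchange_big; apply: eq_bigr => j _.
by rewrite mxE mulr_suml adjm_entry.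
Qed.

Lemma form_bound N (E : 'M[C]_N) u : nc (form E u u) <= en E * \sum_i nc (u 0 i) ^+ 2.
Proof.
set S := \sum_i _; have S0 i : nc (u 0 i) ^+ 2 <= S.
  by rewrite /S (bigD1 i) //= lerDl; apply: sumr_ge0 => j _; exact: exprn_ge0 (nc_ge0 _).
rewrite form_sum; apply: (le_trans (nc_sum _ _ _)); rewrite /en mulr_suml; apply: ler_sum => i _.
apply: (le_trans (nc_sum _ _ _)); rewrite mulr_suml; apply: ler_sum => j _.
rewrite !ncM ncJ mulrAC mulrC; apply: ler_wpM2l; first exact: nc_ge0.
have := S0 i; have := S0 j; have := sqr_ge0 (nc (u 0 i) - nc (u 0 j)).
rewrite sqrrB; nra.
Qed.

Lemma form_conjd n (U : 'M[C]_n.+1) d u : form (conjd U d) u u = \sum_i (d i)%:C * (nc ((u *m U) 0 i) ^+ 2)%:C.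
Proof.
rewrite /form /conjd !mulmxA -mulmxA -adjmM mxE; apply: eq_bigr => i _.
rewrite adjm_entry /rdiag mul_mx_diag !mxE mulrAC mulrC; congr (_ * _).
by rewrite nc_sqr; case: (\sum_j _) => a b; simpc; congr (_ +i* _); ring.
Qed.

(** At [s] the least eigenvalue, capped at [1], bounds the form from below; a perturbation with
    entry sum at most half of that bound costs at most half of it. *)
Lemma posdef_near n (U : 'M[C]_n.+1) d (B : R -> 'M[C]_n.+1) s : adjm U *m U = 1%:M ->
  (forall i, 0 < d i) -> anmx s B -> B s = conjd U d ->
  exists2 kap, 0 < kap & near s (fun t => forall u : 'rV_n.+1,
    kap * (\sum_i nc (u 0 i) ^+ 2) <= Re (form (B t) u u)).
Proof.
move=> UU d0 hB Bs.
pose k := \big[Num.min/1]_i d i.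
have k0 : 0 < k by apply: lt_bigmin.
have kd i : k <= d i by apply: bigmin_le_cond.
exists (k / 2%:R); first by rewrite divr_gt0 // ltr0n.
have k2 : 0 < k / 2%:R by rewrite divr_gt0 // ltr0n.
apply: near_imp (near_en_anmx hB k2) => t ht u.
set S := \sum_i _; have S0 : 0 <= S by apply: sumr_ge0 => i _; exact: exprn_ge0 (nc_ge0 _).
have h1 : k * S <= Re (form (B s) u u).
  have UU' : U *m adjm U = 1%:M by apply: mulmx1C.
  have -> : S = \sum_i nc ((u *m U) 0 i) ^+ 2.
    have h : form 1%:M u u = form 1%:M (u *m U) (u *m U).
      by rewrite /form !mulmx1 adjmM mulmxA -[u *m U *m _]mulmxA UU' mulmx1.
    have E (v : 'rV[C]_n.+1) : Re (form 1%:M v v) = \sum_i nc (v 0 i) ^+ 2.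
      rewrite /form mulmx1 mxE Csum_Re; apply: eq_bigr => i _; rewrite adjm_entry cReM nc_sqr.
      by case: (v 0 i) => a b /=; rewrite mulrN opprK !expr2.
    by rewrite /S -!E h.
  rewrite Bs form_conjd Csum_Re mulr_sumr; apply: ler_sum => i _.
  by rewrite cReRM /= ler_wpM2r // exprn_ge0 // nc_ge0.
have -> : form (B t) u u = form (B s) u u + form (B t - B s) u u.
  by rewrite /form mulmxBr mulmxBl [X in _ + X]mxE [X in _ + (_ + X)]mxE addrC subrK.
rewrite cReD.
have h2 := le_trans (nc_Re _) (form_bound (B t - B s) u).
have h3 : en (B t - B s) * S <= k / 2%:R * S by apply: ler_wpM2r.
have := ler_norm (- Re (form (B t - B s) u u)); rewrite normrN.
move: h2; rewrite -/S; lra.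
Qed.

Lemma opc_gt e : opc (fun t => e < t).
Proof.
split=> [s hs|a b t ea _ at_ _]; last exact: lt_le_trans at_.
exists (s - e) => [|t ts]; first by rewrite subr_gt0.
by have := ler_norm (s - t); rewrite distrC; lra.
Qed.

(* Before [t0] the metric is continued by the Hermitian part of its power series at [t0]. *)
Lemma flow_extension n (x y : Mat) (c : R -> Mat) (t0 : R) :
  (forall t, Ici t0 t -> posdef n.+1 (c t)) ->
  (forall t, Ici t0 t -> Mderiv_within n.+1 (Ici t0) c t (Mopp (Lap n.+1 x y (Mlog n.+1 (c t))))) ->
  exists (D : R -> Prop) (B : R -> 'M[C]_n.+1), opc D /\ (forall t, t0 <= t -> D t) /\
   [/\ anm D B, forall t, D t -> adjm (B t) = B t, uposdef D B &
       forall t, t0 <= t -> B t = toM n.+1 (c t)].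
Proof.
move=> hpos hder.
have hA t : t0 <= t -> adjm (toM n.+1 (c t)) = toM n.+1 (c t).
  by move=> /RleP /hpos [/toM_eq]; rewrite toMJ.
have loc s : t0 <= s -> exists hs, [/\ anmx s hs, forall t, adjm (hs t) = hs t,
    near s (fun t => t0 <= t -> toM n.+1 (c t) = hs t) &
    exists2 kap, 0 < kap & near s (fun t => forall u : 'rV_n.+1, kap * (\sum_i nc (u 0 i) ^+ 2) <= Re (form (hs t) u u))].
  move=> t0s; have [cs acs ecs] := flow_anat hpos hder t0s.
  pose hs t := (2%:R^-1 : C) *: (cs t + adjm (cs t)).
  have ahs : anmx s hs by exact: (@anmxZ s _ _ (fun=> 2%:R^-1) _ (anat_cst s _) (anmxD acs (anmx_adjm acs))).
  have ehs : near s (fun t => t0 <= t -> toM n.+1 (c t) = hs t).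
    apply: near_imp ecs => t e t0t; rewrite /hs -(e t0t) (hA _ t0t).
    have -> (m : 'M[C]_n.+1) : m + m = (2%:R : C) *: m by rewrite scaler_nat mulr2n.
    by rewrite scalerA mulVf ?scale1r // pnatr_eq0.
  exists hs; split=> //.
    by move=> t; rewrite /hs adjmZ adjmD adjmK addrC; congr (_ *: _); rewrite fmorphV rmorph_nat.
  have [U [d [u1 u2 d0 e]]] := posdef_diag (hpos s (elimT RleP t0s)).
  by apply: posdef_near u1 d0 ahs _; rewrite -e; symmetry; exact: (near_self ehs).
have [h0 [a0 adj0 e0 [k0 k0p pos0]]] := loc t0 (lexx t0).
(* On this ball the series at [t0] agrees with the flow for [t >= t0], stays uniformly positive and
   is analytic at every point. *)
have [eps eps0 heps] := near_and e0 (near_and pos0 (near_forall_fin (fun i => near_forall_fin (fun j => anat_recenter (a0 i j))))).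
pose D t := t0 - eps < t.
pose B t := if t < t0 then h0 t else toM n.+1 (c t).
have Bh t : `|t - t0| < eps -> B t = h0 t.
  by move=> /heps[h _]; rewrite /B; case: ltP => // t0t; exact: h.
have Bc t : t0 <= t -> B t = toM n.+1 (c t) by rewrite /B ltNge => ->.
have near_t0 s : D s -> s <= t0 -> `|s - t0| < eps.
  by rewrite /D => Ds st; rewrite ler0_norm ?subr_le0 //; lra.
have Bnear s : D s -> exists hs, [/\ anmx s hs, near s (fun t => B t = hs t) &
    exists2 kap, 0 < kap & near s (fun t => forall u : 'rV_n.+1, kap * (\sum_i nc (u 0 i) ^+ 2) <= Re (form (hs t) u u))].
  move=> Ds; have [st|ts] := leP s t0.
    have sn := near_t0 s Ds st; have [_ [_ an0]] := heps s sn.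
    have nb : near s (fun t => `|t - t0| < eps) by apply: (opc_ball t0 eps).1.
    exists h0; split=> //; first by apply: near_imp nb => t; exact: Bh.
    by exists k0 => //; apply: near_imp nb => t /heps [_ []].
  have [hs [as_ _ es ps]] := loc s (ltW ts); exists hs; split=> //.
  have g : near s (fun t => t0 < t) by apply: (opc_gt t0).1.
  by apply: near_imp (near_and es g) => t [h g']; rewrite Bc ?h // ltW.
exists D, B; split; first exact: opc_gt.
split; first by move=> t t0t; rewrite /D; lra.
split=> //.
- move=> s /Bnear[hs [a e _]]; apply: anmx_ext a; apply: near_imp e => t; exact: esym.
- move=> t _; rewrite /B; case: ltP => // t0t; exact: hA.
- move=> s /Bnear[hs [_ e [k kp p]]]; exists k => //.
  by apply: near_imp (near_and e p) => t [->].
Qed.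

Lemma anat_analytic D f : (forall t, D t -> anat t f) -> Canalytic_on D (fun t => xc (f t)).
Proof.
move=> hf; split=> t /hf[r r0 [a [A [_ ha]]]].
  exists (fun k => Re (a k)), r; split=> [|s _ sr]; first exact/RltP.
  have {}sr : `|s - t| < r by have /RltP := sr; rewrite RabsE.
  have tE : t + (s - t) = s by rewrite addrC subrK.
  have := ha (s - t) sr; rewrite tE => /csumE[h _].
  apply/is_series_Reals; apply: is_series_ext h => k.
  by rewrite -rmorphXn mulrC cReRM mulrC RpowE.
exists (fun k => Im (a k)), r; split=> [|s _ sr]; first exact/RltP.
have {}sr : `|s - t| < r by have /RltP := sr; rewrite RabsE.
have tE : t + (s - t) = s by rewrite addrC subrK.
  have := ha (s - t) sr; rewrite tE => /csumE[_ h].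
apply/is_series_Reals; apply: is_series_ext h => k.
by rewrite -rmorphXn mulrC cImRM mulrC RpowE.
Qed.

Lemma ipc_trace n c a b :
  cx (ipc n c a b) = \tr (toM n c *m (adjm (toM n a) *m toM n b)).
Proof. by rewrite /ipc toM_tr !toMM toMJ. Qed.

(** Clearing the inverse of [c] gives the pencil form, in which both sides are self-adjoint for the
    plain trace product. *)
Lemma LB_eigen n x y c a lam : posdef n.+1 c ->
  Meq n.+1 (LB n.+1 x y c a) (Mscal lam a) <->
  lap (toM n.+1 x) (toM n.+1 y) (toM n.+1 a) = cx lam *: (toM n.+1 a *m toM n.+1 c).
Proof.
move=> hc; have [h1 h2] := Minv_spec hc.
rewrite toM_eq /LB toMM toMZ toM_lap; split=> [e|->].
  by rewrite -[LHS]mulmx1 -h2 mulmxA e scalemxAl.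
by rewrite -scalemxAl -mulmxA h1 mulmx1.
Qed.

Lemma trace_form_rows n (B V : 'M[C]_n) : \tr (V *m B *m adjm V) = \sum_i form B (row i V) (row i V).
Proof.
apply: eq_bigr => i _; rewrite /form -row_mul mxE [RHS]mxE; apply: eq_bigr => j _.
by rewrite !adjm_entry !mxE.
Qed.

Lemma sum_sqr_vec m n (u : 'rV[C]_(m * n)) :
  \sum_k nc (u 0 k) ^+ 2 = \sum_i \sum_j nc (row i (vec_mx u) 0 j) ^+ 2.
Proof.
rewrite (reindex _ (curry_mxvec_bij m n)) /= (pair_bigA _ (fun i j => nc (row i (vec_mx u) 0 j) ^+ 2)) /=.
by apply: eq_bigr => -[i j] _; rewrite !mxE.
Qed.

Lemma uposdef_lin_mulmxr D n (B : R -> 'M[C]_n.+1) : uposdef D B ->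
  uposdef D (fun t => lin_mx (mulmxr (B t)) : 'M[C]_(n.+1 * n.+1)).
Proof.
move=> uB s Ds; have [k k0 hk] := uB s Ds; exists k => //; apply: near_imp hk => t hk u.
rewrite form_lin_mx /= trace_form_rows Csum_Re sum_sqr_vec mulr_sumr.
by apply: ler_sum => i _; exact: hk.
Qed.

Lemma flow_eigensystem n (x y : Mat) (c : R -> Mat) (t0 : R) :
  hermitian n.+1 x -> hermitian n.+1 y ->
  (forall t, Ici t0 t -> posdef n.+1 (c t)) ->
  (forall t, Ici t0 t -> Mderiv_within n.+1 (Ici t0) c t (Mopp (Lap n.+1 x y (Mlog n.+1 (c t))))) ->
  exists (lam : nat -> R -> Cx) (a : nat -> R -> Mat),
     (forall k, (k < n.+1 * n.+1)%coq_nat ->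
        Canalytic_on (Ici t0) (lam k) /\ Manalytic_on n.+1 (Ici t0) (a k)) /\
     (forall t, Ici t0 t ->
        (forall k, (k < n.+1 * n.+1)%coq_nat ->
           Meq n.+1 (LB n.+1 x y (c t) (a k t)) (Mscal (lam k t) (a k t))) /\
        (forall k l, (k < n.+1 * n.+1)%coq_nat -> (l < n.+1 * n.+1)%coq_nat ->
           ipc n.+1 (c t) (a k t) (a l t) = if Nat.eqb k l then Cx1 else Cx0)).
Proof.
move=> /toM_eq hx /toM_eq hy hpos hder; rewrite !toMJ in hx hy.
have [D [B [oD [Dt [aB hB uB eB]]]]] := flow_extension hpos hder.
pose X := toM n.+1 x; pose Y := toM n.+1 y.
pose L : 'M[C]_(n.+1 * n.+1) := lin_mx (lap X Y).
pose M t : 'M[C]_(n.+1 * n.+1) := lin_mx (mulmxr (B t)).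
have hL : adjm L = L by apply: adjm_lin_mx => a b; exact: lap_selfadjoint.
have aM : anm D M by move=> s Ds; apply: anmx_lin_mulmxr; exact: aB.
have hM t : D t -> adjm (M t) = M t.
  by move=> Dt'; apply: adjm_lin_mx => a b /=; rewrite adjmM (hB t Dt') mulmxA.
have [lam [v [al av hv]]] := an_pencil oD (Dt t0 (lexx t0)) hL aM hM (uposdef_lin_mulmxr uB).
have DI t : Ici t0 t -> D t by move=> /RleP; exact: Dt.
exists (fun k t => xc (lam k t)), (fun k t => ofM (vec_mx (v k t))); split.
  move=> k /ssrnat.ltP kn; split.
    by apply: anat_analytic => t /DI; exact: al.
  move=> i j _ _; apply: anat_analytic => t /DI Dt'.
  apply: anat_eq (av k kn t Dt' 0 (mxvec_index (inord i) (inord j))) => s.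
  by rewrite mxE.
move=> t t0t; have [e1 e2] := hv t (DI t t0t); have Bt := eB t (introT RleP t0t); split.
  move=> k /ssrnat.ltP kn; apply/(LB_eigen _ _ _ _ (hpos t t0t)); rewrite ofMK xcK -Bt.
  have := congr1 vec_mx (e1 k kn); rewrite linearZ /= -{1 2}(vec_mxK (v k t)) !mul_vec_lin !mxvecK.
  exact.
(* [ipc] is conjugate-linear in its first argument and [form] in its second, so [k] and [l] change
   places. *)
move=> k l /ssrnat.ltP kn /ssrnat.ltP ln; apply: cx_inj; rewrite ipc_trace !ofMK -Bt mulmxA mxtrace_mulC mulmxA.
have := e2 l k ln kn; rewrite form_lin_mx /= => ->.
by rewrite eq_sym; case: (Nat.eqb_spec k l) => [->|/eqP/negPf->]; rewrite ?eqxx.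
Qed.

(** * The derivative of an eigenvalue *)

Definition wlim (t0 t : R) (F : R -> C) (l : C) := forall e, 0 < e ->
  near t (fun s => t0 <= s -> s != t -> nc (F s - l) <= e).

Section WithinLimits.
Variables t0 t : R.

Lemma wlim_ext F G l : (forall s, t0 <= s -> s != t -> F s = G s) -> wlim t0 t F l -> wlim t0 t G l.
Proof.
move=> FG h e e0; apply: near_imp (h e e0) => s hs t0s st.
by rewrite -FG //; exact: hs.
Qed.

Lemma wlim_cst l : wlim t0 t (fun=> l) l.
Proof. by move=> e e0; apply: near_all => s _ _; rewrite subrr nc0 ltW. Qed.

Lemma wlimD F G l m : wlim t0 t F l -> wlim t0 t G m -> wlim t0 t (fun s => F s + G s) (l + m).
Proof.
move=> hF hG e e0; have e2 : 0 < e / 2%:R by rewrite divr_gt0 // ltr0n.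
apply: near_imp (near_and (hF _ e2) (hG _ e2)) => s [h1 h2] t0s st.
rewrite opprD addrACA; apply: (le_trans (ncD _ _)).
have := h1 t0s st; have := h2 t0s st; lra.
Qed.

Lemma wlimM F G l m : wlim t0 t F l -> wlim t0 t G m -> wlim t0 t (fun s => F s * G s) (l * m).
Proof.
move=> hF hG e e0; pose D := nc l + nc m + 1.
have D0 : 0 < D by rewrite ltr_wpDl // addr_ge0 // nc_ge0.
pose d := Num.min 1 (e / D); have d0 : 0 < d by rewrite lt_min ltr01 divr_gt0.
have d1 : d <= 1 by rewrite ge_min lexx.
have dD : d * D <= e by rewrite -ler_pdivlMr // ge_min lexx orbT.
apply: near_imp (near_and (hF _ d0) (hG _ d0)) => s [h1 h2] t0s st.
have {}h1 := h1 t0s st; have {}h2 := h2 t0s st.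
have -> : F s * G s - l * m = (F s - l) * (G s - m) + (m * (F s - l) + l * (G s - m)) by ring.
apply: (le_trans (ncD _ _)); apply: le_trans dD; rewrite /D.
have -> : d * (nc l + nc m + 1) = 1 * d + (nc m * d + nc l * d) by ring.
apply: lerD.
  by rewrite ncM; apply: ler_pM; rewrite ?nc_ge0 // (le_trans h1).
apply: (le_trans (ncD _ _)); rewrite !ncM; apply: lerD; apply: ler_wpM2l => //; exact: nc_ge0.
Qed.

Lemma wlim_sum (I : finType) (F : I -> R -> C) l : (forall i, wlim t0 t (F i) (l i)) ->
  wlim t0 t (fun s => \sum_i F i s) (\sum_i l i).
Proof.
move=> h; elim: (index_enum I) => [|i r IH].
  by rewrite big_nil; apply: wlim_ext (wlim_cst 0) => s _ _; rewrite big_nil.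
by rewrite big_cons; apply: wlim_ext (wlimD (h i) IH) => s _ _; rewrite big_cons.
Qed.

(** With [d <= 1/2] the bound [|F| <= |l| + d + |F| * d] keeps [F] bounded, and [F - l] is
    [(F * G - l) - F * (G - 1)]. *)
Lemma wlim_quot F G l : wlim t0 t (fun s => F s * G s) l -> wlim t0 t G 1 -> wlim t0 t F l.
Proof.
move=> hFG hG e e0; pose D := nc l + 2%:R.
have D0 : 0 < D by rewrite ltr_wpDl ?nc_ge0 // ltr0n.
have h2 : (0 : R) < 2%:R^-1 by rewrite invr_gt0 ltr0n.
pose d := Num.min 2%:R^-1 (e / (2%:R * D)).
have d0 : 0 < d by rewrite lt_min h2 divr_gt0 // mulr_gt0 // ltr0n.
have d1 : d <= 2%:R^-1 by rewrite ge_min lexx.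
have dD : d * (2%:R * D) <= e by rewrite -ler_pdivlMr ?mulr_gt0 ?ltr0n // ge_min lexx orbT.
apply: near_imp (near_and (hFG _ d0) (hG _ d0)) => s [g1 g2] t0s st.
have {}g1 := g1 t0s st; have {}g2 := g2 t0s st.
have a1 : nc (F s) <= nc l + d + nc (F s) * d.
  have -> : F s = l + (F s * G s - l) - F s * (G s - 1) by ring.
  apply: (le_trans (ncB _ _)); apply: lerD.
    by apply: (le_trans (ncD _ _)); rewrite lerD2l.
  have -> : l + (F s * G s - l) - F s * (G s - 1) = F s by ring.
  by rewrite ncM ler_wpM2l ?nc_ge0.
have -> : F s - l = (F s * G s - l) - F s * (G s - 1) by ring.
apply: (le_trans (ncB _ _)); apply: (@le_trans _ _ (d + nc (F s) * d)).
  by apply: lerD => //; rewrite ncM ler_wpM2l ?nc_ge0.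
have p := nc_ge0 (F s); have pl := nc_ge0 l.
have a2 : nc (F s) * d <= nc (F s) * 2%:R^-1 by rewrite ler_wpM2l.
move: dD; rewrite /D; nra.
Qed.

Definition wlimx m n (A : R -> 'M[C]_(m, n)) (L : 'M[C]_(m, n)) :=
  forall i j, wlim t0 t (fun s => A s i j) (L i j).

Lemma wlimxM m n p (A : R -> 'M[C]_(m, n)) (B : R -> 'M[C]_(n, p)) K L :
  wlimx A K -> wlimx B L -> wlimx (fun s => A s *m B s) (K *m L).
Proof.
move=> hA hB i j; rewrite mxE.
apply: (@wlim_ext (fun s => \sum_k A s i k * B s k j)) => [s _ _|]; first by rewrite mxE.
by apply: wlim_sum => k; apply: wlimM.
Qed.

Lemma wlimx_cst m n (A : 'M[C]_(m, n)) : wlimx (fun=> A) A.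
Proof. by move=> i j; apply: wlim_cst. Qed.

Lemma wlim_tr n (A : R -> 'M[C]_n) L : wlimx A L -> wlim t0 t (fun s => \tr (A s)) (\tr L).
Proof. by move=> h; apply: wlim_sum => i; apply: h. Qed.

Lemma Cderiv_wlim f l : Cderiv_within (Ici t0) f t l <->
  wlim t0 t (fun s => (s - t)^-1%:C * (cx (f s) - cx (f t))) (cx l).
Proof.
have E s : Re ((s - t)^-1%:C * (cx (f s) - cx (f t)) - cx l) =
    Rminus (Rdiv (Rminus (fst (f s)) (fst (f t))) (Rminus s t)) (fst l).
  by rewrite cReD cReN cReRM cReD cReN RminusE RdivE !RminusE mulrC.
have E' s : Im ((s - t)^-1%:C * (cx (f s) - cx (f t)) - cx l) =
    Rminus (Rdiv (Rminus (snd (f s)) (snd (f t))) (Rminus s t)) (snd l).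
  by rewrite cImD cImN cImRM cImD cImN RminusE RdivE !RminusE mulrC.
split=> [[h1 h2] e e0|h].
  have e2 : 0 < e / 2%:R by rewrite divr_gt0 // ltr0n.
  have [d1 [/RltP d10 hd1]] := h1 _ (elimT RltP e2).
  have [d2 [/RltP d20 hd2]] := h2 _ (elimT RltP e2).
  exists (Num.min d1 d2); first by rewrite lt_min d10.
  move=> s; rewrite lt_min => /andP[s1 s2] /RleP t0s /eqP st.
  apply: (le_trans (nc_le _)); rewrite E E'.
  have := hd1 s t0s st; rewrite RabsE => /(_ (elimT RltP s1)) /RltP; rewrite RabsE.
  have := hd2 s t0s st; rewrite RabsE => /(_ (elimT RltP s2)) /RltP; rewrite RabsE.
  lra.
split=> e /RltP e0.
  have e2 : 0 < e / 2%:R by rewrite divr_gt0 // ltr0n.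
  have [d d0 hd] := h _ e2; exists d; split=> [|s /RleP t0s /eqP st /RltP]; first exact/RltP.
  rewrite RabsE => sd; apply/RltP; rewrite RabsE -E.
  by apply: le_lt_trans (nc_Re _) _; have := hd s sd t0s st; lra.
have e2 : 0 < e / 2%:R by rewrite divr_gt0 // ltr0n.
have [d d0 hd] := h _ e2; exists d; split=> [|s /RleP t0s /eqP st /RltP]; first exact/RltP.
rewrite RabsE => sd; apply/RltP; rewrite RabsE -E'.
by apply: le_lt_trans (nc_Im _) _; have := hd s sd t0s st; lra.
Qed.

Lemma Ranalytic_near f : Ranalytic_on (Ici t0) f -> t0 <= t -> forall e, 0 < e ->
  near t (fun s => t0 <= s -> `|f s - f t| <= e).
Proof.
move=> hf t0t e e0; have [a [r [/RltP r0 h]]] := hf t (elimT RleP t0t).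
have hs s : t0 <= s -> `|s - t| < r -> is_series (fun k => Rmult (a k) (pow (Rminus s t) k)) (f s).
  by move=> /RleP t0s sr; apply/is_series_Reals; apply: h => //; apply/RltP; rewrite RabsE.
have PE s : t0 <= s -> `|s - t| < r -> PSeries a (Rminus s t) = f s.
  by move=> t0s sr; apply: is_series_unique; exact: hs.
have r2 : 0 < r / 2%:R by rewrite divr_gt0 // ltr0n.
(* Convergence is known only on the half-line; [t + r / 2] lies there even when [t = t0], and
   convergence at that point forces a positive radius. *)
have cv : Rbar_lt (Finite (Rabs 0)) (CV_radius a).
  rewrite Rabs_R0; apply: Rbar_not_le_lt => cv.
  have sE : Rminus (t + r / 2%:R) t = r / 2%:R by rewrite RminusE addrC addKr.
  apply: (CV_disk_outside a (r / 2%:R)).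
    by apply: Rbar_le_lt_trans cv _; apply/RltP; rewrite RabsE gtr0_norm.
  apply: ex_series_lim_0; exists (f (t + r / 2%:R)).
  have := hs (t + r / 2%:R); rewrite sE; apply.
    by rewrite (le_trans t0t) // lerDl ltW.
  by rewrite addrC addKr gtr0_norm //; lra.
have ct := PSeries_continuity a 0 cv.
have [d [/RltP d0 hd]] := ct e (elimT RltP e0).
exists (Num.min d r); first by rewrite lt_min d0.
move=> s; rewrite lt_min => /andP[sd sr] t0s.
have [->|st] := eqVneq s t; first by rewrite subrr normr0 ltW.
have tt : Rminus t t = 0 by rewrite RminusE subrr.
rewrite -(PE s t0s sr) -(PE t t0t) ?subrr ?normr0 // tt.
have := hd (Rminus s t); rewrite /D_x /no_cond /dist /= /R_dist => /(_ _)/RltP; rewrite !RabsE => hh.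
apply: ltW; apply: hh; split.
  by split=> // /esym/eqP; rewrite RminusE subr_eq0 (negPf st).
by apply/RltP; rewrite !RminusE subr0.
Qed.

Lemma Canalytic_wlim f : Canalytic_on (Ici t0) f -> t0 <= t ->
  wlim t0 t (fun s => cx (f s)) (cx (f t)).
Proof.
move=> [h1 h2] t0t e e0; have e2 : 0 < e / 2%:R by rewrite divr_gt0 // ltr0n.
apply: near_imp (near_and (Ranalytic_near h1 t0t e2) (Ranalytic_near h2 t0t e2)) => s [g1 g2] t0s _.
apply: (le_trans (nc_le _)); have := g1 t0s; have := g2 t0s; rewrite cReD cReN cImD cImN /=; lra.
Qed.
End WithinLimits.

Lemma trace_cyc n (p q r : 'M[C]_n) : \tr (p *m q *m r) = \tr (q *m (r *m p)).
Proof. by rewrite -mulmxA mxtrace_mulC mulmxA. Qed.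

(* Pairing [lap a_s] with [a_t] in two ways gives
   [(lam_s - lam_t) tr (c_s a_t^* a_s) = - lam_t tr ((c_s - c_t) a_t^* a_s)], so only the
   continuity of [a] is needed. *)
Lemma flow_eigenvalue_derivative n (x y : Mat) (c : R -> Mat) (t0 : R) lam a :
  hermitian n.+1 x -> hermitian n.+1 y ->
  (forall t, Ici t0 t -> posdef n.+1 (c t)) ->
  (forall t, Ici t0 t -> Mderiv_within n.+1 (Ici t0) c t (Mopp (Lap n.+1 x y (Mlog n.+1 (c t))))) ->
  Manalytic_on n.+1 (Ici t0) a ->
  (forall t, Ici t0 t ->
        Meq n.+1 (LB n.+1 x y (c t) (a t)) (Mscal (lam t) (a t)) /\
        ipc n.+1 (c t) (a t) (a t) = Cx1) ->
  forall t, Ici t0 t ->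
       Cderiv_within (Ici t0) lam t
         (Cmul (lam t)
            (Mtr n.+1 (Mmul n.+1 (Mmul n.+1 (Madj (a t)) (a t)) (Lap n.+1 x y (Mlog n.+1 (c t)))))).
Proof.
move=> /toM_eq hx /toM_eq hy hpos hder ha he t It; rewrite !toMJ in hx hy.
have t0t := introT RleP It.
pose X := toM n.+1 x; pose Y := toM n.+1 y; pose A s := toM n.+1 (a s); pose B s := toM n.+1 (c s).
pose l s := cx (lam s).
have hB s : t0 <= s -> adjm (B s) = B s.
  by move=> /RleP /hpos [/toM_eq]; rewrite toMJ.
have eig s : t0 <= s -> lap X Y (A s) = l s *: (A s *m B s).
  by move=> /RleP s0; have [h _] := he s s0; apply/(LB_eigen _ _ _ _ (hpos s s0)).
have nrm s : t0 <= s -> \tr (B s *m (adjm (A s) *m A s)) = 1.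
  by move=> /RleP s0; have [_ h] := he s s0; rewrite -ipc_trace h.
have key s u : t0 <= s -> t0 <= u ->
    l s * \tr (B s *m (adjm (A u) *m A s)) = conjc (l u) * \tr (B u *m (adjm (A u) *m A s)).
  move=> t0s t0u; have := lap_selfadjoint (A s) (A u) hx hy.
  rewrite -/X -/Y (eig s t0s) (eig u t0u) adjmZ adjmM (hB u t0u) -scalemxAl -scalemxAr !mxtraceZ.
  by rewrite (trace_cyc (A s) (B s) (adjm (A u))) (mulmxA (A s)) (trace_cyc (A s) (B u) (adjm (A u))).
(* The pairing of an eigenvector with itself, whose norm is [1]. *)
have real u : t0 <= u -> conjc (l u) = l u.
  by move=> t0u; have := key u u t0u t0u; rewrite nrm // !mulr1; exact: esym.
have wA : wlimx t0 t A (A t).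
  move=> i j; rewrite mxE; apply: wlim_ext (Canalytic_wlim (ha i j _ _) t0t) => [s _ _||].
  - by rewrite mxE.
  - exact: elimT ssrnat.ltP (ltn_ord i).
  - exact: elimT ssrnat.ltP (ltn_ord j).
have wB : wlimx t0 t B (B t).
  move=> i j e e0; apply: near_imp (flow_cont hder t0t e0) => s h t0s _.
  by apply: le_trans (h t0s); apply: le_trans (en_entry (B s - B t) i j); rewrite !mxE.
pose dB s := (s - t)^-1%:C *: (B s - B t).
have wdB : wlimx t0 t dB (- lap X Y (toM n.+1 (Mlog n.+1 (c t)))).
  move=> i j; have /Cderiv_wlim   := hder t It i j (elimT ssrnat.ltP (ltn_ord i)) (elimT ssrnat.ltP (ltn_ord j)).
  rewrite -toM_lap -toMN [X in _ -> wlim _ _ _ X]mxE; apply: wlim_ext => s _ _.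
  by rewrite /dB /B !mxE.
pose G s := \tr (B s *m (adjm (A t) *m A s)).
have wG : wlim t0 t G 1.
  rewrite -(nrm t t0t); apply: wlim_tr; apply: (wlimxM wB).
  exact: wlimxM (wlimx_cst _ _ _) wA.
apply/Cderiv_wlim; rewrite cxM toM_tr !toMM toMJ toM_lap -/(l t) -/(A t) -/X -/Y.
apply: (wlim_quot _ wG).
have -> : l t * \tr (adjm (A t) *m A t *m lap X Y (toM n.+1 (Mlog n.+1 (c t)))) =
   (- l t) * \tr (- lap X Y (toM n.+1 (Mlog n.+1 (c t))) *m (adjm (A t) *m A t)).
  by rewrite mulNmx linearN /= mulrNN mxtrace_mulC.
have w2 := wlimM (wlim_cst t0 t (- l t)) (wlim_tr (wlimxM wdB (wlimxM (wlimx_cst t0 t (adjm (A t))) wA))).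
apply: wlim_ext w2 => s t0s st; rewrite /dB -scalemxAl mxtraceZ mulmxBl.
have -> (p q : 'M[C]_n.+1) : \tr (p - q) = \tr p - \tr q by exact: linearB.
have := key s t t0s t0t; rewrite (real t t0t) -/(G s) => k.
rewrite mulrCA -mulrA; congr (_ * _); rewrite -/(l s) -/(l t) -/(G s) mulrBl k; ring.
Qed.
End RicciFlow.

Open Scope R_scope.

Theorem theorem5p1 (n m : nat) (u v x y : Mat) (c : R -> Mat) (t0 : R) :
  (2 <= n)%nat -> (1 <= m)%nat -> (m <= n - 1)%nat -> Nat.gcd m n = 1%nat ->
  unitary n u -> unitary n v -> generates n u v ->
  Meq n (Mmul n v u) (Mscal (Cexpi (2 * PI * INR m / INR n)) (Mmul n u v)) ->
  hermitian n x -> hermitian n y ->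
  is_fcalc n (fun r => Cexpi (2 * PI * r / INR n)) x u ->
  is_fcalc n (fun r => Cexpi (2 * PI * r / INR n)) y v ->
  (* c is a Cx^1 solution in P of the Ricci flow on [t0, oo) *)
  (forall t, Ici t0 t -> posdef n (c t)) ->
  C1_on n (Ici t0) c ->
  (forall t, Ici t0 t ->
     Mderiv_within n (Ici t0) c t (Mopp (Lap n x y (Mlog n (c t))))) ->
  (* analytic choice of eigenvalues and orthonormal eigenvectors *)
  (exists (lam : nat -> R -> Cx) (a : nat -> R -> Mat),
     (forall k, (k < n * n)%nat ->
        Canalytic_on (Ici t0) (lam k) /\ Manalytic_on n (Ici t0) (a k)) /\
     (forall t, Ici t0 t ->
        (forall k, (k < n * n)%nat ->
           Meq n (LB n x y (c t) (a k t)) (Mscal (lam k t) (a k t))) /\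
        (forall k l, (k < n * n)%nat -> (l < n * n)%nat ->
           ipc n (c t) (a k t) (a l t) = if Nat.eqb k l then Cx1 else Cx0)))
  /\
  (* derivative formula for any analytic normalized eigenpair *)
  (forall (lam : R -> Cx) (a : R -> Mat),
     Canalytic_on (Ici t0) lam -> Manalytic_on n (Ici t0) a ->
     (forall t, Ici t0 t ->
        Meq n (LB n x y (c t) (a t)) (Mscal (lam t) (a t)) /\
        ipc n (c t) (a t) (a t) = Cx1) ->
     forall t, Ici t0 t ->
       Cderiv_within (Ici t0) lam t
         (Cmul (lam t)
            (Mtr n (Mmul n (Mmul n (Madj (a t)) (a t)) (Lap n x y (Mlog n (c t))))))).
Proof.
  intros hn _ _ _ _ _ _ _ hx hy _ _ hpos _ hder.
  (* The ring structure on square matrices asks for a size of the form [n.+1]. *)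
  destruct n as [|n]; [inversion hn|].
  split.
  - exact (RicciFlow.flow_eigensystem hx hy hpos hder).
  - intros lam a _ ha he.
    exact (RicciFlow.flow_eigenvalue_derivative hx hy hpos hder ha he).
Qed.
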